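(* Let $\mathbb{G}$ be a Carnot group with sub-gradient $\nabla$ and Carnot–Carathéodory distance $d$, let $d\mu=\frac1Ze^{-U(d(x))}d\lambda(x)$ be a probability measure, and let $\rho>0$. Assume $\mu$ satisfies the 2-Logarithmic Sobolev inequality $$\rho\left(\int f^2\log f^2\,d\mu-\int f^2d\mu\,\log\int f^2d\mu\right)\le 2\int|\nabla f|^2\,d\mu$$ for all (sufficiently regular) $f$. For a bounded measurable $f$ on $\mathbb{G}$ let $Q_tf(x)=\inf_{y\in\mathbb{G}}\{\frac{d(x,y)^2}{2t}+f(y)\}$ for $t>0$ and $Q_0f=f$ (the Hopf–Lax solution of $\partial_tu+\frac12|\nabla u|^2=0$, $u(\cdot,0)=f$). Then for every bounded measurable $f$, every $t\ge0$ and every $a\in\mathbb{R}$, $$\|e^{Q_tf}\|_{a+\rho t}\le\|e^{f}\|_a .$$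
   Context: A (homogeneous) Carnot group is $\mathbb{G}=(\mathbb{R}^N,\circ,\delta_\lambda)$ with dilations acting as group automorphisms and left-invariant generators $Z_1,\dots,Z_{N_1}$ (with $Z_j(0)=\partial_{x_j}|_0$) satisfying the Hörmander rank condition; sub-gradient $\nabla=(Z_1,\dots,Z_{N_1})$, $|\nabla f|=(\sum_i|Z_if|^2)^{1/2}$; $d$ is the Carnot–Carathéodory (control) distance associated to $Z_1,\dots,Z_{N_1}$, $d(x)=d(x,0)$; $U$ is an increasing function with $e^{-U(d)}$ integrable, $\lambda$ Lebesgue measure, $Z$ the normalization constant. For $a\in\mathbb{R}\setminus\{0\}$, $\|g\|_a=(\int|g|^a d\mu)^{1/a}$, and $\|g\|_0=\exp(\int\log|g|\,d\mu)$. *)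

(* Defs.v *)
From HB Require Import structures.
From mathcomp Require Import all_boot all_order all_algebra.
From mathcomp Require Import all_classical all_reals all_analysis.
Set Implicit Arguments. Unset Strict Implicit. Unset Printing Implicit Defensive.
Import Order.TTheory GRing.Theory Num.Theory.
Import numFieldNormedType.Exports.
Local Open Scope classical_set_scope.
Local Open Scope ring_scope.

Definition RN (R : realType) (N : nat) := g_sigma_algebraType (@open 'rV[R]_N).

Section Defs.
Variable R : realType.

Fixpoint iterD (V W : normedModType R) (f : V -> W) (vs : seq V) : V -> W :=
  match vs with
  | [::] => f
  | v :: vs' => fun x => 'D_v (iterD f vs') x
  end.

Definition smooth (V W : normedModType R) (f : V -> W) :=
  forall (vs : seq V), continuous (iterD f vs) /\
    (forall (v x : V), derivable (iterD f vs) x v).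

Variables N1 M : nat.
Notation N := (N1 + M)%N.
Notation pt := 'rV[R]_N.

(** j-th canonical basis vector e_j of R^N, j in the first layer. *)
Definition ej (j : 'I_N1) : pt := delta_mx 0 (lshift M j).

Definition dil (sigma : 'I_N -> nat) (l : R) (x : pt) : pt :=
  \row_i (l ^+ sigma i * x 0 i).

Variable op : pt -> pt -> pt.

Definition Zfield (j : 'I_N1) : pt -> pt := fun x => 'D_(ej j) (op x) 0.

Definition Zop (j : 'I_N1) (f : pt -> R) (x : pt) : R :=
  derive1 (fun s : R => f (op x (s *: ej j))) 0.

Definition subgrad_norm (f : pt -> R) (x : pt) : R :=
  Num.sqrt (\sum_(j < N1) (Zop j f x) ^+ 2).

Definition lie_bracket (X Y : pt -> pt) : pt -> pt :=
  fun x => 'D_(X x) Y x - 'D_(Y x) X x.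

Inductive lie_gen : (pt -> pt) -> Prop :=
| lie_gen_Z j : lie_gen (Zfield j)
| lie_gen_br X Y : lie_gen X -> lie_gen Y -> lie_gen (lie_bracket X Y).

Definition hormander :=
  forall x : pt, exists A : 'M[R]_N,
    row_full A /\ forall i, exists2 X, lie_gen X & row i A = X x.

(** Subunit paths on [0,T] (Lipschitz, equivalently absolutely continuous). *)
Definition subunit (T : R) (g : R -> pt) :=
  [lipschitz g s | s in `[0, T]] /\
  exists h : R -> 'rV[R]_N1,
    (forall s, \sum_(j < N1) (h s 0 j) ^+ 2 <= 1) /\
    {ae (@lebesgue_measure R), forall s, s \in `[0, T] ->
        derivable g s 1 /\ derive1 g s = \sum_(j < N1) h s 0 j *: Zfield j (g s)}.

Definition cc_dist (x y : pt) : R :=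
  inf [set T : R | 0 <= T /\ exists g : R -> pt, [/\ g 0 = x, g T = y & subunit T g]].

Definition hopf_lax (t : R) (f : pt -> R) (x : pt) : R :=
  if t == 0 then f x
  else inf [set cc_dist x y ^+ 2 / (2 * t) + f y | y in [set: pt]].

End Defs.

Definition Lnorm_a (R : realType) (N : nat)
    (mu : {measure set (RN R N) -> \bar R}) (a : R) (g : 'rV[R]_N -> R) : R :=
  if a == 0 then expR (Rintegral mu [set: RN R N] (fun x => ln `|g x|))
  else powR (Rintegral mu [set: RN R N] (fun x => powR `|g x| a)) a^-1.

(* Main.v *)
Require Import Defs.
From HB Require Import structures.
From mathcomp Require Import all_boot all_order all_algebra.
From mathcomp Require Import all_classical all_reals all_analysis.
From mathcomp Require Import measurable_realfun lra ring zify.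
Import Order.TTheory GRing.Theory Num.Theory.
Import numFieldNormedType.Exports.
Local Open Scope classical_set_scope.
Local Open Scope ring_scope.
Set Implicit Arguments. Unset Strict Implicit. Unset Printing Implicit Defensive.

(* For t > 0 the function Q_t f is only Lipschitz for d, so the log-Sobolev
   inequality is not available for it directly.  Mollify it on the left:
     u(t)(x) = int Q_t f(z x) phi(z) dz,
   with phi a bump function of small support and integral 1.  By invariance of
   Lebesgue measure under group translations u(t) is smooth, and since left
   translations are isometries of d it inherits
     u(t+s)(x) <= d(x,y)^2/(2s) + u(t)(y).
   Taking y = x exp(s v) along the horizontal field v = - grad u gives, for
   each x, that the one-sided time derivatives of u are at most
   - |grad u|^2/2.

   The Gibbs variational inequality for ln int e^g dmu turns this, together with
   the log-Sobolev inequality applied to e^{p u/2} (extended from compactly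
   supported functions by dilated cutoffs), into the statement that
   t |-> p^-1 ln int e^{p u(t)} dmu with p = a + rho t has a nonpositive Dini
   derivative where p <> 0: forward differences are used for p < 0 and backward
   differences for p > 0, so that u(t) is always the function inside the
   weight.  Continuity carries the monotonicity across p = 0.  Finally phi tends
   to a Dirac mass and the starting time to 0.

   The mollification argument needs d to be finite and continuous.  This is
   Chow's theorem: the vectors Ad(h) Z_j span the Lie algebra by the Hormander
   condition, so a product of finitely many conjugated horizontal exponentials
   is a local submersion at the identity, and dilations make the statement
   global. *)

(** * Smooth functions on row vectors *)

(** Smoothness only asks that all iterated directional derivatives exist and are continuous; Fréchet
    differentiability, the chain rule and Schwarz's theorem are recovered from it by mean value
    arguments. Homogeneity under the dilations does two jobs. Component i of a left-invariant field
    depends only on coordinates of weight less than [sigma i]. Hence the horizontal exponential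
    solves a triangular system and is found as a fixed point of a terminating iteration; and the
    left-invariant fields are divergence free, which yields invariance of Lebesgue measure under z
    |-> z x, the side that the left mollifier requires. Finiteness of d matters already for the
    triangle inequality: the infimum of an empty set of times is 0, so points that no path joins
    would be at distance 0. Derivatives of u in time are controlled only pointwise and from one
    side. The Dini lemmas therefore ask, at each time, for a single small step of controlled
    increase, and that step is obtained by a dominated convergence argument. In the last limit Q_t f
    stays fixed and only the exponent moves, while at the starting end Q_s f <= f is enough. *)

Section smooth_basics.
Variables (R : realType) (V W : normedModType R).
Implicit Types f : V -> W.

Lemma smooth_continuous f : smooth f -> continuous f.
Proof. by move=> /(_ [::])[]. Qed.

Lemma smooth_derivable f : smooth f -> forall v x, derivable f x v.
Proof. by move=> /(_ [::])[]. Qed.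

Lemma iterD_rcons f vs v : Defs.iterD f (rcons vs v) = Defs.iterD ('D_v f) vs.
Proof. by elim: vs => //= u vs ->. Qed.

Lemma smooth_D f v : smooth f -> smooth ('D_v f).
Proof. by move=> sf vs; rewrite -iterD_rcons. Qed.

(** Coinduction principle: each use chooses a class [P] that is stable under directional
    derivatives, often larger than the functions of interest. *)
Lemma smooth_coind (P : (V -> W) -> Prop) :
  (forall f, P f -> [/\ continuous f, forall v x, derivable f x v &
     forall v, P ('D_v f)]) -> forall f, P f -> smooth f.
Proof.
move=> HP f Pf vs.
suff : P (Defs.iterD f vs) by move=> /HP[].
by elim: vs => //= v vs /HP[].
Qed.

Lemma derivable_line f x v (s : R) : derivable f (x + s *: v) v ->
  is_derive s 1 (fun s => f (x + s *: v)) ('D_v f (x + s *: v)).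
Proof.
move=> df.
have E : (fun h : R => h^-1 *: (f (h *: v + (x + s *: v)) - f (x + s *: v))) =
  (fun h : R => h^-1 *: (f (x + (h *: (1:R^o) + s) *: v) - f (x + s *: v))).
  by apply/funext => h; rewrite scalerDl addrCA [h *: 1]mulr1.
by apply: DeriveDef; rewrite /derivable /derive -E.
Qed.

Lemma derivable_line0 f x v : derivable f x v ->
  is_derive (0 : R) 1 (fun s => f (x + s *: v)) ('D_v f x).
Proof. by move=> df; have := @derivable_line f x v 0; rewrite scale0r addr0; exact. Qed.

Lemma derivable_of_line f x v : derivable (fun s : R => f (x + s *: v)) 0 1 ->
  derivable f x v.
Proof.
move=> dl; rewrite /derivable.
have -> // : (fun h : R => h^-1 *: ((f \o shift x) (h *: v) - f x)) =
  (fun h : R => h^-1 *: (((fun s : R => f (x + s *: v)) \o shift 0) (h *: (1:R^o)) -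
    f (x + (0:R) *: v))).
by apply/funext => h /=; rewrite scale0r !addr0 [h *: 1]mulr1 (addrC x).
Qed.

End smooth_basics.
Arguments smooth_continuous {R V W f} _.
Arguments smooth_derivable {R V W f} _ _ _.
Arguments smooth_D {R V W f} v _.
Arguments smooth_coind {R V W} P _ f _.

(** * Chain rule and Fréchet differentiability *)

Section chain.
Variables (R : realType) (U V W : normedModType R).

(** Only [g] is Fréchet differentiable. Along the line x + s v the map [f] becomes a function of one
    real variable, for which having a derivative is being differentiable, so the chain rule for
    differentials applies. *)
Lemma derive_comp_diff (f : U -> V) (g : V -> W) x v :
  derivable f x v -> differentiable g (f x) ->
  is_derive x v (g \o f) ('d g (f x) ('D_v f x)).
Proof.
move=> df dg.
have dl := derivable_line0 df.
have dfl : differentiable (fun s : R => f (x + s *: v)) 0.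
  by apply/derivable1_diffP; have [] := dl.
have dg' : differentiable g (f (x + (0:R) *: v)) by rewrite scale0r addr0.
have dc := differentiable_comp dfl dg'.
apply: DeriveDef.
  by apply: derivable_of_line; apply/derivable1_diffP.
rewrite -(@derive_val _ _ _ _ _ _ _ dl).
have [dd <-] : is_derive (0 : R) 1 (fun s : R => (g \o f) (x + s *: v)) ('D_v (g \o f) x).
  apply: derivable_line0.
  by apply: derivable_of_line; apply/derivable1_diffP.
rewrite deriveE; last by apply/derivable1_diffP.
rewrite (diff_comp dfl dg') /= scale0r addr0 deriveE //.
Qed.
End chain.

Section frechet.
Variables (R : realType) (V : normedModType R).

Lemma line_MVT (f : V -> R) x v : (forall y, derivable f y v) ->
  exists2 th : R, 0 <= th <= 1 & f (x + v) - f x = 'D_v f (x + th *: v).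
Proof.
move=> df.
have dl (s : R) : is_derive s 1 (fun s => f (x + s *: v)) ('D_v f (x + s *: v)).
  exact: derivable_line.
have [c c01] := @MVT_segment R (fun s => f (x + s *: v))
  (fun s => 'D_v f (x + s *: v)) 0 1 ler01 (fun s _ => dl s)
  (derivable_within_continuous (fun s _ => (@ex_derive _ _ _ _ _ _ _ (dl s)))).
rewrite subr0 mulr1 scale1r scale0r addr0 => E; by exists c.
Qed.

(** A single directional derivative carries no linear differential; the factor comes from
    reparametrising the line by [s * k]. *)
Lemma deriveZv (f : V -> R) x v (k : R) : derivable f x v ->
  'D_(k *: v) f x = k * 'D_v f x.
Proof.
move=> df; have dl := derivable_line0 df.
have [_ <-] : is_derive (0:R) 1 ((fun s => f (x + s *: v)) \o (fun s => s * k))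
    (k * 'D_v f x).
  have d1 : is_derive (0 : R) 1 (fun s : R => s * k) k.
    rewrite (_ : (fun s : R => s * k) = k *: (@id R)); last first.
      by apply/funext => s; rewrite mulrC.
    by apply: is_derive_eq; rewrite [_ *: _]mulr1.
  have d2 : differentiable (fun s : R => f (x + s *: v)) 0.
    exact: (derivable1_diffP _ _).1 (@ex_derive _ _ _ _ _ _ _ dl).
  have e0 : (fun s : R => s * k) 0 = 0 by rewrite mul0r.
  have [d1' E1] := d1.
  have d2' : differentiable (fun s : R => f (x + s *: v)) ((fun s : R => s * k) 0).
    by rewrite e0.
  apply: is_derive_eq; first exact: (derive_comp_diff d1' d2').
  rewrite E1 e0 (_ : 'd _ _ k = 'd (fun s : R => f (x + s *: v)) 0 (k *: (1 : R^o))).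
    by rewrite linearZ -deriveE // (@derive_val _ _ _ _ _ _ _ dl).
  by rewrite [_ *: _]mulr1.
rewrite /derive; set F1 := (fun h : R => _); set F2 := (fun h : R => _).
suff -> : F1 = F2 by []; apply/funext => h; rewrite /F1 /F2 /=.
by rewrite mul0r scale0r !addr0 [h *: 1]mulr1 scalerA (addrC x).
Qed.

(** The increment is split along the broken path x, x + h v, x + h v + h u. Each leg is a mean value
    taken at a point tending to x, and continuity of both derivatives concludes. *)
Lemma deriveDv (f : V -> R) x u v : (forall v y, derivable f y v) ->
  (forall v, continuous ('D_v f)) ->
  'D_(u + v) f x = 'D_u f x + 'D_v f x.
Proof.
move=> df cf; apply/cvg_lim => //; apply/cvgrPdist_le => e e0.
have e2 : 0 < e / 2 by rewrite divr_gt0.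
have /cvgrPdist_le/(_ _ e2)/nbhs_ballP[d1 /= d10 h1] := cf u x.
have /cvgrPdist_le/(_ _ e2)/nbhs_ballP[d2 /= d20 h2] := cf v x.
have M0 : 0 < `|u| + `|v| + 1 by rewrite ltr_wpDl// addr_ge0.
near=> h.
have hn0 : h != 0 by near: h; exact: nbhs_dnbhs_neq.
have hs : `|h| < Num.min d1 d2 / (`|u| + `|v| + 1).
  by near: h; apply: dnbhs0_lt; rewrite divr_gt0// lt_min d10.
have [t1 t1I E1] := @line_MVT f (x + h *: v) (h *: u) (df _).
have [t2 t2I E2] := @line_MVT f x (h *: v) (df _).
rewrite deriveZv // in E1; rewrite deriveZv // in E2.
rewrite (_ : h *: (u + v) + x = x + h *: v + h *: u); last first.
  by rewrite scalerDr addrC addrA addrAC.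
rewrite -[f (x + h *: v + _) - _](subrKA (f (x + h *: v))) E1 E2 -mulrDr [_ *: _]mulKf//.
rewrite opprD addrACA (le_trans (ler_normD _ _))// (splitr e).
have bnd (t t' : R) : 0 <= t <= 1 -> 0 <= t' <= 1 ->
   `|t *: (h *: u) + t' *: (h *: v)| < Num.min d1 d2.
  move=> /andP[t0 t1'] /andP[t0' t1'']; move: hs; rewrite ltr_pdivlMr// => hs.
  apply: le_lt_trans hs; rewrite (le_trans (ler_normD _ _))// !normrZ.
  rewrite (ger0_norm t0) (ger0_norm t0') mulrDr mulr1 mulrDr -[leLHS]addr0.
  by rewrite lerD// lerD// ler_piMl// mulr_ge0//.
apply: lerD.
- apply: h1 => /=; rewrite -ball_normE /=.
  rewrite !opprD addrA addrA subrr add0r -opprD normrN addrC.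
  have := bnd t1 1 t1I; rewrite scale1r ler01 lexx => /(_ isT) /lt_le_trans; apply.
  by rewrite ge_min lexx.
- apply: h2 => /=; rewrite -ball_normE /=.
  rewrite !opprD addrA subrr add0r normrN.
  have := bnd 0 t2; rewrite lexx ler01 scale0r add0r => /(_ isT t2I) /lt_le_trans; apply.
  by rewrite ge_min lexx orbT.
Unshelve. all: by end_near. Qed.

End frechet.

Section rV.
Variables (R : realType) (n : nat).
Implicit Types x : 'rV[R]_n.

Lemma rV_norm_le x e : 0 <= e -> (forall j, `|x 0 j| <= e) -> `|x| <= e.
Proof.
move=> e0 H; rewrite [leLHS]/Num.Def.normr/= mx_normrE.
by rewrite (bigmax_le _ e0)//= => -[i j] _; rewrite ord1.
Qed.

Lemma rV_coord_le_norm x j : `|x 0 j| <= `|x|.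
Proof.
by rewrite [leRHS]/Num.Def.normr/= mx_normrE; exact: (le_bigmax _ _ (0, j)).
Qed.

Lemma cvg_rV (T : Type) (F : set_system T) (f : T -> 'rV[R]_n) (l : 'rV[R]_n) :
  Filter F ->
  (forall j, (fun t => f t 0 j) @ F --> l 0 j) -> f @ F --> l.
Proof.
move=> FF H; apply/cvgrPdist_le => e e0.
have : \forall t \near F, forall j, `|l 0 j - f t 0 j| <= e.
  by apply: filter_forall => j; exact: (cvgrPdist_le _ _).1 (H j) _ e0.
apply: filterS => t Ht; apply: rV_norm_le => [|j]; first exact: ltW.
by rewrite !mxE.
Qed.

Lemma cvg_sumr (T : Type) (F : set_system T) (W : normedModType R) (I : Type) (r : seq I)
    (f : I -> T -> W) (l : I -> W) : Filter F ->
  (forall i, f i @ F --> l i) ->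
  (fun t => \sum_(i <- r) f i t) @ F --> \sum_(i <- r) l i.
Proof.
move=> FF H; elim: r => [|i r IH].
  by rewrite big_nil; under eq_fun do rewrite big_nil; exact: cvg_cst.
by rewrite big_cons; under eq_fun do rewrite big_cons; exact: cvgD.
Qed.

Lemma row_sum_delta x : x = \sum_j x 0 j *: delta_mx 0 j.
Proof. exact: row_sum_delta. Qed.

Lemma rV_linear_continuous (W : normedModType R) (f : {linear 'rV[R]_n -> W}) :
  continuous f.
Proof.
move=> x; have -> : (f : _ -> W) = fun y => \sum_j y 0 j *: f (delta_mx 0 j).
  apply/funext => y; rewrite [y in LHS]row_sum_delta linear_sum.
  by apply: eq_bigr => j _; rewrite linearZ.
have FF : Filter (nbhs x) := nbhs_filter x.
apply: (@cvg_sumr _ (nbhs x)) => j; apply: cvgZr_tmp; exact: coord_continuous.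
Qed.

Definition row_form (c : 'rV[R]_n) (v : 'rV[R]_n) : R := \sum_j v 0 j * c 0 j.

Lemma row_form_linear c : linear (row_form c).
Proof.
move=> k u v; rewrite /row_form [in RHS]/GRing.scale /= mulr_sumr -big_split /=.
by apply: eq_bigr => j _; rewrite !mxE mulrDl mulrA.
Qed.

HB.instance Definition _ c :=
  GRing.isLinear.Build R 'rV[R]_n R *:%R (row_form c) (@row_form_linear c).
End rV.

Section diff_criterion.
Variables (R : realType) (V W : normedModType R).

Lemma differentiable_criterion (f : V -> W) (df : {linear V -> W}) x :
  continuous df ->
  (forall eps : R, 0 < eps ->
    \forall h \near (0 : V), `|f (h + x) - f x - df h| <= eps * `|h|) ->
  differentiable f x /\ 'd f x = df :> (V -> W).
Proof.
move=> dfc H.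
have E : f \o shift x = cst (f x) + df +o_ (0 : V) id.
  apply/eqaddoP => eps e0; have := H _ e0; apply: filterS => h.
  by rewrite !fctE /= opprD addrA.
have U := diff_unique dfc E.
split => //; apply/diff_locallyP; split; first by rewrite U.
by rewrite U.
Qed.

End diff_criterion.

Section frechet_rV.
Variables (R : realType) (n : nat).
Notation V := 'rV[R]_n.

Lemma derive_sumv (f : V -> R) x v : (forall v y, derivable f y v) ->
  (forall v, continuous ('D_v f)) ->
  'D_v f x = \sum_j v 0 j * 'D_(delta_mx 0 j) f x.
Proof.
move=> df cf; rewrite {1}[v]row_sum_delta.
elim: (index_enum _) => [|j r IH]; first by rewrite !big_nil derive0.
by rewrite !big_cons deriveDv// deriveZv// IH.
Qed.

(** Mean value theorem on the segment from x to x + h, the derivative in direction h being expanded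
    in coordinates; each partial derivative at the intermediate point is close to its value at x. *)
Lemma C1_differentiable (f : V -> R) x : (forall v y, derivable f y v) ->
  (forall v, continuous ('D_v f)) -> differentiable f x.
Proof.
move=> df cf.
have [|//] := @differentiable_criterion R V R f
  (row_form (\row_j 'D_(delta_mx 0 j) f x)) x (@rV_linear_continuous _ _ _ _).
move=> eps e0.
(* The sum of n such errors is at most [eps]; [n.+1] also serves n = 0. *)
have e1 : 0 < eps / n.+1%:R by rewrite divr_gt0.
have H : \forall y \near x, forall j : 'I_n,
   `|'D_(delta_mx 0 j) f x - 'D_(delta_mx 0 j) f y| <= eps / n.+1%:R.
  have FF : Filter (nbhs x) := nbhs_filter x.
  have := @filter_forall _ _ (fun (j : 'I_n) (y : V) =>
    `|'D_(delta_mx 0 j) f x - 'D_(delta_mx 0 j) f y| <= eps / n.+1%:R) _ FF.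
  apply => j; by have /cvgrPdist_le/(_ _ e1) := cf (delta_mx 0 j) x.
have [d /= d0 hd] := (nbhs_ballP _ _).1 H.
apply/nbhs_ballP; exists d => //= h.
rewrite -ball_normE /= sub0r normrN => hh.
have [t t01 E] := @line_MVT R V f x h (df _).
rewrite [h + x]addrC E derive_sumv// /row_form -sumrB.
under eq_bigr do rewrite mxE -mulrBr.
apply: le_trans (ler_norm_sum _ _ _) _.
apply: (@le_trans _ _ (\sum_(j < n) `|h| * (eps / n.+1%:R))).
  apply: ler_sum => j _; rewrite normrM ler_pM// ?rV_coord_le_norm//.
  rewrite distrC; apply: hd; rewrite -ball_normE /= opprD addNKr normrN.
  case/andP: t01 => t0 t1; rewrite normrZ ger0_norm//.
  by apply: le_lt_trans hh; rewrite ler_piMl.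
rewrite sumr_const card_ord -[leLHS]mulr_natr -mulrA [leRHS]mulrC ler_wpM2l//.
by rewrite mulrAC ler_pdivrMr// ler_wpM2l ?ltW// ltr_nat.
Qed.

Lemma differentiable_rVcod (E : normedModType R) (f : E -> V) x :
  (forall j, differentiable (fun y => f y 0 j) x) -> differentiable f x.
Proof.
move=> df; have -> : f = \sum_j (fun y => f y 0 j *: (delta_mx 0 j : V)).
  apply/funext => y; rewrite fct_sumE [LHS]row_sum_delta.
  by apply: eq_bigr.
by apply: differentiable_sum => j; exact: differentiableZl.
Qed.

End frechet_rV.

(** * Closure properties of smooth functions *)

Section smooth_real.
Variables (R : realType) (V : normedModType R).
Implicit Types f g : V -> R.

Lemma smooth_cst (W : normedModType R) (c : W) : smooth (fun _ : V => c).
Proof.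
pose P (f : V -> W) := exists c, f = fun _ => c.
apply: (smooth_coind P); last by exists c.
move=> _ [{}c ->]; split.
- by move=> x; exact: cvg_cst.
- by move=> v x; exact: derivable_cst.
- by move=> v; exists 0; apply/funext => x; rewrite derive_cst.
Qed.

Lemma smooth_linear (W : normedModType R) (f : {linear V -> W}) :
  continuous f -> smooth f.
Proof.
move=> cf vs; case/lastP: vs => [|vs v].
  split => // v x; apply: diff_derivable; exact: linear_differentiable.
rewrite iterD_rcons.
have -> : 'D_v f = fun _ => f v.
  apply/funext => x; rewrite deriveE; last exact: linear_differentiable.
  by rewrite diff_lin.
exact: smooth_cst.
Qed.

(** The derivative of a product is no longer a single product, so the coinductive class is the
    algebra generated by the smooth functions, which the Leibniz rule preserves. *)
Inductive smooth_span : (V -> R) -> Prop :=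
| smooth_span_base f : smooth f -> smooth_span f
| smooth_span_add f g : smooth_span f -> smooth_span g ->
    smooth_span (fun x => f x + g x)
| smooth_span_mul f g : smooth_span f -> smooth_span g ->
    smooth_span (fun x => f x * g x).

Lemma smooth_span_smooth f : smooth_span f -> smooth f.
Proof.
apply: (smooth_coind smooth_span) => {}f; elim=> {f} [f sf|f g _ [cf df Df] _ [cg dg Dg]|
    f g sf [cf df Df] sg [cg dg Dg]].
- split; [exact: smooth_continuous|exact: smooth_derivable|].
  by move=> v; apply: smooth_span_base; exact: smooth_D.
- split=> [x|v x|v].
  + exact: cvgD (cf x) (cg x).
  + exact: derivableD (df v x) (dg v x).
  + have -> : 'D_v (fun x => f x + g x) = fun x => 'D_v f x + 'D_v g x.
      by apply/funext => x; exact: deriveD (df v x) (dg v x).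
    exact: smooth_span_add.
- split=> [x|v x|v].
  + exact: cvgM (cf x) (cg x).
  + exact: derivableM (df v x) (dg v x).
  + have -> : 'D_v (fun x => f x * g x) = fun x => f x * 'D_v g x + g x * 'D_v f x.
      by apply/funext => x; exact: deriveM (df v x) (dg v x).
    by apply: smooth_span_add; exact: smooth_span_mul.
Qed.

Lemma smoothD f g : smooth f -> smooth g -> smooth (fun x => f x + g x).
Proof.
move=> sf sg; apply: smooth_span_smooth.
by apply: smooth_span_add; exact: smooth_span_base.
Qed.

Lemma smoothM f g : smooth f -> smooth g -> smooth (fun x => f x * g x).
Proof.
move=> sf sg; apply: smooth_span_smooth.
by apply: smooth_span_mul; exact: smooth_span_base.
Qed.

Lemma smoothZ f k : smooth f -> smooth (fun x => k * f x).
Proof. by move=> sf; exact: smoothM (smooth_cst k) sf. Qed.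

Lemma smoothB f g : smooth f -> smooth g -> smooth (fun x => f x - g x).
Proof.
move=> sf sg; have := smoothD sf (smoothZ (-1) sg).
by congr smooth; apply/funext => x; rewrite mulN1r.
Qed.

Lemma smooth_sum (I : Type) (r : seq I) (f : I -> V -> R) :
  (forall i, smooth (f i)) -> smooth (fun x => \sum_(i <- r) f i x).
Proof.
move=> sf; elim: r => [|i r IH].
  by under eq_fun do rewrite big_nil; exact: smooth_cst.
by under eq_fun do rewrite big_cons; exact: smoothD (sf i) IH.
Qed.

Lemma smooth_prod (I : Type) (r : seq I) (f : I -> V -> R) :
  (forall i, smooth (f i)) -> smooth (fun x => \prod_(i <- r) f i x).
Proof.
move=> sf; elim: r => [|i r IH].
  by under eq_fun do rewrite big_nil; exact: smooth_cst.
by under eq_fun do rewrite big_cons; exact: smoothM (sf i) IH.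
Qed.

Lemma smoothX f n : smooth f -> smooth (fun x => f x ^+ n).
Proof.
move=> sf; elim: n => [|n IH]; first exact: smooth_cst.
by under eq_fun do rewrite exprS; exact: smoothM sf IH.
Qed.

End smooth_real.

Section smooth_rV.
Variables (R : realType) (n : nat) (E : normedModType R).

Lemma smooth_coord (g : E -> 'rV[R]_n) j : smooth g -> smooth (fun x => g x 0 j).
Proof.
pose P (f : E -> R) := exists g : E -> 'rV[R]_n, smooth g /\ f = fun x => g x 0 j.
move=> sg; apply: (smooth_coind P); last by exists g.
move=> _ [{}g [{}sg ->]].
have dg v x := @derivable_mxP _ _ _ _ g x v.
split=> [x|v x|v].
- apply: (@continuous_comp _ _ _ g (fun M : 'rV[R]_n => M 0 j)).
    exact: smooth_continuous.
  exact: coord_continuous.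
- exact: (dg v x).1 (smooth_derivable sg v x) 0 j.
- exists ('D_v g); split; first exact: smooth_D.
  apply/funext => x; rewrite derive_mx ?mxE//; exact: smooth_derivable.
Qed.

Lemma smooth_of_coord (g : E -> 'rV[R]_n) :
  (forall j, smooth (fun x => g x 0 j)) -> smooth g.
Proof.
pose P (g : E -> 'rV[R]_n) := forall j, smooth (fun x => g x 0 j).
apply: (smooth_coind P) => {}g sg.
have dg v x : derivable g x v.
  by apply/derivable_mxP => i j; rewrite ord1; exact: smooth_derivable.
split; [move=> x|exact: dg|move=> v j].
- have FF : Filter (nbhs x) := nbhs_filter x.
  by apply: cvg_rV => j; exact: (smooth_continuous (sg j)).
- have -> : (fun x => 'D_v g x 0 j) = 'D_v (fun x => g x 0 j).
    by apply/funext => x; rewrite derive_mx// mxE.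
  exact: smooth_D.
Qed.

Lemma smooth_differentiable (f : 'rV[R]_n -> R) x : smooth f -> differentiable f x.
Proof.
move=> sf; apply: C1_differentiable => [v y|v]; first exact: smooth_derivable.
by apply: smooth_continuous; exact: smooth_D.
Qed.

Lemma derive_comp_rV (f : 'rV[R]_n -> R) (g : E -> 'rV[R]_n) x v :
  smooth f -> derivable g x v ->
  is_derive x v (f \o g) (\sum_j ('D_v g x) 0 j * 'D_(delta_mx 0 j) f (g x)).
Proof.
move=> sf dg; have df := smooth_differentiable (g x) sf.
apply: is_derive_eq; first exact: derive_comp_diff.
rewrite -deriveE// derive_sumv// => [u y|u]; first exact: smooth_derivable.
by apply: smooth_continuous; exact: smooth_D.
Qed.

(** By the chain rule a derivative of a composite is a sum of products of components of ['D_v g]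
    with new composites; the algebra generated by composites with [g] and smooth functions is
    therefore stable. *)
Inductive comp_span (g : E -> 'rV[R]_n) : (E -> R) -> Prop :=
| comp_span_comp f : smooth f -> comp_span g (fun x => f (g x))
| comp_span_base f : smooth f -> comp_span g f
| comp_span_add f h : comp_span g f -> comp_span g h ->
    comp_span g (fun x => f x + h x)
| comp_span_mul f h : comp_span g f -> comp_span g h ->
    comp_span g (fun x => f x * h x).

Lemma comp_span_sum g (I : Type) (r : seq I) (f : I -> E -> R) :
  (forall i, comp_span g (f i)) -> comp_span g (fun x => \sum_(i <- r) f i x).
Proof.
move=> sf; elim: r => [|i r IH].
  by under eq_fun do rewrite big_nil; apply: comp_span_base; exact: smooth_cst.
by under eq_fun do rewrite big_cons; exact: comp_span_add.
Qed.

Lemma smooth_comp_rV (f : 'rV[R]_n -> R) (g : E -> 'rV[R]_n) :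
  smooth f -> smooth g -> smooth (fun x => f (g x)).
Proof.
move=> sf sg; suff : forall h, comp_span g h -> smooth h.
  by apply; exact: comp_span_comp.
apply: (smooth_coind (comp_span g)) => h; elim=> {h f sf} [f sf|f sf|f h _ [cf df Df] _ [cg dg Dg]|
    f h sf [cf df Df] sh [cg dg Dg]].
- have D v x := derive_comp_rV sf (smooth_derivable sg v x).
  split=> [x|v x|v].
  + apply: (@continuous_comp _ _ _ g f); first exact: smooth_continuous.
    exact: smooth_continuous.
  + by have [] := D v x.
  + have -> : 'D_v (fun x => f (g x)) =
        fun x => \sum_j ('D_v g x) 0 j * 'D_(delta_mx 0 j) f (g x).
      by apply/funext => x; have [_ <-] := D v x.
    apply: comp_span_sum => j; apply: comp_span_mul.
      by apply: comp_span_base; apply: smooth_coord; exact: smooth_D.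
    exact: (@comp_span_comp g _ (smooth_D _ sf)).
- split; [exact: smooth_continuous|exact: smooth_derivable|].
  by move=> v; apply: comp_span_base; exact: smooth_D.
- split=> [x|v x|v].
  + exact: cvgD (cf x) (cg x).
  + exact: derivableD (df v x) (dg v x).
  + have -> : 'D_v (fun x => f x + h x) = fun x => 'D_v f x + 'D_v h x.
      by apply/funext => x; exact: deriveD (df v x) (dg v x).
    exact: comp_span_add.
- split=> [x|v x|v].
  + exact: cvgM (cf x) (cg x).
  + exact: derivableM (df v x) (dg v x).
  + have -> : 'D_v (fun x => f x * h x) = fun x => f x * 'D_v h x + h x * 'D_v f x.
      by apply/funext => x; exact: deriveM (df v x) (dg v x).
    by apply: comp_span_add; exact: comp_span_mul.
Qed.

End smooth_rV.

Section smooth_more.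
Variable R : realType.

Lemma is_derive_shiftv (V W : normedModType R) (f : V -> W) c x v :
  derivable f (x + c) v -> is_derive x v (fun y => f (y + c)) ('D_v f (x + c)).
Proof.
move=> df.
have E : (fun h : R => h^-1 *: (f (h *: v + (x + c)) - f (x + c))) =
  (fun h : R => h^-1 *: (f (h *: v + x + c) - f (x + c))).
  by apply/funext => h; rewrite addrA.
by apply: DeriveDef; rewrite /derivable /derive -E.
Qed.

Lemma is_derive_comp_linear (U V W : normedModType R) (f : V -> W)
    (T : {linear U -> V}) x v :
  derivable f (T x) (T v) -> is_derive x v (fun y => f (T y)) ('D_(T v) f (T x)).
Proof.
move=> df.
have E : (fun h : R => h^-1 *: (f (h *: T v + T x) - f (T x))) =
  (fun h : R => h^-1 *: (f (T (h *: v + x)) - f (T x))).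
  by apply/funext => h; rewrite linearP.
by apply: DeriveDef; rewrite /derivable /derive -E.
Qed.

Lemma smooth_comp_linear (U V W : normedModType R) (f : V -> W)
    (T : {linear U -> V}) : continuous T -> smooth f -> smooth (fun y => f (T y)).
Proof.
move=> cT sf; pose P (h : U -> W) := exists g, smooth g /\ h = fun y => g (T y).
apply: (smooth_coind P); last by exists f.
move=> _ [g [sg ->]]; split.
- move=> x; apply: (@continuous_comp _ _ _ T g); first exact: cT.
  exact: smooth_continuous sg _.
- move=> v x.
  by have [] := @is_derive_comp_linear _ _ _ g T x v (smooth_derivable sg _ _).
- move=> v; exists ('D_(T v) g); split; first exact: smooth_D.
  apply/funext => x.
  by have [_ <-] := @is_derive_comp_linear _ _ _ g T x v (smooth_derivable sg _ _).
Qed.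

Lemma smooth_comp (n m : nat) (E : normedModType R) (f : 'rV[R]_n -> 'rV[R]_m)
    (g : E -> 'rV[R]_n) : smooth f -> smooth g -> smooth (fun x => f (g x)).
Proof.
move=> sf sg; apply: smooth_of_coord => j.
exact: smooth_comp_rV (smooth_coord j sf) sg.
Qed.

(** Carries functions of two vectors, such as the group law, to functions of one row vector, where
    the composition theorem is available. *)
Definition unrow n m (p : 'rV[R]_(n + m)) : 'rV[R]_n * 'rV[R]_m := (lsubmx p, rsubmx p).

Lemma unrow_linear n m : linear (@unrow n m).
Proof. by move=> k u v; rewrite /unrow !linearP. Qed.
HB.instance Definition _ n m :=
  GRing.isLinear.Build R _ _ *:%R (@unrow n m) (@unrow_linear n m).

Lemma smooth_comp_pair (n m : nat) (W E : normedModType R)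
    (f : 'rV[R]_n * 'rV[R]_m -> R) (g1 : E -> 'rV[R]_n) (g2 : E -> 'rV[R]_m) :
  smooth f -> smooth g1 -> smooth g2 -> smooth (fun x => f (g1 x, g2 x)).
Proof.
move=> sf s1 s2.
have sT : smooth (fun y => f (@unrow n m y)).
  by apply: smooth_comp_linear => //; exact: rV_linear_continuous.
have sg : smooth (fun x => row_mx (g1 x) (g2 x)).
  apply: smooth_of_coord => j; under eq_fun do rewrite mxE.
  by case: (fintype.split j) => k; exact: smooth_coord.
have := smooth_comp_rV sT sg; congr smooth; apply/funext => x.
by rewrite /unrow row_mxKl row_mxKr.
Qed.

Lemma smooth_comp_op (n m k : nat) (E : normedModType R)
    (f : 'rV[R]_n -> 'rV[R]_m -> 'rV[R]_k) (g1 : E -> 'rV[R]_n) (g2 : E -> 'rV[R]_m) :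
  smooth (fun p : 'rV[R]_n * 'rV[R]_m => f p.1 p.2) ->
  smooth g1 -> smooth g2 -> smooth (fun x => f (g1 x) (g2 x)).
Proof.
move=> sf s1 s2; apply: smooth_of_coord => j.
exact: smooth_comp_pair (smooth_coord j sf) s1 s2.
Qed.

Lemma smooth_id (V : normedModType R) : smooth (fun x : V => x).
Proof. exact: (@smooth_linear R V V idfun (fun x => @cvg_id _ _)). Qed.

Lemma smooth_fst (U V : normedModType R) : smooth (fun x : U * V => x.1).
Proof. exact: (@smooth_linear R _ _ fst (fun x => @cvg_fst _ _ _ _ _)). Qed.

Lemma smooth_snd (U V : normedModType R) : smooth (fun x : U * V => x.2).
Proof. exact: (@smooth_linear R _ _ snd (fun x => @cvg_snd _ _ _ _ _)). Qed.

Lemma differentiable_smooth n m (f : 'rV[R]_n -> 'rV[R]_m) x :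
  smooth f -> differentiable f x.
Proof.
move=> sf; apply: differentiable_rVcod => j.
exact: smooth_differentiable (smooth_coord j sf).
Qed.

Lemma smooth_comp1 (E : normedModType R) (f : R -> R) (g : E -> R) :
  smooth f -> smooth g -> smooth (fun x => f (g x)).
Proof.
move=> sf sg.
have sT : smooth (fun y : 'rV[R]_1 => f (row_form 1 y)).
  by apply: smooth_comp_linear => //; exact: rV_linear_continuous.
have sg' : smooth (fun x => (\row_(j < 1) g x)).
  by apply: smooth_of_coord => j; under eq_fun do rewrite mxE.
have := smooth_comp_rV sT sg'; congr smooth; apply/funext => x.
by rewrite /row_form big_ord1 !mxE mulr1.
Qed.

(** Two mean values: along [u] for the difference of [f] in direction [v], then along [v] for
    ['D_u f]. *)
Lemma second_difference (V : normedModType R) (f : V -> R) x u v (h : R) : smooth f ->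
  exists t1 t2 : R, [/\ 0 <= t1 <= 1, 0 <= t2 <= 1 &
    f (x + h *: u + h *: v) - f (x + h *: u) - (f (x + h *: v) - f x) =
    h * (h * 'D_v ('D_u f) (x + t1 *: (h *: u) + t2 *: (h *: v)))].
Proof.
move=> sf; pose k y := f (y + h *: v) - f y.
have dk y : is_derive y (h *: u) k ('D_(h *: u) f (y + h *: v) - 'D_(h *: u) f y).
  have df := smooth_derivable sf.
  have [d1 e1] := @is_derive_shiftv V R f (h *: v) y (h *: u) (df _ _).
  by apply: DeriveDef; [exact: derivableB d1 (df _ _)|rewrite [LHS](deriveB d1 (df _ _)) e1].
have [t1 t1I] := @line_MVT R V k x (h *: u) (fun y => @ex_derive _ _ _ _ _ _ _ (dk y)).
have [_ ->] := dk (x + t1 *: (h *: u)).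
rewrite /k !deriveZv; try exact: smooth_derivable.
have sf' := smooth_D u sf.
have [t2 t2I] := @line_MVT R V ('D_u f) (x + t1 *: (h *: u)) (h *: v)
  (fun y => smooth_derivable sf' _ _).
rewrite deriveZv; last exact: smooth_derivable.
by move=> E ->; exists t1, t2; split => //; rewrite -E mulrBr.
Qed.

(** The second difference is symmetric in [u] and [v], so the two mixed derivatives agree at a pair
    of points as close to x as desired; continuity brings both points to x. *)
Lemma schwarz (V : normedModType R) (f : V -> R) x u v : smooth f ->
  'D_v ('D_u f) x = 'D_u ('D_v f) x.
Proof.
move=> sf; apply/eqP; rewrite -subr_eq0 -normr_le0; apply/ler_addgt0Pl => e e0.
rewrite addr0.
have e2 : 0 < e / 2 by rewrite divr_gt0.
have c1 := smooth_continuous (smooth_D v (smooth_D u sf)) x.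
have c2 := smooth_continuous (smooth_D u (smooth_D v sf)) x.
move/cvgrPdist_le/(_ _ e2)/nbhs_ballP : c1 => [d1 /= d10 h1].
move/cvgrPdist_le/(_ _ e2)/nbhs_ballP : c2 => [d2 /= d20 h2].
have M0 : 0 < `|u| + `|v| + 1 by rewrite ltr_wpDl// addr_ge0.
have [h h0 hM] : exists2 h : R, 0 < h & h * (`|u| + `|v|) < Num.min d1 d2.
  have m0 : 0 < Num.min d1 d2 by rewrite lt_min d10.
  exists (Num.min d1 d2 / (`|u| + `|v| + 1)); first by rewrite divr_gt0.
  by rewrite mulrAC ltr_pdivrMr// ltr_pM2l// ltrDl.
have bnd (t t' : R) (a b : V) : `|a| + `|b| <= `|u| + `|v| ->
   0 <= t <= 1 -> 0 <= t' <= 1 ->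
   `|t *: (h *: a) + t' *: (h *: b)| < Num.min d1 d2.
  move=> ab /andP[t0 t1'] /andP[t0' t1'']; apply: le_lt_trans hM.
  rewrite (le_trans (ler_normD _ _))// !normrZ (ger0_norm t0) (ger0_norm t0').
  rewrite (ger0_norm (ltW h0)) (@le_trans _ _ (h * (`|a| + `|b|)))//.
    by rewrite mulrDr lerD// ler_piMl// mulr_ge0// ltW.
  by rewrite ler_pM2l.
have [t1 [t2 [I1 I2 E1]]] := second_difference x u v h sf.
have [s1 [s2 [J1 J2 E2]]] := second_difference x v u h sf.
have EE : 'D_v ('D_u f) (x + t1 *: (h *: u) + t2 *: (h *: v)) =
          'D_u ('D_v f) (x + s1 *: (h *: v) + s2 *: (h *: u)).
  apply: (mulfI (lt0r_neq0 h0)); apply: (mulfI (lt0r_neq0 h0)).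
  apply: etrans (esym E1) _; apply: etrans E2.
  rewrite (addrAC x (h *: v)) -!(addrA (f _)); congr (_ + _).
  by rewrite !opprB [LHS]addrCA [RHS]addrCA; congr (_ + _); exact: addrC.
rewrite -(subrKA ('D_v ('D_u f) (x + t1 *: (h *: u) + t2 *: (h *: v)))).
apply: (le_trans (ler_normD _ _)); rewrite (splitr e); apply: lerD.
- apply: h1; rewrite -ball_normE /= -addrA opprD addNKr normrN.
  by apply: (lt_le_trans (bnd _ _ _ _ _ I1 I2)); rewrite ?ge_min ?lexx.
- rewrite EE distrC; apply: h2; rewrite -ball_normE /= -addrA opprD addNKr normrN.
  apply: (lt_le_trans (bnd _ _ _ _ _ J1 J2)); first by rewrite addrC.
  by rewrite ge_min lexx orbT.
Qed.

End smooth_more.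

(** * Functions flat at the origin *)

Section flat.
Variable R : realType.

(** The factor s^(-k) makes the family stable, up to linear combinations, under differentiation;
    bumps are built from k = 0. *)
Definition flat (k : nat) (s : R) : R := if 0 < s then s ^- k * expR (- s^-1) else 0.

Lemma flat_ge0 k s : 0 <= flat k s.
Proof.
rewrite /flat; case: ifP => // s0.
by rewrite mulr_ge0 ?expR_ge0// invr_ge0 exprn_ge0// ltW.
Qed.

Lemma flat_gt0 k s : (0 < flat k s) = (0 < s).
Proof.
rewrite /flat; case: ifP => [s0|_]; last by rewrite ltxx.
by rewrite mulr_gt0 ?expR_gt0// invr_gt0 exprn_gt0.
Qed.

Lemma flat0_le1 s : flat 0 s <= 1.
Proof.
rewrite /flat; case: ifP => // s0; rewrite expr0 invr1 mul1r -expR0 ler_expR.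
by rewrite oppr_le0 invr_ge0 ltW.
Qed.

(** One term of the exponential series gives e^(1/s) >= s^-(k+2) / (k+2)!. The quadratic bound
    forces the difference quotient at 0 to tend to 0. *)
Lemma flat_le_sqr k : exists C, forall s, flat k s <= C * s ^+ 2.
Proof.
exists (k.+2)`!%:R => s; rewrite /flat; case: ifP => [s0|_]; last first.
  by rewrite mulr_ge0// sqr_ge0.
have sV : 0 <= s^-1 by rewrite invr_ge0 ltW.
have := expR_ge1Dxn k.+1 sV; rewrite exprVn => H.
have {}H : s ^- k.+2 / (k.+2)`!%:R <= expR s^-1.
  by apply: le_trans H; rewrite lerDr.
have f0 : 0 < (k.+2)`!%:R :> R by rewrite ltr0n fact_gt0.
rewrite expRN -ler_pdivlMl ?exprn_gt0// ?invr_gt0 ?exprn_gt0// invrK.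
rewrite mulrCA -exprD addn2 -(invrK (_ * s ^+ k.+2)) lef_pV2 ?posrE ?expR_gt0//; last first.
  by rewrite invr_gt0 mulr_gt0// exprn_gt0.
by rewrite invfM mulrC.
Qed.


Lemma is_derive1_flat k (s : R) :
  is_derive s 1 (flat k) (flat k.+2 s - k%:R * flat k.+1 s).
Proof.
have [s0|s0|->] := ltgtP s 0.
- have -> : flat k.+2 s - k%:R * flat k.+1 s = 0.
    by rewrite /flat ltNge ltW//= mulr0 subr0.
  apply: near_eq_is_derive (is_derive_cst (0 : R) s 1).
  near=> x; rewrite /flat ifF//; apply/negbTE; rewrite -leNgt; apply: ltW.
  by near: x; exact: lt_nbhsl.
- apply: (@near_eq_is_derive R R R (fun s : R => s^-1 ^+ k * expR (- s^-1))).
    near=> x; rewrite /flat ifT ?exprVn//.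
    by near: x; exact: lt_nbhsr.
  have sn0 : s != 0 by rewrite gt_eqF.
  have d1 : is_derive s 1 (fun s : R => s^-1) (- s ^- 2).
    have := @is_deriveV R id s 1 1 sn0 (is_derive_id s 1).
    by rewrite [_ *: _]mulr1.
  have d2 : is_derive s 1 (fun s : R => expR (- s^-1)) (s ^- 2 * expR (- s^-1)).
    have d1N : is_derive s 1 (fun s : R => - s^-1) (- - s ^- 2) := is_deriveN d1.
    have := @is_derive1_comp R expR (fun s => - s^-1) s _ _ (is_derive_expR _) d1N.
    by rewrite opprK [_ * s ^- 2]mulrC.
  have := is_deriveM (is_deriveX k d1) d2; congr is_derive.
    by apply/funext => y; rewrite mulrfctE exprfctE.
  rewrite exprfctE /flat s0 /GRing.scale/= -!exprVn.
  case: k => [|k] /=; first by rewrite !expr0; ring.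
  by rewrite !exprS; ring.
have f0 j : flat j 0 = 0 by rewrite /flat ltxx.
rewrite !f0 mulr0 subr0.
have [C HC] := flat_le_sqr k.
have cvC : (fun h : R => `|C| * `|h|) @ (0 : R)^' --> (0 : R).
  apply: cvg_within_filter.
  have : (fun h : R => `|C| * `|h|) @ (0 : R) --> `|C| * `|0 : R|.
    have F0 : Filter (nbhs (0 : R)) := nbhs_filter _.
    by apply: cvgM; [exact: cvg_cst|apply: cvg_norm; exact: cvg_id].
  by rewrite normr0 mulr0.
have H : (fun h : R => h^-1 *: (flat k (h *: 1 + 0) - flat k 0)) @ 0^' --> (0 : R).
  apply: (@squeeze_cvgr _ _ _ _ (fun h => - (`|C| * `|h|)) (fun h => `|C| * `|h|)).
  - near=> h; rewrite -ler_norml f0 subr0 addr0 [h *: 1]mulr1 normrM normfV.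
    have h0 : h != 0 by near: h; exact: nbhs_dnbhs_neq.
    rewrite ler_pdivrMl ?normr_gt0// (ger0_norm (flat_ge0 _ _)) (le_trans (HC h))//.
    have -> : `|h| * (`|C| * `|h|) = `|C| * h ^+ 2.
      by rewrite -(real_normK (num_real h)); ring.
    rewrite ler_wpM2r ?sqr_ge0//.
    exact: ler_norm.
  - have F0 : Filter ((0 : R)^') := dnbhs_filter _.
    by have := @cvgN _ _ _ _ F0 _ _ cvC; rewrite oppr0.
  - exact: cvC.
by apply: DeriveDef; [exact: cvgP H|exact: cvg_lim H].
Unshelve. all: by end_near.
Qed.

Lemma smooth_flat k : smooth (flat k).
Proof.
pose P (f : R -> R) := exists s : seq (R * nat), f = fun x => \sum_(p <- s) p.1 * flat p.2 x.
have D1 v j x : is_derive x v (flat j) (v * (flat j.+2 x - j%:R * flat j.+1 x)).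
  have d := is_derive1_flat j x.
  have dd : differentiable (flat j) x by apply/derivable1_diffP; have [] := d.
  apply: DeriveDef; first exact: diff_derivable.
  have {1}-> : v = v *: 1 by rewrite [RHS]mulr1.
  by rewrite deriveE// linearZ/= -deriveE// (@derive_val _ _ _ _ _ _ _ d).
apply: (smooth_coind P); last first.
  by exists [:: (1, k)]; apply/funext => x; rewrite big_seq1 mul1r.
move=> _ [s ->].
have D v x : is_derive x v (fun x => \sum_(p <- s) p.1 * flat p.2 x)
    (\sum_(p <- s) p.1 * (v * (flat p.2.+2 x - p.2%:R * flat p.2.+1 x))).
  elim: s => [|p s IH].
    under eq_fun do rewrite big_nil.
    by rewrite big_nil; exact: is_derive_cst.
  under eq_fun do rewrite big_cons.
  rewrite big_cons; apply: is_deriveD.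
split.
- move=> x; apply: differentiable_continuous; apply/derivable1_diffP.
  by have [] := D 1 x.
- by move=> v x; have [] := D v x.
move=> v; exists (flatten [seq [:: (p.1 * v, p.2.+2); (- (p.1 * v * p.2%:R), p.2.+1)] | p <- s]).
apply/funext => x; have [_ ->] := D v x.
rewrite big_flatten big_map; apply: eq_bigr => p _.
by rewrite !big_cons big_nil /=; ring.
Qed.

End flat.

Lemma smooth_expR (R : realType) : smooth (@expR R).
Proof.
pose P (f : R -> R) := exists c : R, f = fun x => c * expR x.
apply: (smooth_coind P); last by exists 1; apply/funext => x; rewrite mul1r.
move=> _ [c ->].
have D v x : is_derive x v (fun x => c * expR x) (c * (v * expR x)).
  have d := is_derive_expR x.
  have dd : differentiable (@expR R) x by apply/derivable1_diffP; have [] := d.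
  have De : is_derive x v (@expR R) (v * expR x).
    apply: DeriveDef; first exact: diff_derivable.
    have {1}-> : v = v *: 1 by rewrite [RHS]mulr1.
    by rewrite deriveE// linearZ/= -deriveE// (@derive_val _ _ _ _ _ _ _ d).
  exact: is_deriveZ.
split.
- move=> x; apply: differentiable_continuous; apply/derivable1_diffP.
  by have [] := D 1 x.
- by move=> v x; have [] := D v x.
- move=> v; exists (c * v); apply/funext => x; have [_ ->] := D v x.
  by rewrite mulrA.
Qed.

(** * Horizontal exponentials *)

(** A directional derivative sees only the values along its line, so it can be moved between
    different domains, for instance from one slot of a two-variable map to the product space. *)
Lemma derive_eq_along (R : realType) (U V W : normedModType R) (f : U -> W) (g : V -> W)
    x v y w :
  (forall h : R, f (h *: v + x) = g (h *: w + y)) -> 'D_v f x = 'D_w g y.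
Proof.
move=> H; have := H 0; rewrite !scale0r !add0r => H0.
rewrite /derive; set F1 := (fun h : R => _); set F2 := (fun h : R => _).
by suff -> : F1 = F2 by []; apply/funext => h; rewrite /F1 /F2 /= H H0.
Qed.

#[local] Opaque smooth derive derivable.

Section derive_more.
Variable R : realType.

Lemma derive_pair2 (U V W : normedModType R) (F : U -> V -> W) x y v :
  'D_v (F x) y = 'D_((0, v) : U * V) (fun p : U * V => F p.1 p.2) (x, y).
Proof. by apply: derive_eq_along => h /=; rewrite scaler0 add0r. Qed.

Lemma derive_pair1 (U V W : normedModType R) (F : U -> V -> W) x y v :
  'D_v (F ^~ y) x = 'D_((v, 0) : U * V) (fun p : U * V => F p.1 p.2) (x, y).
Proof. by apply: derive_eq_along => h /=; rewrite scaler0 add0r. Qed.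

Lemma derive_coord (E : normedModType R) n (f : E -> 'rV[R]_n) x v j :
  derivable f x v -> 'D_v (fun y => f y 0 j) x = ('D_v f x) 0 j.
Proof. by move=> df; rewrite derive_mx// mxE. Qed.

Lemma derive_smooth_linear n m (f : 'rV[R]_n -> 'rV[R]_m) x k u v : smooth f ->
  'D_(k *: u + v) f x = k *: 'D_u f x + 'D_v f x.
Proof.
by move=> sf; rewrite !deriveE ?linearP//; exact: differentiable_smooth.
Qed.

Lemma derive_smoothZ n m (f : 'rV[R]_n -> 'rV[R]_m) x k u : smooth f ->
  'D_(k *: u) f x = k *: 'D_u f x.
Proof.
by move=> sf; have := derive_smooth_linear x k u 0 sf; rewrite derive0 !addr0.
Qed.

Lemma derive_linear (V W : normedModType R) (f : {linear V -> W}) x v :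
  continuous f -> 'D_v f x = f v.
Proof.
move=> cf; rewrite deriveE ?diff_lin//; exact: linear_differentiable.
Qed.

Lemma derive_smooth_sum n m (f : 'rV[R]_n -> 'rV[R]_m) x v : smooth f ->
  'D_v f x = \sum_j v 0 j *: 'D_(delta_mx 0 j) f x.
Proof.
move=> sf; rewrite deriveE; last exact: differentiable_smooth.
rewrite {1}[v]row_sum_delta linear_sum; apply: eq_bigr => j _.
by rewrite linearZ deriveE//; exact: differentiable_smooth.
Qed.

Lemma is_derive_comp_smooth (E : normedModType R) n m (f : E -> 'rV[R]_n)
    (g : 'rV[R]_n -> 'rV[R]_m) x v df : smooth g -> is_derive x v f df ->
  is_derive x v (fun y => g (f y)) ('D_df g (f x)).
Proof.
move=> sg [dfx <-]; have dg := differentiable_smooth (f x) sg.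
by rewrite [X in is_derive _ _ _ X]deriveE//; exact: derive_comp_diff.
Qed.

Lemma is_derive_comp_smoothR (E : normedModType R) n (f : E -> 'rV[R]_n)
    (g : 'rV[R]_n -> R) x v df : smooth g -> is_derive x v f df ->
  is_derive x v (fun y => g (f y)) ('D_df g (f x)).
Proof.
move=> sg [dfx <-]; have dg := smooth_differentiable (f x) sg.
by rewrite [X in is_derive _ _ _ X]deriveE//; exact: derive_comp_diff.
Qed.

End derive_more.

(** * Functions homogeneous under the dilations *)

Section homogeneity.
Variables (R : realType) (N1 M : nat).
Notation N := (N1 + M)%N.
Notation pt := 'rV[R]_N.
Variable sigma : 'I_N -> nat.
Hypothesis sigma_gt0 : forall i, (0 < sigma i)%N.
Notation dil := (@dil R N1 M sigma).

Lemma dil_linear l : linear (dil l).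
Proof.
by move=> k u v; apply/rowP => i; rewrite !mxE mulrDr mulrCA.
Qed.
HB.instance Definition _ l := GRing.isLinear.Build R pt pt *:%R (dil l) (@dil_linear l).

Lemma dil_delta l q : dil l (delta_mx 0 q) = l ^+ sigma q *: delta_mx 0 q.
Proof.
apply/rowP => i; rewrite !mxE eqxx /=.
by case: eqVneq => [->|_] //=; rewrite !mulr0.
Qed.

Lemma dil0 l : dil l 0 = 0. Proof. exact: linear0. Qed.

Lemma dil1 x : dil 1 x = x.
Proof. by apply/rowP => i; rewrite mxE expr1n mul1r. Qed.

Lemma dil_0 x : dil 0 x = 0.
Proof. by apply/rowP => i; rewrite !mxE expr0n gtn_eqF// mul0r. Qed.

Lemma dilM l m x : dil l (dil m x) = dil (l * m) x.
Proof. by apply/rowP => i; rewrite !mxE exprMn mulrA. Qed.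

Lemma smooth_dil_curve x : smooth (fun s => dil s x).
Proof.
apply: smooth_of_coord => j; under eq_fun do rewrite mxE mulrC.
by apply: smoothZ; apply: smoothX; exact: smooth_id.
Qed.

Lemma is_derive_dil_curve x (s : R) : is_derive s 1 (fun s => dil s x)
  (\row_i ((sigma i)%:R * s ^+ (sigma i).-1 * x 0 i)).
Proof.
have ds := smooth_derivable (smooth_dil_curve x) 1 s.
apply: DeriveDef => //; rewrite derive_mx//; apply/matrixP => i j.
rewrite ord1 !mxE.
have -> : (fun t => dil t x 0 j) = x 0 j *: (fun t : R => t ^+ sigma j).
  by apply/funext => t; rewrite mxE mulrC.
rewrite deriveZ; last exact: exprn_derivable.
by rewrite exp_derive [_ *: 1]mulr1 [_ *: _]mulrC.
Qed.

(** Homogeneity of degree m - p, written without subtraction so that negative degrees are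
    included. *)
Definition homogeneous (p m : nat) (f : pt -> R) :=
  forall l : R, 0 < l -> forall x, l ^+ p * f (dil l x) = l ^+ m * f x.

Lemma homogeneous_derive p m f q : smooth f -> homogeneous p m f ->
  homogeneous (p + sigma q) m ('D_(delta_mx 0 q) f).
Proof.
move=> sf hf l l0 x; have df := smooth_derivable sf.
have [_ E] : is_derive x (delta_mx 0 q) (fun y => f (dil l y))
    (l ^+ sigma q * 'D_(delta_mx 0 q) f (dil l x)).
  apply: is_derive_eq; first exact: is_derive_comp_linear (df _ _).
  by rewrite /= dil_delta deriveZv.
have dfl : derivable (fun y => f (dil l y)) x (delta_mx 0 q).
  by have [] := @is_derive_comp_linear R _ _ _ f (dil l) x (delta_mx 0 q) (df _ _).
have : (l ^+ p *: (fun y => f (dil l y))) = l ^+ m *: f.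
  by apply/funext => y; exact: hf.
move/(congr1 (fun g => 'D_(delta_mx 0 q) g x)).
by rewrite (deriveZ _ dfl) (deriveZ _ (df _ _)) E exprD -mulrA.
Qed.

(** A continuous function of negative degree vanishes: l^(p-m) f([dil l x]) equals f x for every l >
    0 and is 0 at l = 0. *)
Lemma homogeneous_eq0 p m f : smooth f -> homogeneous p m f -> (m < p)%N ->
  f = fun=> 0.
Proof.
move=> sf hf mp; apply/funext => x.
pose g (l : R) := l ^+ (p - m) * f (dil l x).
have gc : continuous g.
  apply: smooth_continuous; apply: smoothM.
    by apply: smoothX; exact: smooth_id.
  exact: smooth_comp_rV sf (smooth_dil_curve x).
have g0 : g 0 = 0 by rewrite /g expr0n gtn_eqF ?subn_gt0// mul0r.
have gE l : 0 < l -> g l = f x.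
  move=> l0; have lm : l ^+ m != 0 by rewrite expf_neq0// gt_eqF.
  by apply: (mulfI lm); rewrite -hf// /g mulrA -exprD subnKC// ltnW.
apply/eqP; rewrite -normr_le0; apply/ler_addgt0Pl => e e0; rewrite addr0.
have /cvgrPdist_le/(_ _ e0)/nbhs_ballP[d /= d0 hd] := gc 0.
have := hd (d / 2); rewrite g0 gE ?divr_gt0// sub0r normrN; apply.
rewrite -ball_normE /= sub0r normrN gtr0_norm ?divr_gt0//.
by rewrite ltr_pdivrMr// ltr_pMr// ltr1n.
Qed.

Lemma homogeneous_derive_eq0 p m f q x : smooth f -> homogeneous p m f ->
  (m < p + sigma q)%N -> 'D_(delta_mx 0 q) f x = 0.
Proof.
move=> sf hf mp.
by have /(congr1 (@^~ x)) := homogeneous_eq0 (smooth_D _ sf) (homogeneous_derive q sf hf) mp.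
Qed.

(** A derivative along a coordinate whose weight exceeds the degree m - p has negative degree, hence
    vanishes; by the mean value theorem [f] ignores such coordinates. *)
Lemma homogeneous_local p m f (x y : pt) : smooth f -> homogeneous p m f ->
  (forall q, (p + sigma q <= m)%N -> x 0 q = y 0 q) -> f x = f y.
Proof.
move=> sf hf xy; apply/esym/eqP; rewrite -subr_eq0; apply/eqP.
have df := smooth_derivable sf.
have [t _ E] := @line_MVT R _ f x (y - x) (fun z => df _ z).
rewrite (addrC x) subrK in E; rewrite E derive_sumv//; last first.
  by move=> v; apply: smooth_continuous; exact: smooth_D.
apply: big1 => q _; case: (leqP (p + sigma q) m) => [/xy e|mq].
  by rewrite !mxE e subrr mul0r.
by rewrite (homogeneous_derive_eq0 _ sf hf mq) mulr0.
Qed.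

Lemma is_derive_along_dil f x (s : R) : smooth f ->
  is_derive s 1 (fun s => f (dil s x))
   (\sum_q (sigma q)%:R * s ^+ (sigma q).-1 * x 0 q * 'D_(delta_mx 0 q) f (dil s x)).
Proof.
move=> sf; apply: is_derive_eq.
  exact: is_derive_comp_smoothR sf (is_derive_dil_curve x s).
rewrite derive_sumv//; [|exact: smooth_derivable|]; last first.
  by move=> v; apply: smooth_continuous; exact: smooth_D.
by apply: eq_bigr => q _; rewrite mxE.
Qed.

(* A smooth homogeneous function is a polynomial, hence homogeneous under
   the dilations of negative parameter as well. *)
Lemma homogeneous_all m f : smooth f -> homogeneous 0 m f ->
  forall (l : R) x, f (dil l x) = l ^+ m * f x.
Proof.
elim/ltn_ind: m f => m IH f sf hf l x.
have key (s : R) q : (sigma q)%:R * s ^+ (sigma q).-1 * x 0 q *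
    'D_(delta_mx 0 q) f (dil s x) =
    s ^+ m.-1 * ((sigma q)%:R * x 0 q * 'D_(delta_mx 0 q) f x).
  have h1 := homogeneous_derive q sf hf; rewrite add0n in h1.
  case: (leqP (sigma q) m) => [qm|mq]; last first.
    by rewrite !(homogeneous_derive_eq0 _ sf hf)// !mulr0.
  have h2 : homogeneous 0 (m - sigma q) ('D_(delta_mx 0 q) f).
    move=> t t0 y; have tq : t ^+ sigma q != 0 by rewrite expf_neq0// gt_eqF.
    by apply: (mulfI tq); rewrite mul1r h1// mulrA -exprD subnKC.
  rewrite (IH _ _ _ (smooth_D _ sf) h2); last by rewrite ltn_subrL sigma_gt0 (leq_trans _ qm).
  have -> : m.-1 = ((sigma q).-1 + (m - sigma q))%N.
    by rewrite -(prednK (sigma_gt0 q)) in qm *; lia.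
  by rewrite exprD; ring.
pose C := \sum_q (sigma q)%:R * x 0 q * 'D_(delta_mx 0 q) f x.
have dfs (s : R) : is_derive s 1 (fun s => f (dil s x)) (s ^+ m.-1 * C).
  apply: is_derive_eq; first exact: is_derive_along_dil.
  by rewrite /C mulr_sumr; apply: eq_bigr => q _; rewrite key.
case: m => [|m] in IH hf key dfs *.
  have C0 : C = 0.
    apply: big1 => q _; rewrite (homogeneous_derive_eq0 _ sf hf) ?mulr0//.
    by rewrite add0n.
  rewrite expr0 mul1r -[in RHS](dil1 x).
  apply: (@is_derive_0_is_cst R (fun s => f (dil s x))) => s.
  by have := dfs s; rewrite C0 mulr0.
have f0 : f 0 = 0.
  have := hf 2 (ltr0n _ 2) 0; rewrite dil0 mul1r => /eqP.
  rewrite -subr_eq0 -{1}[f 0]mul1r -mulrBl mulf_eq0 subr_eq0 => /orP[|/eqP//].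
  by rewrite eq_sym gt_eqF// exprn_egt1// ltr1n.
have dp (s : R) : is_derive s 1 ((C / m.+1%:R) *: (fun s : R => s ^+ m.+1)) (s ^+ m * C).
  apply: DeriveDef; first exact: derivableZ (@exprn_derivable _ _ _ _).
  rewrite (deriveZ _ (@exprn_derivable _ _ _ _)) exp_derive /=.
  rewrite -[LHS]/((C / m.+1%:R) * ((m.+1%:R * s ^+ m) * 1)) mulr1.
  by rewrite mulrA divfK ?pnatr_eq0// mulrC.
have cst (s t : R) : f (dil s x) - (C / m.+1%:R) * s ^+ m.+1 =
                     f (dil t x) - (C / m.+1%:R) * t ^+ m.+1.
  apply: (@is_derive_0_is_cst R
    ((fun s => f (dil s x)) - (C / m.+1%:R) *: (fun s : R => s ^+ m.+1))) => u.
  by apply: is_derive_eq; rewrite subrr.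
have := cst 1 0; rewrite dil1 dil_0 f0 expr0n /= mulr0 subr0 expr1n mulr1 => /eqP.
rewrite subr_eq0 => /eqP fE.
have := cst l 0; rewrite dil_0 f0 expr0n /= mulr0 subr0 => /eqP.
by rewrite subr_eq0 fE mulrC => /eqP.
Qed.

End homogeneity.

Record carnot_group (R : realType) (N1 M : nat)
    (op : 'rV[R]_(N1 + M) -> 'rV[R]_(N1 + M) -> 'rV[R]_(N1 + M))
    (inv : 'rV[R]_(N1 + M) -> 'rV[R]_(N1 + M)) (sigma : 'I_(N1 + M) -> nat) : Prop :=
  CarnotGroup {
    cg_assoc : forall x y z, op x (op y z) = op (op x y) z;
    cg_0x : forall x, op 0 x = x;
    cg_x0 : forall x, op x 0 = x;
    cg_inv : forall x, op x (inv x) = 0 /\ op (inv x) x = 0;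
    cg_op_smooth : smooth (fun p : 'rV[R]_(N1 + M) * 'rV[R]_(N1 + M) => op p.1 p.2);
    cg_inv_smooth : smooth inv;
    cg_sigma_1 : forall i : 'I_N1, sigma (lshift M i) = 1%N;
    cg_sigma_2 : forall i : 'I_M, (2 <= sigma (rshift N1 i))%N;
    cg_dil_aut : forall l : R, 0 < l -> forall x y,
      dil sigma l (op x y) = op (dil sigma l x) (dil sigma l y) }.

(** * Left-invariant fields and their integral curves *)

Section carnot_group.
Variables (R : realType) (N1 M : nat).
Notation N := (N1 + M)%N.
Notation pt := 'rV[R]_N.
Variables (op : pt -> pt -> pt) (inv : pt -> pt) (sigma : 'I_N -> nat).
Hypothesis G : carnot_group op inv sigma.
Notation dil := (@dil R N1 M sigma).
Let op_assoc := cg_assoc G.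
Let op_0x := cg_0x G.
Let op_x0 := cg_x0 G.
Let op_inv := cg_inv G.
Let op_smooth := cg_op_smooth G.
Let inv_smooth := cg_inv_smooth G.
Let sigma_1 := cg_sigma_1 G.
Let sigma_2 := cg_sigma_2 G.
Let dil_aut := cg_dil_aut G.

Lemma opVK x y : op (inv x) (op x y) = y.
Proof. by rewrite op_assoc (op_inv x).2 op_0x. Qed.

Lemma opKV x y : op x (op (inv x) y) = y.
Proof. by rewrite op_assoc (op_inv x).1 op_0x. Qed.

Lemma op_xK x y : op (op y x) (inv x) = y.
Proof. by rewrite -op_assoc (op_inv x).1 op_x0. Qed.

Lemma op_xVK x y : op (op y (inv x)) x = y.
Proof. by rewrite -op_assoc (op_inv x).2 op_x0. Qed.

Lemma op_inv0 : inv 0 = 0.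
Proof. by rewrite -[LHS]op_0x (op_inv 0).1. Qed.

Lemma smooth_op (E : normedModType R) (f g : E -> pt) :
  smooth f -> smooth g -> smooth (fun x => op (f x) (g x)).
Proof. exact: smooth_comp_op. Qed.

Lemma smooth_inv (E : normedModType R) (f : E -> pt) :
  smooth f -> smooth (fun x => inv (f x)).
Proof. exact: smooth_comp. Qed.

Lemma smooth_opl x : smooth (op x).
Proof. exact: smooth_op (smooth_cst _) (@smooth_id _ _). Qed.

Lemma smooth_opr y : smooth (op^~ y).
Proof. exact: smooth_op (@smooth_id _ _) (smooth_cst _). Qed.

(** The left-invariant vector field with value [v] at the identity. *)
Definition left_field (v x : pt) : pt := 'D_v (op x) 0.

Lemma ZfieldE j : Zfield op j = left_field (ej R M j).
Proof. by []. Qed.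

Lemma left_field_sum x v : left_field v x = \sum_k v 0 k *: left_field (delta_mx 0 k) x.
Proof. exact: derive_smooth_sum (smooth_opl x). Qed.

Lemma left_field_horizontal (h : 'rV[R]_N1) x :
  left_field (row_mx h 0) x = \sum_j h 0 j *: Zfield op j x.
Proof.
rewrite left_field_sum big_split_ord /= [X in _ + X]big1 ?addr0; last first.
  by move=> i _; rewrite row_mxEr mxE scale0r.
by apply: eq_bigr => j _; rewrite row_mxEl.
Qed.

Lemma left_field0 v : left_field v 0 = v.
Proof.
rewrite /left_field (_ : op 0 = idfun) ?derive_id//.
by apply/funext => x; rewrite op_0x.
Qed.

Lemma smooth_left_field v : smooth (left_field v).
Proof.
rewrite (_ : left_field v = fun x => (fun a b => 'D_((0, v) : pt * pt)
   (fun p : pt * pt => op p.1 p.2) (a, b)) x (0 : pt)); last first.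
  by apply/funext => x; rewrite /left_field derive_pair2.
apply: (@smooth_comp_op R _ _ _ pt (fun a b => 'D_((0, v) : pt * pt)
   (fun p : pt * pt => op p.1 p.2) (a, b)) (fun x => x) (fun=> 0) _
   (@smooth_id _ _) (smooth_cst _)).
have := smooth_D ((0, v) : pt * pt) op_smooth.
by congr smooth; apply/funext => -[].
Qed.

Lemma left_field_op v a x : left_field v (op a x) = 'D_(left_field v x) (op a) x.
Proof.
have dx : is_derive (0 : pt) v (op x) (left_field v x).
  by apply: DeriveDef => //; exact: smooth_derivable (smooth_opl x) _ _.
have := is_derive_comp_smooth (smooth_opl a) dx; rewrite op_x0 => -[_ <-].
rewrite /left_field; congr ('D_v _ 0); apply/funext => y.
by rewrite op_assoc.
Qed.

Lemma sigma_gt0 i : (0 < sigma i)%N.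
Proof.
case: (split_ordP i) => j ->; first by rewrite sigma_1.
by rewrite ltnW// sigma_2.
Qed.

(** Obtained by differentiating the automorphism property of the dilation in the second factor at
    0. *)
Lemma left_field_dil k (l : R) x : 0 < l ->
  l ^+ sigma k *: left_field (delta_mx 0 k) (dil l x) =
  dil l (left_field (delta_mx 0 k) x).
Proof.
move=> l0.
have E : (fun y => op (dil l x) (dil l y)) = fun y => dil l (op x y).
  by apply/funext => y; rewrite dil_aut.
have [_ d1] := @is_derive_comp_linear R _ _ _ (op (dil l x)) (dil l) 0 (delta_mx 0 k)
  (smooth_derivable (smooth_opl _) _ _).
have cdil : continuous (dil l) by exact: rV_linear_continuous.
have dx : is_derive (0 : pt) (delta_mx 0 k) (op x) (left_field (delta_mx 0 k) x).
  by apply: DeriveDef => //; exact: smooth_derivable (smooth_opl x) _ _.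
have [_ d2] := is_derive_comp_smooth (smooth_linear cdil) dx.
rewrite op_x0 in d2.
have e2 := etrans d2 (derive_linear x (left_field (delta_mx 0 k) x) cdil).
move: d1; rewrite /= E dil_delta dil0 => d1.
exact: etrans (esym (etrans d1 (derive_smoothZ _ _ _ (smooth_opl _)))) e2.
Qed.

Lemma left_field_homogeneous k i :
  homogeneous sigma (sigma k) (sigma i) (fun x => left_field (delta_mx 0 k) x 0 i).
Proof.
move=> l l0 x; have /(congr1 (fun v : pt => v 0 i)) := left_field_dil k x l0.
by rewrite !mxE.
Qed.

(** Component i has degree [sigma i - sigma k], less than [sigma i], so it does not depend on
    coordinate i. In particular left-invariant fields are divergence free, the source of the
    translation invariance of Lebesgue measure. *)
Lemma left_field_derive0 k i x :
  'D_(delta_mx 0 i) (fun x => left_field (delta_mx 0 k) x 0 i) x = 0.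
Proof.
apply: (homogeneous_derive_eq0 x _ (left_field_homogeneous k i)).
  exact: smooth_coord (smooth_left_field _).
by rewrite -[X in (X < _)%N]add0n ltn_add2r sigma_gt0.
Qed.

Section horizontal_curve.
Variable h : 'rV[R]_N1.
Notation X := (left_field (row_mx h 0)).

Lemma horizontal_homogeneous i : homogeneous sigma 1 (sigma i) (fun x => X x 0 i).
Proof.
move=> l l0 x.
have XE y : X y 0 i = \sum_j h 0 j * left_field (delta_mx 0 (lshift M j)) y 0 i.
  apply: etrans (congr1 (fun v : pt => v 0 i) (left_field_horizontal h y)) _.
  by rewrite summxE; apply: eq_bigr => j _; rewrite mxE.
rewrite (XE x) (XE (dil l x)) !mulr_sumr; apply: eq_bigr => j _.
have := left_field_homogeneous (lshift M j) i l0 x; rewrite sigma_1 => E.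
by rewrite mulrCA E mulrCA.
Qed.

Lemma horizontal_homogeneous_all i (l : R) x :
  X (dil l x) 0 i = l ^+ (sigma i).-1 * X x 0 i.
Proof.
apply: (homogeneous_all sigma_gt0 (f := fun x => X x 0 i)).
  exact: smooth_coord (smooth_left_field _).
move=> t t0 y; apply: (mulfI (lt0r_neq0 t0)).
by have := horizontal_homogeneous i t0 y; rewrite !mul1r mulrA -exprS prednK// sigma_gt0.
Qed.

(** Iteration for the system [sigma i] * p_i = X_i(p), which says that s |-> [dil s p] is an
    integral curve of X. *)
Fixpoint exp_iter (n : nat) : pt :=
  if n is n'.+1 then \row_i (X (exp_iter n') 0 i / (sigma i)%:R) else 0.

Lemma exp_iterS n i : exp_iter n.+1 0 i = X (exp_iter n) 0 i / (sigma i)%:R.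
Proof. by rewrite mxE. Qed.

(** Component i of a horizontal field has degree [sigma i] - 1, so it reads only coordinates of
    smaller weight, which are already stationary. The largest weight thus bounds the number of
    iterations. *)
Lemma exp_iter_stable n i : (sigma i <= n)%N -> exp_iter n.+1 0 i = exp_iter n 0 i.
Proof.
elim: n i => [|n IH] i sn; first by have := sigma_gt0 i; rewrite ltnNge sn.
apply: etrans (exp_iterS n.+1 i) (etrans _ (esym (exp_iterS n i))).
apply: (congr1 (fun y => y / (sigma i)%:R)).
apply: (homogeneous_local _ (horizontal_homogeneous i)).
  exact: smooth_coord (smooth_left_field _).
by move=> q sq; apply: IH; rewrite -ltnS (leq_trans _ sn).
Qed.

Definition exp_pt : pt := exp_iter (\max_i sigma i).

Lemma exp_ptE i : (sigma i)%:R * exp_pt 0 i = X exp_pt 0 i.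
Proof.
have := @exp_iter_stable (\max_i sigma i) i (leq_bigmax _).
rewrite -/exp_pt exp_iterS => <-; rewrite mulrC divfK// pnatr_eq0.
by have := sigma_gt0 i; case: (sigma i).
Qed.

Definition exp_curve (s : R) : pt := dil s exp_pt.

Lemma smooth_exp_curve : smooth exp_curve.
Proof. exact: smooth_dil_curve. Qed.

Lemma exp_curve0 : exp_curve 0 = 0.
Proof. exact: dil_0 sigma_gt0 _. Qed.

(** The velocity of [dil s p] in coordinate i is [sigma i] s^(sigma i - 1) p_i = s^(sigma i - 1)
    X_i(p), which is X_i([dil s p]) for every real s because X_i is a homogeneous polynomial. *)
Lemma is_derive_exp_curve (s : R) : is_derive s 1 exp_curve (X (exp_curve s)).
Proof.
apply: is_derive_eq; first exact: is_derive_dil_curve.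
apply/rowP => i; rewrite mxE horizontal_homogeneous_all -exp_ptE.
by rewrite mulrAC mulrC mulrA.
Qed.

Lemma is_derive_op_exp_curve x (s : R) :
  is_derive s 1 (fun s => op x (exp_curve s)) (X (op x (exp_curve s))).
Proof.
rewrite left_field_op.
exact: is_derive_comp_smooth (smooth_opl x) (is_derive_exp_curve s).
Qed.

End horizontal_curve.

End carnot_group.

(** * Horizontal paths *)

Section ae_affine.
Variable R : realType.
Notation leb := (@lebesgue_measure R).

Lemma measurable_affine (a b : R) : measurable_fun [set: measurableTypeR R]
  (fun s : R => a * s + b : measurableTypeR R).
Proof.
apply: continuous_measurable_fun => x; apply: cvgD; last exact: cvg_cst.
by apply: cvgM; [exact: cvg_cst|exact: cvg_id].
Qed.

(** Uniqueness of the measure giving half-open intervals their length. For a < 0 the preimage of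
    such an interval is closed at the other end, with the same length. *)
Lemma lebesgue_measure_affine (a b : R) (A : set R) : a != 0 -> measurable A ->
  leb A = (`|a|%:E * leb ((fun s : R => (a * s + b)%R) @^-1` A))%E.
Proof.
move=> a0 mA; pose phi := (fun s => a * s + b) : measurableTypeR R -> measurableTypeR R.
have mphi : measurable_fun [set: measurableTypeR R] phi := measurable_affine a b.
pose nu0 : {measure set _ -> \bar R} := pushforward leb phi.
pose nu : {measure set _ -> \bar R} := mscale (NngNum (normr_ge0 a)) (nu0 mphi).
apply: (@lebesgue_measure_unique R nu) => // _ [[c d]] _ <- /=.
rewrite /nu /mscale /nu0 /= /pushforward.
have [a1|a1|/eqP] := ltgtP a 0; last by rewrite (negbTE a0).
- have -> : phi @^-1` `]c, d]%classic = `[(d - b) / a, (c - b) / a[%classic.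
    apply/seteqP; split=> s; rewrite /phi /= !in_itv /= => /andP[h1 h2]; apply/andP.
      by rewrite ler_ndivrMr// ltr_ndivlMr// lerBrDr ltrBlDr ![s * a]mulrC.
    move: h1 h2.
    by rewrite ler_ndivrMr// ltr_ndivlMr// lerBrDr ltrBlDr ![s * a]mulrC.
  rewrite !lebesgue_measure_itv /= !lte_fin ltr_nM2r ?invr_lt0// ltrD2r.
  case: ifPn => _; last by rewrite mule0.
  by rewrite -!EFinB -EFinM -mulrBl ltr0_norm//; congr (_%:E); field.
- have -> : phi @^-1` `]c, d]%classic = `](c - b) / a, (d - b) / a]%classic.
    apply/seteqP; split=> s; rewrite /phi /= !in_itv /= => /andP[h1 h2]; apply/andP.
      by rewrite ler_pdivlMr// ltr_pdivrMr// lerBrDr ltrBlDr ![s * a]mulrC.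
    move: h1 h2.
    by rewrite ler_pdivlMr// ltr_pdivrMr// lerBrDr ltrBlDr ![s * a]mulrC.
  rewrite !lebesgue_measure_itv /= !lte_fin ltr_pM2r ?invr_gt0// ltrD2r.
  case: ifPn => _; last by rewrite mule0.
  by rewrite -!EFinB -EFinM -mulrBl gtr0_norm//; congr (_%:E); field.
Qed.

Lemma ae_affine (a b : R) (P : R -> Prop) : a != 0 ->
  {ae leb, forall s, P s} -> {ae leb, forall s, P (a * s + b)}.
Proof.
move=> a0 [A [mA A0 sub]].
exists ((fun s : R => a * s + b) @^-1` A); split; last by move=> s; exact: sub.
- rewrite -[X in measurable X]setTI.
  by apply: (measurable_affine a b).
- have /esym/eqP := lebesgue_measure_affine b a0 mA.
  by rewrite [X in _ == X]A0 mule_eq0 eqe normr_eq0 (negbTE a0) => /eqP.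
Qed.

Lemma ae_mono (P Q : R -> Prop) : (forall s, P s -> Q s) ->
  {ae leb, forall s, P s} -> {ae leb, forall s, Q s}.
Proof.
move=> PQ [A [mA A0 sub]]; exists A; split => // s nQ.
by apply: sub => /PQ.
Qed.

Lemma ae_and (P Q : R -> Prop) : {ae leb, forall s, P s} ->
  {ae leb, forall s, Q s} -> {ae leb, forall s, P s /\ Q s}.
Proof.
move=> nP nQ; apply: negligibleS (negligibleU nP nQ) => s /= /not_andP.
by case; [left|right].
Qed.

Lemma ae_neq (a : R) : {ae leb, forall s, s <> a}.
Proof.
exists [set a]; split; [exact: measurable_set1|exact: lebesgue_measure_set1|].
by move=> s /= /contrapT.
Qed.
End ae_affine.

Section lipschitz.
Variable R : realType.

Lemma lipschitz_onP (V W : normedModType R) (A : set V) (f : V -> W) :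
  [lipschitz f x | x in A] <->
  exists2 K : R, 0 <= K & forall x y, A x -> A y -> `|f x - f y| <= K * `|x - y|.
Proof.
split=> [|[K K0 H]].
  move=> [K [Kr H]]; have : `|K| + 1 > K by rewrite ltr_pwDr// ler_norm.
  move=> /H {}H; exists (`|K| + 1); first by rewrite addr_ge0.
  by move=> x y Ax Ay; exact: (H (x, y)).
exists K; split; first exact: num_real.
move=> M KM [x y] [/= Ax Ay]; apply: (le_trans (H x y Ax Ay)).
by rewrite ler_wpM2r// ltW.
Qed.

(** The partial derivatives are bounded on the compact ball, and segments stay in it by convexity;
    the constant is the sum of all these bounds. *)
Lemma smooth_lipschitz_ball n m (f : 'rV[R]_n -> 'rV[R]_m) (r : R) : smooth f ->
  exists2 K : R, 0 <= K & forall x y, `|x| <= r -> `|y| <= r ->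
    `|f x - f y| <= K * `|x - y|.
Proof.
move=> sf.
have [r0|r0] := ltP r 0.
  exists 0 => // x y xr; have := le_lt_trans (le_trans (normr_ge0 _) xr) r0.
  by rewrite ltxx.
have cB : compact [set x : 'rV[R]_n | `|x| <= r].
  apply: bounded_closed_compact.
    exists r; split; first exact: num_real.
    by move=> M rM x /= xr; rewrite (le_trans xr)// ltW.
  apply: (@preimage_closed _ _ _ [set y : R | y <= r]); last exact: closed_le.
  by move=> x _; exact: norm_continuous.
have bd (j : 'I_m) (q : 'I_n) : exists2 K : R, 0 <= K & forall x, `|x| <= r ->
    `|'D_(delta_mx 0 q) (fun y => f y 0 j) x| <= K.
  have sD := smooth_D (delta_mx 0 q) (smooth_coord j sf).
  have [] := @EVT_max_rV R n (fun x => `|'D_(delta_mx 0 q) (fun y => f y 0 j) x|)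
    [set x | `|x| <= r] _ cB.
  - by exists 0; rewrite /= normr0.
  - apply: continuous_subspaceT => x.
      by exact: (cvg_norm (smooth_continuous sD x)).
  move=> c _ Hc; exists (`|'D_(delta_mx 0 q) (fun y => f y 0 j) c|) => // x xr.
  by apply: Hc; rewrite inE.
have /choice [K HK] : forall p : 'I_m * 'I_n, exists K : R, 0 <= K /\ forall x, `|x| <= r ->
    `|'D_(delta_mx 0 p.2) (fun y => f y 0 p.1) x| <= K.
  by move=> p; have [K K0 H] := bd p.1 p.2; exists K.
have K0 i q : 0 <= K (i, q) by exact: (HK (i, q)).1.
exists (\sum_i \sum_q K (i, q)).
  by apply: sumr_ge0 => i _; apply: sumr_ge0 => q _.
move=> x y xr yr; apply: rV_norm_le => [|j].
  by rewrite mulr_ge0//; apply: sumr_ge0 => i _; apply: sumr_ge0 => q _.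
have sj := smooth_coord j sf.
have [t /andP[t0 t1] E] := @line_MVT R _ (fun y => f y 0 j) y (x - y)
  (fun z => smooth_derivable sj _ z).
rewrite (addrC y) subrK in E; rewrite !mxE E.
have zr : `|y + t *: (x - y)| <= r.
  have -> : y + t *: (x - y) = t *: x + (1 - t) *: y.
    by rewrite scalerBr scalerBl scale1r addrCA addrC.
  rewrite (le_trans (ler_normD _ _))// !normrZ (ger0_norm t0) ger0_norm ?subr_ge0//.
  rewrite (@le_trans _ _ (t * r + (1 - t) * r))//.
    by rewrite lerD// ler_wpM2l// subr_ge0.
  by rewrite -mulrDl addrC subrK mul1r.
rewrite derive_sumv; last 2 first.
- by move=> v z; exact: smooth_derivable.
- by move=> v; exact: smooth_continuous (smooth_D v sj).
apply: (le_trans (ler_norm_sum _ _ _)).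
rewrite (bigD1 j)//= mulrDl -[leLHS]addr0 mulr_suml.
apply: lerD; last first.
  by rewrite mulr_ge0//; apply: sumr_ge0 => i _; apply: sumr_ge0 => q _.
apply: ler_sum => q _; rewrite normrM mulrC ler_pM//.
  exact: (HK (j, q)).2.
exact: rV_coord_le_norm.
Qed.

End lipschitz.

Lemma is_derive_comp_affine (R : realType) (W : normedModType R) (g : R -> W) (a b s : R) w :
  is_derive (a * s + b) 1 g w -> is_derive s 1 (fun s : R => g (a * s + b)) (a *: w).
Proof.
move=> [dg <-].
have d1 : is_derive s 1 (fun s : R => a * s + b) a.
  rewrite (_ : (fun s => _) = (a *: (@id R)) + cst b); last by apply/funext.
  by apply: is_derive_eq; rewrite addr0 [_ *: _]mulr1.
have [d2 E] := d1.
have dg' : differentiable g (a * s + b) by apply/derivable1_diffP.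
apply: is_derive_eq; first exact: (derive_comp_diff (f := fun s : R => a * s + b) d2 dg').
rewrite E deriveE// (_ : a = a *: (1 : R^o)) ?linearZ//; last by rewrite [_ *: _]mulr1.
by rewrite [a *: 1]mulr1.
Qed.

(** * Operations on horizontal paths and the control distance *)

Section cc_distance.
Variables (R : realType) (N1 M : nat).
Notation N := (N1 + M)%N.
Notation pt := 'rV[R]_N.
Variables (op : pt -> pt -> pt) (inv : pt -> pt) (sigma : 'I_N -> nat).
Hypothesis G : carnot_group op inv sigma.
Notation leb := (@lebesgue_measure R).

(** The subunit condition on an arbitrary interval, with an explicit Lipschitz constant and the
    velocity as the single left-invariant field of the control; this form suits changes of time and
    concatenation. *)
Definition horizontal (p q : R) (g : R -> pt) :=
  (exists2 K : R, 0 <= K & forall s t, p <= s <= q -> p <= t <= q ->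
     `|g s - g t| <= K * `|s - t|) /\
  exists h : R -> 'rV[R]_N1, (forall s, \sum_j (h s 0 j) ^+ 2 <= 1) /\
    {ae leb, forall s, p <= s <= q ->
       is_derive s 1 g (left_field op (row_mx (h s) 0) (g s))}.

Lemma subunitE T g : subunit op T g <-> horizontal 0 T g.
Proof.
split=> [[Lg [h [h1 H]]]|[Lg [h [h1 H]]]]; split.
- have [K K0 {}Lg] := (lipschitz_onP _ _).1 Lg.
  by exists K => // s t s0 t0; apply: Lg; rewrite /= in_itv.
- exists h; split => //; apply: ae_mono H => s H s0.
  have [|ds de] := H; first by rewrite in_itv.
  by apply: DeriveDef; rewrite // -derive1E de (left_field_horizontal G).
- apply/lipschitz_onP; have [K K0 {}Lg] := Lg.
  by exists K => // s t; rewrite /= !in_itv /=; exact: Lg.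
- exists h; split => //; apply: ae_mono H => s H.
  rewrite in_itv /= => /H[ds de]; split => //.
  by rewrite derive1E de (left_field_horizontal G).
Qed.

(** Common source of left translation, dilation, time reversal and time shift: if a dA(Z_j) = c Z_j
    along A, the new path has control c h(a s + b), still of length at most 1. *)
Lemma horizontal_affine p q p' q' (a b c : R) (A : pt -> pt) g :
  smooth A -> a != 0 -> `|c| <= 1 ->
  (forall s, p' <= s <= q' -> p <= a * s + b <= q) ->
  (forall j x, a *: 'D_(left_field op (ej R M j) x) A x =
     c *: left_field op (ej R M j) (A x)) ->
  horizontal p q g -> horizontal p' q' (fun s => A (g (a * s + b))).
Proof.
move=> sA a0 c1 sub HA [[K K0 Lg] [h [h1 H]]]; split.
  (* [A] is Lipschitz only on balls, so the trace of the path is first enclosed in one. *)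
  have [r Hr] : exists r : R, forall s, p <= s <= q -> `|g s| <= r.
    exists (`|g p| + K * `|q - p|) => s sI.
    have pI : p <= p <= q by rewrite lexx/=; case/andP: sI => /le_trans; apply.
    rewrite -[g s](subrK (g p)) (le_trans (ler_normD _ _))// addrC lerD2l.
    rewrite (le_trans (Lg _ _ sI pI))// ler_wpM2l//.
    by case/andP: sI => ps sq; rewrite !ger0_norm ?subr_ge0// ?(le_trans ps)// lerD2r.
  have [K' K'0 HK'] := @smooth_lipschitz_ball R _ _ A r sA.
  exists (K' * (K * `|a|)); first by rewrite !mulr_ge0.
  move=> s t sI tI; apply: (le_trans (HK' _ _ (Hr _ (sub _ sI)) (Hr _ (sub _ tI)))).
  rewrite -!mulrA ler_wpM2l// (le_trans (Lg _ _ (sub _ sI) (sub _ tI)))//.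
  by rewrite ler_wpM2l// -normrM mulrBr opprD addrACA subrr addr0.
exists (fun s => c *: h (a * s + b)); split.
  move=> s; under eq_bigr do rewrite mxE exprMn.
  rewrite -mulr_sumr -[leRHS]mulr1 ler_pM ?sqr_ge0//.
    by apply: sumr_ge0 => j _; exact: sqr_ge0.
  by rewrite -[c ^+ 2]real_normK ?num_real// exprn_ile1.
have := ae_affine b a0 H; apply: ae_mono => s Hs sI.
have {}Hs := Hs (sub _ sI).
have ds : is_derive s 1 (fun s => g (a * s + b))
    (a *: left_field op (row_mx (h (a * s + b)) 0) (g (a * s + b))).
  exact: is_derive_comp_affine.
apply: is_derive_eq; first exact: is_derive_comp_smooth sA ds.
rewrite derive_smoothZ// !(left_field_horizontal G).
rewrite deriveE ?linear_sum; last exact: differentiable_smooth.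
apply: eq_bigr => j _ /=; rewrite linearZ -deriveE; last exact: differentiable_smooth.
have := HA j (g (a * s + b)); rewrite -!ZfieldE => E.
move: E; set w := 'D_(_) A _; set z := Zfield op j (A _) => E.
have swap (k l : R) (u : pt) : k *: (l *: u) = l *: (k *: u).
  by rewrite !scalerA mulrC.
by apply: etrans (swap a _ w) _; rewrite E mxE scalerA mulrC.
Qed.

Lemma horizontal_op z p q g : horizontal p q g -> horizontal p q (fun s => op z (g s)).
Proof.
move=> Hg.
have -> : (fun s => op z (g s)) = fun s => op z (g (1 * s + 0)).
  by apply/funext => s; rewrite mul1r addr0.
apply: (@horizontal_affine p q p q 1 0 1 (op z) g _ _ _ _ _ Hg).
- exact: smooth_opl G z.
- exact: oner_neq0.
- by rewrite normr1.
- by move=> s; rewrite mul1r addr0.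
- by move=> j x; rewrite !scale1r (left_field_op G).
Qed.

Lemma horizontal_dil l p q g : 0 < l -> horizontal p q g ->
  horizontal (l * p) (l * q) (fun s => dil sigma l (g (l^-1 * s))).
Proof.
move=> l0 Hg.
have -> : (fun s => dil sigma l (g (l^-1 * s))) = fun s => dil sigma l (g (l^-1 * s + 0)).
  by apply/funext => s; rewrite addr0.
apply: (@horizontal_affine p q (l * p) (l * q) l^-1 0 1 (dil sigma l) g _ _ _ _ _ Hg).
- by apply: smooth_linear; exact: rV_linear_continuous.
- by rewrite invr_eq0 gt_eqF.
- by rewrite normr1.
- by move=> s; rewrite addr0 ler_pdivlMl// ler_pdivrMl.
- move=> j x; rewrite scale1r derive_linear; last exact: rV_linear_continuous.
  have E := left_field_dil G (lshift M j) x l0; rewrite (cg_sigma_1 G) expr1 in E.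
  by rewrite /= -[ej R M j]/(delta_mx 0 (lshift M j)) -E scalerA mulVf ?scale1r// gt_eqF.
Qed.

Lemma horizontal_rev T g : horizontal 0 T g -> horizontal 0 T (fun s => g (T - s)).
Proof.
move=> Hg.
have -> : (fun s => g (T - s)) = fun s => g (-1 * s + T).
  by apply/funext => s; rewrite mulN1r addrC.
apply: (@horizontal_affine 0 T 0 T (-1) T (-1) id g _ _ _ _ _ Hg).
- exact: smooth_id.
- by rewrite oppr_eq0 oner_eq0.
- by rewrite normrN normr1.
- by move=> s /andP[s0 sT]; rewrite mulN1r addrC subr_ge0 sT lerBlDr lerDl.
- by move=> j x; rewrite derive_id.
Qed.

Lemma horizontal_shift p q b g : horizontal p q g ->
  horizontal (p + b) (q + b) (fun s => g (s - b)).
Proof.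
move=> Hg.
have -> : (fun s => g (s - b)) = fun s => g (1 * s - b).
  by apply/funext => s; rewrite mul1r.
apply: (@horizontal_affine p q (p + b) (q + b) 1 (- b) 1 id g _ _ _ _ _ Hg).
- exact: smooth_id.
- exact: oner_neq0.
- by rewrite normr1.
- by move=> s; rewrite mul1r lerBrDr lerBlDr.
- by move=> j x; rewrite derive_id.
Qed.

Lemma horizontal_cat p q r g1 g2 : p <= q -> q <= r -> g1 q = g2 q ->
  horizontal p q g1 -> horizontal q r g2 ->
  horizontal p r (fun s => if s <= q then g1 s else g2 s).
Proof.
move=> pq qr gq [[K1 K10 L1] [h1 [b1 H1]]] [[K2 K20 L2] [h2 [b2 H2]]]; split.
  exists (K1 + K2); first exact: addr_ge0.
  have qI1 : p <= q <= q by rewrite pq lexx.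
  have qI2 : q <= q <= r by rewrite qr lexx.
  (* Two times on either side of the junction are compared through the common point at [q]. *)
  have mix s t : p <= s <= q -> q <= t <= r -> `|g1 s - g2 t| <= (K1 + K2) * `|s - t|.
    move=> sI tI; rewrite -(subrKA (g1 q)) (le_trans (ler_normD _ _))// mulrDl.
    case/andP: (sI) => ps sq; case/andP: (tI) => qt tr.
    apply: lerD; [apply: (le_trans (L1 _ _ sI qI1))|rewrite gq; apply: (le_trans (L2 _ _ qI2 tI))].
      by rewrite ler_wpM2l// !ler0_norm ?subr_le0 ?(le_trans sq)// !opprB lerD2r.
    by rewrite ler_wpM2l// !ler0_norm ?subr_le0 ?(le_trans sq)// !opprB lerD2l lerN2.
  move=> s t /andP[ps sr] /andP[pt_ tr].
  case: (leP s q) => [sq|/ltW qs]; case: (leP t q) => [tq|/ltW qt].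
  - by rewrite (le_trans (L1 _ _ _ _)) ?ps ?pt_// ler_wpM2r// lerDl.
  - by apply: mix; [rewrite ps|rewrite qt].
  - by rewrite distrC [`|s - t|]distrC; apply: mix; [rewrite pt_|rewrite qs].
  - by rewrite (le_trans (L2 _ _ _ _)) ?qs ?qt// ler_wpM2r// lerDr.
exists (fun s => if s <= q then h1 s else h2 s); split.
  by move=> s; case: ifPn.
(* The junction is a null set of times; at every other time the glued path coincides locally with
   one of the pieces. *)
have := ae_and (ae_neq q) (ae_and H1 H2); apply: ae_mono => s [sq [D1 D2]] /andP[ps sr].
case: (ltgtP s q) sq => // [sq|qs] _.
- apply: (@near_eq_is_derive _ _ _ g1).
    near=> u; rewrite ifT//; apply: ltW; near: u; exact: lt_nbhsl.
  by apply: D1; rewrite ps ltW.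
- apply: (@near_eq_is_derive _ _ _ g2).
    near=> u; rewrite ifF//; apply/negbTE; rewrite -ltNge; near: u; exact: lt_nbhsr.
  by apply: D2; rewrite sr ltW.
Unshelve. all: by end_near. Qed.

Definition joined (x y : pt) (T : R) :=
  0 <= T /\ exists g : R -> pt, [/\ g 0 = x, g T = y & horizontal 0 T g].

Lemma joined_op z x y T : joined x y T -> joined (op z x) (op z y) T.
Proof.
move=> [T0 [g [g0 gT Hg]]]; split => //; exists (fun s => op z (g s)).
by split; [rewrite g0|rewrite gT|exact: horizontal_op].
Qed.

Lemma joined_dil l x y T : 0 < l -> joined x y T ->
  joined (dil sigma l x) (dil sigma l y) (l * T).
Proof.
move=> l0 [T0 [g [g0 gT Hg]]]; split; first by rewrite mulr_ge0// ltW.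
exists (fun s => dil sigma l (g (l^-1 * s))); split.
- by rewrite mulr0 g0.
- by rewrite mulKf ?gT// gt_eqF.
- by have := horizontal_dil l0 Hg; rewrite mulr0.
Qed.

Lemma joined_sym x y T : joined x y T -> joined y x T.
Proof.
move=> [T0 [g [g0 gT Hg]]]; split => //; exists (fun s => g (T - s)).
by split; [rewrite subr0|rewrite subrr|exact: horizontal_rev].
Qed.

Lemma joined_trans x y z S T : joined x y S -> joined y z T -> joined x z (S + T).
Proof.
move=> [S0 [g [g0 gS Hg]]] [T0 [k [k0 kT Hk]]]; split; first exact: addr_ge0.
exists (fun s => if s <= S then g s else k (s - S)); split.
- by rewrite S0.
- rewrite gerDl (addrC S) addrK; case: leP => // T0'.
  have T_0 : T = 0 by apply/eqP; rewrite eq_le T0' T0.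
  by rewrite -kT T_0 k0 add0r.
- have := horizontal_shift S Hk; rewrite add0r [T + S]addrC => Hk'.
  apply: horizontal_cat => //; first by rewrite lerDl.
  by rewrite subrr gS k0.
Qed.

Lemma horizontal_exp_curve x (h : 'rV[R]_N1) (p q : R) : \sum_j (h 0 j) ^+ 2 <= 1 ->
  horizontal p q (fun u => op x (exp_curve op sigma h u)).
Proof.
move=> h1; split; last first.
  exists (fun=> h); split => //; apply: aeW => u _.
  exact: is_derive_op_exp_curve G h x u.
have sc : smooth (fun v : 'rV[R]_1 => op x (exp_curve op sigma h (row_form 1 v))).
  apply: (@smooth_comp_linear R _ _ _ (fun u => op x (exp_curve op sigma h u)) (row_form 1)).
    exact: rV_linear_continuous.
  apply: (smooth_op G); [exact: smooth_cst|exact: smooth_exp_curve].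
have [K K0 HK] := smooth_lipschitz_ball (`|p| + `|q|) sc.
exists K => // u v uI vI.
have E (w : R) : row_form 1 (\row_(j < 1) w) = w by rewrite /row_form big_ord1 !mxE mulr1.
have B (w : R) : p <= w <= q -> `|\row_(j < 1) w| <= `|p| + `|q|.
  move=> /andP[pw wq]; apply: rV_norm_le => [|j]; first exact: addr_ge0.
  rewrite mxE ler_norml; apply/andP; split.
    by rewrite (le_trans _ pw)// opprD -[leRHS]addr0 lerD ?oppr_le0// lerNl -normrN ler_norm.
  by rewrite (le_trans wq)// (le_trans (ler_norm q))// lerDr.
have := HK (\row_(j < 1) u) (\row_(j < 1) v) (B _ uI) (B _ vI); rewrite !E => H.
apply: (le_trans H); rewrite ler_wpM2l//; apply: rV_norm_le => // j.
by rewrite !mxE.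
Qed.

Lemma joined_exp_curve x (h : 'rV[R]_N1) (a b : R) : a <= b ->
  \sum_j (h 0 j) ^+ 2 <= 1 ->
  joined (op x (exp_curve op sigma h a)) (op x (exp_curve op sigma h b)) (b - a).
Proof.
move=> ab h1; split; first by rewrite subr_ge0.
exists (fun u => op x (exp_curve op sigma h (u - - a))); split.
- by rewrite opprK add0r.
- by rewrite opprK subrK.
- by rewrite -[X in horizontal X](subrr a); exact: horizontal_shift (horizontal_exp_curve _ _ _ h1).
Qed.

Lemma cc_distE x y : cc_dist op x y = inf [set T | joined x y T].
Proof.
rewrite /cc_dist; congr (inf _); apply/seteqP; split=> T /= [T0 [g [g0 gT Hg]]].
  by split => //; exists g; split => //; apply/subunitE.
by split => //; exists g; split => //; apply/subunitE.
Qed.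

(** The infimum of the empty set is 0 by convention, so the bound holds before finiteness is
    known. *)
Lemma cc_dist_ge0 x y : 0 <= cc_dist op x y.
Proof.
rewrite cc_distE; have [->|/set0P ne] := eqVneq [set T | joined x y T] set0.
  by rewrite inf0.
by apply: lb_le_inf => // T [].
Qed.

Lemma cc_dist_le x y T : joined x y T -> cc_dist op x y <= T.
Proof. by rewrite cc_distE => J; apply: ge_inf => //; exists 0 => S []. Qed.

End cc_distance.

(** * Chow's theorem *)

Section linear_algebra.
Variables (R : realType) (n : nat).

Lemma row_formE (c : 'rV[R]_n) (u : 'rV[R]_n) : row_form c u = (u *m c^T) 0 0.
Proof. by rewrite mxE; apply: eq_bigr => j _; rewrite mxE. Qed.

Lemma row_form_eq0_unit (A : 'M[R]_n) (c : 'rV[R]_n) : row_full A ->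
  (forall i, row_form c (row i A) = 0) -> c = 0.
Proof.
move=> fA H; have Ac : A *m c^T = 0.
  apply/matrixP => i j; rewrite ord1 [RHS]mxE -[RHS](H i) row_formE.
  by rewrite !mxE; apply: eq_bigr => k _; rewrite !mxE.
apply: trmx_inj; rewrite trmx0 -[LHS]mul1mx.
have [B BA] := row_fullP fA.
by rewrite -BA -mulmxA Ac mulmx0.
Qed.

(** Greedy choice: while fewer than n rows are chosen some nonzero [c] annihilates them all, and a
    vector of [S] on which [c] does not vanish is independent of them. *)
Lemma spanning_basis (S : set 'rV[R]_n) :
  (forall c, (forall u, S u -> row_form c u = 0) -> c = 0) ->
  exists A : 'M[R]_n, A \in unitmx /\ forall i, S (row i A).
Proof.
move=> HS; suff : forall k, (k <= n)%N ->
    exists A : 'M[R]_(k, n), row_free A /\ forall i, S (row i A).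
  move=> /(_ n (leqnn n))[A [fA SA]]; exists A; split => //.
  by rewrite -row_free_unit.
elim=> [_|k IH kn].
  by exists 0; split; [rewrite /row_free mxrank0|case].
have [A [fA SA]] := IH (ltnW kn).
have : kermx A^T != 0.
  rewrite -mxrank_eq0 mxrank_ker mxrank_tr -lt0n subn_gt0.
  by rewrite (eqP fA).
move=> /rowV0Pn[c /sub_kermxP cA c0].
have [u Su cu] : exists2 u, S u & row_form c u != 0.
  apply: contrapT => /forall2NP H; move/eqP: c0; apply; apply: HS => u Su.
  by case: (H u) => // /negP; rewrite negbK => /eqP.
rewrite -add1n; exists (col_mx u A); split; last first.
  move=> i; case: (@split_ordP 1 k i) => j ->.
    by rewrite rowKu ord1 (_ : row 0 u = u)//; apply/rowP => q; rewrite mxE.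
  by rewrite rowKd.
rewrite -kermx_eq0; apply/rowV0P => v /sub_kermxP.
rewrite -[v]hsubmxK mul_row_col => E.
have uE : lsubmx v *m u = (lsubmx v 0 0) *: u.
  by rewrite [lsubmx v]mx11_scalar mul_scalar_mx !mxE eqxx mulr1n.
have v0 : lsubmx v 0 0 = 0.
  have := congr1 (fun w => (w *m c^T) 0 0) E.
  rewrite mulmxDl -(mulmxA (rsubmx v)) (_ : A *m c^T = 0); last first.
    by apply: trmx_inj; rewrite trmx_mul trmxK cA trmx0.
  rewrite mulmx0 addr0 uE -scalemxAl [LHS]mxE -row_formE mul0mx [RHS]mxE.
  by move=> /eqP; rewrite mulf_eq0 (negbTE cu) orbF => /eqP.
move: E; rewrite uE v0 scale0r add0r => E.
have -> : lsubmx v = 0 by apply/matrixP => i j; rewrite !ord1 v0 mxE.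
rewrite (row_free_inj fA (_ : rsubmx v *m A = 0 *m A)) ?mul0mx//.
by rewrite row_mx0.
Qed.

End linear_algebra.

(** * Local surjectivity from an invertible derivative *)

Section local_surjectivity.
Variables (R : realType).

Lemma differentiable_eps (V W : normedModType R) (f : V -> W) x : differentiable f x ->
  forall eps : R, 0 < eps ->
    \forall h \near (0 : V), `|f (h + x) - f x - 'd f x h| <= eps * `|h|.
Proof.
move=> /diff_locally/eqaddoP H eps e0; have := H _ e0; apply: filterS => h.
by rewrite !fctE /= opprD addrA.
Qed.

Variable n : nat.
Notation V := 'rV[R]_n.

Lemma mulmx_norm_bound (B : 'M[R]_n) : exists2 C : R, 0 < C & forall u : V, `|u *m B| <= C * `|u|.
Proof.
exists (1 + \sum_i \sum_j `|B i j|).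
  by rewrite ltr_wpDr//; apply: sumr_ge0 => i _; apply: sumr_ge0.
move=> u; apply: rV_norm_le => [|j].
  by rewrite mulr_ge0// addr_ge0//; apply: sumr_ge0 => i _; apply: sumr_ge0.
rewrite mxE (le_trans (ler_norm_sum _ _ _))// mulrDl mul1r -[leLHS]add0r lerD//.
rewrite mulr_suml; apply: ler_sum => i _; rewrite normrM mulrC ler_pM//.
  by rewrite (bigD1 j)//= lerDl; apply: sumr_ge0.
exact: rV_coord_le_norm.
Qed.

Lemma continuous_det (A : V -> 'M[R]_n) : (forall i j, continuous (fun s => A s i j)) ->
  continuous (fun s => \det (A s)).
Proof.
move=> cA s; rewrite /determinant.
have FF : Filter (nbhs s) := nbhs_filter s.
apply: (@cvg_sumr R _ (nbhs s)) => p.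
apply: cvgM; first exact: cvg_cst.
elim: (index_enum _) => [|i r IH].
  by rewrite big_nil; under eq_fun do rewrite big_nil; exact: cvg_cst.
by rewrite big_cons; under eq_fun do rewrite big_cons; apply: cvgM; first exact: cA.
Qed.

(* The point of a small ball minimising [|f s - y|^2] is interior, and the
   Jacobian there is invertible, so the critical point equation gives [f s = y]. *)
Lemma local_surjectivity (f : V -> V) (B : 'M[R]_n) : smooth f -> f 0 = 0 ->
  (forall v, 'D_v f 0 = v *m B) -> B \in unitmx ->
  exists r rho : R, 0 < rho /\ forall y, `|y| < rho -> exists2 s, `|s| <= r & f s = y.
Proof.
move=> sf f0 DB uB.
pose J s : 'M[R]_n := \matrix_(k, i) ('D_(delta_mx 0 k) f s) 0 i.
have cJ : continuous (fun s => \det (J s)).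
  apply: continuous_det => i j; under eq_fun do rewrite mxE.
  exact: smooth_continuous (smooth_coord j (smooth_D _ sf)).
have J0 : J 0 = B.
  by apply/matrixP => k i; rewrite mxE DB -rowE mxE.
have dJ0 : 0 < `|\det (J 0)| by rewrite J0 normr_gt0 -unitfE -unitmxE.
have /cvgrPdist_lt/(_ _ dJ0)/nbhs_ballP[r1 /= r10 H1] := cJ 0.
have [C C0 HC] := mulmx_norm_bound (invmx B).
have e0 : 0 < (2 * C)^-1 by rewrite invr_gt0 mulr_gt0.
have /nbhs_ballP[r2 /= r20 H2] := differentiable_eps (differentiable_smooth 0 sf) e0.
pose r := Num.min r1 r2 / 2.
have r0 : 0 < r by rewrite divr_gt0// lt_min r10.
have rlt : r < Num.min r1 r2 by rewrite /r ltr_pdivrMr// ltr_pMr ?ltr1n// lt_min r10.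
have Jn0 s : `|s| <= r -> J s \in unitmx.
  move=> sr; rewrite unitmxE unitfE; apply/negP => /eqP E.
  have sr1 : ball 0 r1 s.
    rewrite -ball_normE /= sub0r normrN.
    by apply: (le_lt_trans sr); apply: (lt_le_trans rlt); rewrite ge_min lexx.
  by have := H1 s sr1; rewrite E subr0 lt_irreflexive.
(* Lower bound from the derivative at 0: the linear part has inverse norm at most C, and the choice
   eps = 1 / (2 C) lets the remainder absorb half of |s|. *)
have low s : `|s| <= r -> `|s| <= 2 * C * `|f s|.
  move=> sr; have := H2 s; rewrite -ball_normE /= sub0r normrN addr0 f0 subr0.
  rewrite -deriveE ?DB; last exact: differentiable_smooth.
  have -> // : `|s| < r2.
    by apply: (le_lt_trans sr); apply: (lt_le_trans rlt); rewrite ge_min lexx orbT.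
  move=> /(_ isT) h.
  have : `|s| <= C * `|s *m B|.
    by have := HC (s *m B); rewrite -mulmxA mulmxV// mulmx1.
  have : `|s *m B| <= `|f s| + `|f s - s *m B|.
    by rewrite -[s *m B](subKr (f s)) (le_trans (ler_normB _ _))// subKr.
  move=> h3 h4.
  have h5 : C * `|s *m B| <= C * `|f s| + `|s| / 2.
    apply: (@le_trans _ _ (C * (`|f s| + (2 * C)^-1 * `|s|))).
      by rewrite ler_pM2l// (le_trans h3)// lerD2l.
    have -> : `|s| / 2 = C * ((2 * C)^-1 * `|s|) by field; rewrite gt_eqF.
    by rewrite mulrDr.
  by have := le_trans h4 h5; lra.
(* On the sphere |s| = r one has |f s| >= (n + 3) [rho], hence |f s - y| >= (n + 2) [rho], whereas
   [psi 0] <= n [rho]^2. Since (n + 2)^2 > n, a minimiser cannot lie on the sphere. *)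
pose rho := r / (2 * C) / (n%:R + 3%:R).
have n3 : 0 < n%:R + 3%:R :> R by rewrite ltr_wpDl.
have rho0 : 0 < rho.
  by apply: divr_gt0 => //; apply: divr_gt0 => //; exact: mulr_gt0.
exists r, rho; split => // y yrho.
pose psi s := \sum_i (f s 0 i - y 0 i) ^+ 2.
have spsi : smooth psi.
  apply: smooth_sum => i; apply: smoothX; apply: smoothB; last exact: smooth_cst.
  exact: smooth_coord.
have cB : compact [set x : V | `|x| <= r].
  apply: bounded_closed_compact.
    exists r; split; first exact: num_real.
    by move=> m rm x /= xr; rewrite (le_trans xr)// ltW.
  apply: (@preimage_closed _ _ _ [set y : R | y <= r]); last exact: closed_le.
  by move=> x _; exact: norm_continuous.
have [||s /set_mem sr Hs] := @EVT_min_rV R n psi [set x | `|x| <= r] _ cB.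
- by exists 0; rewrite /= normr0 ltW.
- by apply: continuous_subspaceT => x; exact: (smooth_continuous spsi).
exists s => //.
have srlt : `|s| < r.
  rewrite lt_neqAle sr andbT; apply/eqP => E.
  have h0 : psi s <= psi 0 by apply: Hs; rewrite inE /= normr0 ltW.
  have h1 : psi 0 <= n%:R * rho ^+ 2.
    rewrite /psi; apply: (@le_trans _ _ (\sum_(i < n) rho ^+ 2)).
      apply: ler_sum => i _; rewrite f0 mxE sub0r sqrrN -[leLHS]real_normK ?num_real//.
      rewrite lerXn2r ?nnegrE ?(ltW rho0)//.
      exact: (le_trans (rV_coord_le_norm _ _) (ltW yrho)).
    by rewrite sumr_const card_ord mulr_natl.
  have h2 : (n%:R + 2) * rho <= `|f s - y|.
    have := low s sr; rewrite E => h3.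
    have h4 : r / (2 * C) <= `|f s| by rewrite ler_pdivrMr ?mulr_gt0// mulrC.
    have h5 : (n%:R + 3%:R) * rho = r / (2 * C) by rewrite mulrC divfK// gt_eqF.
    have h6 : `|f s| <= `|f s - y| + `|y|.
      by rewrite -{1}[f s](subrK y) ler_normD.
    lra.
  have h3 : `|f s - y| ^+ 2 <= psi s.
    have [|] := eqVneq (f s - y) 0.
      by move=> ->; rewrite normr0 expr0n /=; apply: sumr_ge0 => i _; exact: sqr_ge0.
    rewrite -normr_eq0 => /mx_norm_neq0[[k i] /=]; rewrite ord1 => Ei.
    rewrite [`|f s - y|]Ei real_normK ?num_real//.
    rewrite /psi (bigD1 i)//= !mxE lerDl.
    by apply: sumr_ge0 => q _; exact: sqr_ge0.
  have h4 : ((n%:R + 2) * rho) ^+ 2 <= n%:R * rho ^+ 2.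
    apply: le_trans (le_trans h3 (le_trans h0 h1)).
    by rewrite ler_sqr ?nnegrE// mulr_ge0 ?ltW// ltr_wpDl.
  move: h4; rewrite exprMn ler_pM2r ?exprn_gt0// => h4.
  have : 0 <= n%:R :> R by [].
  by move: h4; nra.
have crit v : 'D_v psi s = 0.
  pose g (t : R) := psi (s + t *: v).
  have dg (t : R) : is_derive t 1 g ('D_v psi (s + t *: v)).
    exact: derivable_line (smooth_derivable spsi _ _).
  pose d := (r - `|s|) / (`|v| + 1).
  have v1 : 0 < `|v| + 1 by rewrite ltr_wpDl.
  have d0 : 0 < d by rewrite divr_gt0// subr_gt0.
  have Hd : - d < d by rewrite gtrN.
  have c0 : 0 \in `]- d, d[ by rewrite in_itv /= oppr_lt0 d0.
  have [||_] := @derive1_at_min R g (- d) d 0 (ltW Hd) _ c0.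
  - by move=> t _; have [] := dg t.
  - move=> t; rewrite in_itv /= -ltr_norml => td; rewrite /g scale0r addr0; apply: Hs.
    rewrite inE /= (le_trans (ler_normD _ _))// normrZ -lerBrDl.
    move: td; rewrite /d ltr_pdivlMr// => /ltW; apply: le_trans.
    by rewrite ler_wpM2l// lerDl.
  - by have [_ ->] := dg 0; rewrite scale0r addr0.
have : (f s - y) *m (J s)^T = 0.
  apply/rowP => k; rewrite !mxE.
  have dpsi : is_derive s (delta_mx 0 k : V) psi
      (\sum_i (2 * (f s 0 i - y 0 i)) *: ('D_(delta_mx 0 k) f s) 0 i).
    have -> : psi = \sum_i ((fun s => f s 0 i - y 0 i) ^+ 2).
      by apply/funext => u; rewrite fct_sumE.
    apply: is_derive_sum => i.
    have df := smooth_derivable sf (delta_mx 0 k) s.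
    have dfi : is_derive s (delta_mx 0 k : V) (fun u => f u 0 i) (('D_(delta_mx 0 k) f s) 0 i).
      apply: DeriveDef; first by apply: smooth_derivable; exact: smooth_coord.
      by rewrite derive_mx// mxE.
    have dfy : is_derive s (delta_mx 0 k : V) (fun u => f u 0 i - y 0 i) (('D_(delta_mx 0 k) f s) 0 i).
      have := is_deriveB dfi (is_derive_cst (y 0 i) s (delta_mx 0 k)).
      by rewrite subr0.
    by have := is_deriveX 2 dfy; rewrite /= expr1.
  have := crit (delta_mx 0 k); have [_ ->] := dpsi => E0.
  apply: (mulfI (_ : 2 != 0 :> R)); first by rewrite pnatr_eq0.
  rewrite mulr0 -[RHS]E0 mulr_sumr; apply: eq_bigr => i _.
  by rewrite !mxE mulrA.
move=> E; apply/eqP; rewrite -subr_eq0; apply/eqP.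
have uJ : (J s)^T \in unitmx by rewrite unitmx_tr Jn0.
by rewrite -[LHS]mulmx1 -(mulmxV uJ) mulmxA E mul0mx.
Qed.

End local_surjectivity.

(** * Reachable points, the adjoint action and finiteness of the distance *)

Section chow.
Variables (R : realType) (N1 M : nat).
Notation N := (N1 + M)%N.
Notation pt := 'rV[R]_N.
Variables (op : pt -> pt -> pt) (inv : pt -> pt) (sigma : 'I_N -> nat).
Hypothesis G : carnot_group op inv sigma.
Notation joined := (joined op).
Let smooth_op (E : normedModType R) (f g : E -> pt) := smooth_op G (f := f) (g := g).

Lemma derive_sumM (E : normedModType R) n (a b : 'I_n -> E -> R) x v :
  (forall k, derivable (a k) x v) -> (forall k, derivable (b k) x v) ->
  'D_v (fun p => \sum_k a k p * b k p) x =
  \sum_k (a k x * 'D_v (b k) x + b k x * 'D_v (a k) x).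
Proof.
move=> da db.
have -> : (fun p => \sum_k a k p * b k p) = \sum_k (a k * b k).
  by apply/funext => p; rewrite fct_sumE.
rewrite derive_sum => [|k]; last exact: derivableM.
by apply: eq_bigr => k _; rewrite deriveM.
Qed.

Lemma schwarz_rV (V : normedModType R) n (f : V -> 'rV[R]_n) x u v : smooth f ->
  'D_v ('D_u f) x = 'D_u ('D_v f) x.
Proof.
move=> sf; have df w y : derivable f y w := smooth_derivable sf w y.
have Ew w i : (fun y => ('D_w f y) 0 i) = 'D_w (fun y => f y 0 i).
  by apply/funext => y; exact/esym/derive_coord.
apply/rowP => i.
have dd w z : ('D_w ('D_z f) x) 0 i = 'D_w ('D_z (fun y => f y 0 i)) x.
  by rewrite -Ew; apply/esym/derive_coord; exact: smooth_derivable (smooth_D z sf) _ _.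
exact: etrans (dd v u) (etrans (schwarz x u v (smooth_coord i sf)) (esym (dd u v))).
Qed.

Definition reachable (x : pt) := exists T, joined 0 x T.

Lemma reachable_op x y : reachable x -> reachable y -> reachable (op x y).
Proof.
move=> [S xS] [T yT]; exists (S + T).
by have := joined_op G x yT; rewrite (cg_x0 G) => H; exact: (joined_trans G xS H).
Qed.

Lemma reachable_inv x : reachable x -> reachable (inv x).
Proof.
move=> [T xT]; exists T; apply: (joined_sym G).
by have := joined_op G (inv x) xT; rewrite (cg_x0 G) (cg_inv G x).2.
Qed.

Lemma unit_ctrl j : \sum_i ((delta_mx 0 j : 'rV[R]_N1) 0 i) ^+ 2 <= 1.
Proof.
rewrite (bigD1 j)//= big1 ?addr0 ?mxE ?eqxx ?expr1n// => i ij.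
by rewrite mxE (negbTE ij) expr0n.
Qed.

Lemma joined_exp j (s : R) :
  joined 0 (exp_curve op sigma (delta_mx 0 j) s) `|s|.
Proof.
have E u : op 0 u = u := cg_0x G u.
have [s0|/ltW s0] := leP 0 s.
  have := joined_exp_curve G 0 s0 (unit_ctrl j).
  by rewrite !E (exp_curve0 G) subr0 ger0_norm.
apply: (joined_sym G).
have := joined_exp_curve G 0 s0 (unit_ctrl j).
by rewrite !E (exp_curve0 G) sub0r ler0_norm.
Qed.

Lemma reachable_exp j s : reachable (exp_curve op sigma (delta_mx 0 j) s).
Proof. by exists `|s|; exact: joined_exp. Qed.

Lemma joined00 : joined 0 0 0.
Proof.
have h0 : \sum_i ((0 : 'rV[R]_N1) 0 i) ^+ 2 <= 1.
  by rewrite big1// => j _; rewrite mxE expr0n.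
have := joined_exp_curve G 0 (lexx 0) h0.
by rewrite (exp_curve0 G) (cg_x0 G) subrr.
Qed.

Lemma reachable0 : reachable 0.
Proof. by exists 0; exact: joined00. Qed.

Definition opconj (p y : pt) := op (op p y) (inv p).

Lemma smooth_opconj p : smooth (opconj p).
Proof.
apply: smooth_op; last exact: smooth_cst.
exact: (smooth_opl G).
Qed.

Lemma opconj0 p : opconj p 0 = 0.
Proof. by rewrite /opconj (cg_x0 G) (cg_inv G p).1. Qed.

Lemma opconjM p q y : opconj (op p q) y = opconj p (opconj q y).
Proof.
have invM : inv (op p q) = op (inv q) (inv p).
  have h : op (op p q) (op (inv q) (inv p)) = 0.
    by rewrite -(cg_assoc G) (cg_assoc G q) (cg_inv G q).1 (cg_0x G) (cg_inv G p).1.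
  by rewrite -[RHS](opVK G (op p q)) h (cg_x0 G).
by rewrite /opconj invM !(cg_assoc G).
Qed.

(** The adjoint representation; its derivative [ad] at the identity is the Lie bracket on the
    tangent space at 0. *)
Definition Ad (p v : pt) : pt := 'D_v (opconj p) 0.

Lemma Ad_linear p : linear (Ad p).
Proof. by move=> k u v; exact: derive_smooth_linear (smooth_opconj p). Qed.
HB.instance Definition _ p := GRing.isLinear.Build R pt pt *:%R (Ad p) (Ad_linear p).

Lemma Ad_op p q v : Ad (op p q) v = Ad p (Ad q v).
Proof.
have dq : is_derive (0 : pt) v (opconj q) (Ad q v).
  by apply: DeriveDef => //; exact: smooth_derivable (smooth_opconj q) _ _.
have [_ E] := is_derive_comp_smooth (smooth_opconj p) dq; rewrite opconj0 in E.
rewrite -[RHS]E /Ad; congr ('D_v _ 0); apply/funext => y; exact: opconjM.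
Qed.

Lemma Ad0 v : Ad 0 v = v.
Proof.
rewrite /Ad (_ : opconj 0 = id) ?derive_id//; apply/funext => y.
by rewrite /opconj (op_inv0 G) (cg_x0 G) (cg_0x G).
Qed.

Lemma smooth_Ad v : smooth (Ad ^~ v).
Proof.
have -> : Ad ^~ v = fun p => 'D_((0, v) : pt * pt) (fun q : pt * pt => opconj q.1 q.2) (p, 0).
  by apply/funext => p; rewrite /Ad derive_pair2.
apply: (@smooth_comp_op R _ _ _ pt (fun a b => 'D_((0, v) : pt * pt)
   (fun q : pt * pt => opconj q.1 q.2) (a, b)) (fun x => x) (fun=> 0) _
   (@smooth_id _ _) (smooth_cst _)).
have : smooth ('D_((0, v) : pt * pt) (fun q : pt * pt => opconj q.1 q.2)).
  apply: smooth_D; apply: smooth_op; last by apply: (smooth_inv G); exact: smooth_fst.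
  by apply: smooth_op; [exact: smooth_fst|exact: smooth_snd].
by congr smooth; apply/funext => -[].
Qed.

Definition ad (v w : pt) : pt := 'D_v (Ad ^~ w) 0.

(** With m a b = x a b, the field of [w] at x p is the derivative of m in its first slot along
    [Ad p w], while that of [v] at x q is a derivative in the second slot. Differentiating the first
    expression along [v] gives the field of [ad v w] plus a mixed derivative of m; by Schwarz's
    theorem that mixed derivative is the second term of the bracket, and they cancel. *)
Lemma bracket_left_field v w :
  lie_bracket (left_field op v) (left_field op w) = left_field op (ad v w).
Proof.
apply/funext => x.
pose m (a b : pt) := op x (op a b).
have sm : smooth (fun q : pt * pt => m q.1 q.2).
  apply: smooth_op; first exact: smooth_cst.
  by apply: smooth_op; [exact: smooth_fst|exact: smooth_snd].
have sma p : smooth (m ^~ p).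
  apply: smooth_op; first exact: smooth_cst.
  by apply: smooth_op; [exact: smooth_id|exact: smooth_cst].
have smb p : smooth (m p).
  apply: smooth_op; first exact: smooth_cst.
  exact: (smooth_opl G).
(* [x p y = x (p y p^-1) p] *)
have L1 p : left_field op w (op x p) = 'D_(Ad p w) (m ^~ p) 0.
  have dp : is_derive (0 : pt) w (opconj p) (Ad p w).
    by apply: DeriveDef => //; exact: smooth_derivable (smooth_opconj p) _ _.
  have [_] := is_derive_comp_smooth (sma p) dp; rewrite opconj0 => <-.
  rewrite /left_field; congr ('D_w _ 0); apply/funext => y.
  by rewrite /m /opconj -!(cg_assoc G) (cg_inv G p).2 (cg_x0 G).
have L2 q : left_field op v (op x q) = 'D_v (m q) 0.
  rewrite /left_field; congr ('D_v _ 0); apply/funext => y.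
  by rewrite /m (cg_assoc G).
pose K k p : pt := 'D_(delta_mx 0 k) (m ^~ p) 0.
have KE k : K k = fun p => 'D_((delta_mx 0 k, 0) : pt * pt) (fun q : pt * pt => m q.1 q.2) (0, p).
  by apply/funext => p; rewrite /K derive_pair1.
have dx u : is_derive (0 : pt) u (op x) (left_field op u x).
  by apply: DeriveDef => //; exact: smooth_derivable (smooth_opl G x) _ _.
have D1 : 'D_(left_field op v x) (left_field op w) x = 'D_v (fun p => left_field op w (op x p)) 0.
  have [_ E] := is_derive_comp_smooth (smooth_left_field G w) (dx v).
  by rewrite (cg_x0 G) in E; exact: esym E.
have D2 : 'D_(left_field op w x) (left_field op v) x = 'D_w (fun p => left_field op v (op x p)) 0.
  have [_ E] := is_derive_comp_smooth (smooth_left_field G v) (dx w).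
  by rewrite (cg_x0 G) in E; exact: esym E.
apply: etrans (congr2 (fun a b => a - b) D1 D2) _.
have sK k : smooth (K k).
  rewrite KE; apply: (@smooth_comp_op R _ _ _ pt (fun a b => 'D_((delta_mx 0 k, 0) : pt * pt)
   (fun q : pt * pt => m q.1 q.2) (a, b)) (fun=> 0) (fun x => x) _
   (smooth_cst _) (@smooth_id _ _)).
  have := smooth_D ((delta_mx 0 k, 0) : pt * pt) sm.
  by congr smooth; apply/funext => -[].
have sE1 : smooth (fun p => left_field op w (op x p)).
  by apply: smooth_comp; [exact: smooth_left_field G w|exact: smooth_opl G x].
have sW : smooth (fun p => 'D_w (m ^~ p) 0).
  have -> : (fun p => 'D_w (m ^~ p) 0) =
      fun p => 'D_((w, 0) : pt * pt) (fun q : pt * pt => m q.1 q.2) (0, p).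
    by apply/funext => p; rewrite derive_pair1.
  apply: (@smooth_comp_op R _ _ _ pt (fun a b => 'D_((w, 0) : pt * pt)
   (fun q : pt * pt => m q.1 q.2) (a, b)) (fun=> 0) (fun x => x) _
   (smooth_cst _) (@smooth_id _ _)).
  have := smooth_D ((w, 0) : pt * pt) sm.
  by congr smooth; apply/funext => -[].
have E1 : 'D_v (fun p => left_field op w (op x p)) 0 =
    left_field op (ad v w) x + 'D_v (fun p => 'D_w (m ^~ p) 0) 0.
  apply/rowP => i; rewrite [RHS]mxE.
  have dK k p u : derivable (fun p => K k p 0 i) p u.
    exact: smooth_derivable (smooth_coord i (sK k)) _ _.
  have dA k p u : derivable (fun p => Ad p w 0 k) p u.
    exact: smooth_derivable (smooth_coord k (smooth_Ad w)) _ _.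
  apply: etrans (esym (derive_coord i (smooth_derivable sE1 v 0))) _.
  apply: etrans _ (congr1 (+%R _) (derive_coord i (smooth_derivable sW v 0))).
  have -> : (fun p => left_field op w (op x p) 0 i) =
      fun p => \sum_k Ad p w 0 k * K k p 0 i.
    apply/funext => p; rewrite L1 (derive_smooth_sum _ _ (sma p)) summxE.
    by apply: eq_bigr => k _; rewrite mxE.
  have -> : (fun p => ('D_w (m ^~ p) 0) 0 i) = fun p => \sum_k w 0 k * K k p 0 i.
    apply/funext => p; rewrite (derive_smooth_sum _ _ (sma p)) summxE.
    by apply: eq_bigr => k _; rewrite mxE.
  rewrite (derive_sumM (fun k => dA k 0 v) (fun k => dK k 0 v)).
  rewrite (derive_sumM (fun k => derivable_cst (w 0 k) 0 v) (fun k => dK k 0 v)).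
  rewrite (left_field_sum G) summxE -big_split; apply: eq_bigr => k _.
  rewrite Ad0 derive_cst mulr0 addr0 addrC; congr (_ + _).
  rewrite mxE mulrC; congr (_ * _).
    exact: derive_coord (smooth_derivable (smooth_Ad w) _ _).
  have m0 : m ^~ 0 = op x by apply/funext => y; rewrite /m (cg_x0 G).
  by rewrite /K m0.
have E2 : 'D_w (fun p => left_field op v (op x p)) 0 = 'D_v (fun p => 'D_w (m ^~ p) 0) 0.
  under eq_fun do rewrite L2 derive_pair2.
  under [in RHS]eq_fun do rewrite derive_pair1.
  rewrite (derive_pair1 (fun a b => 'D_((0, v) : pt * pt) (fun q : pt * pt => m q.1 q.2) (a, b))).
  rewrite (derive_pair2 (fun a b => 'D_((w, 0) : pt * pt) (fun q : pt * pt => m q.1 q.2) (a, b))).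
  have P (F : pt * pt -> pt) : (fun p : pt * pt => F (p.1, p.2)) = F by apply/funext => -[].
  pose MM (q : pt * pt) := m q.1 q.2.
  apply: etrans (congr1 (fun F => 'D_((w, 0) : pt * pt) F (0, 0)) (P ('D_((0, v) : pt * pt) MM))) _.
  apply: etrans (schwarz_rV _ _ _ sm) _.
  exact: (congr1 (fun F => 'D_((0, v) : pt * pt) F (0, 0)) (esym (P ('D_((w, 0) : pt * pt) MM)))).
exact: etrans (congr2 (fun a b => a - b) E1 E2) (addrK _ _).
Qed.

Definition annihilator (c : pt) := forall h j, reachable h -> row_form c (Ad h (ej R M j)) = 0.

(** The linear span of the vectors Ad(h) e_j with h reachable, described through its annihilator so
    that no finite combinations need be handled. *)
Definition spanned (v : pt) := forall c, annihilator c -> row_form c v = 0.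

(** An annihilating covector composed with Ad(h) still annihilates, because a product of reachable
    points is reachable. *)
Lemma spanned_Ad h v : reachable h -> spanned v -> spanned (Ad h v).
Proof.
move=> rh sv c ac.
have E u : row_form (\row_k row_form c (Ad h (delta_mx 0 k))) u = row_form c (Ad h u).
  rewrite {2}[u]row_sum_delta !linear_sum /row_form; apply: eq_bigr => k _.
  by rewrite !linearZ mxE.
rewrite -E; apply: sv => h' j rh'; rewrite E -Ad_op; apply: ac.
exact: reachable_op.
Qed.

Lemma spanned_ej j : spanned (ej R M j).
Proof. by move=> c /(_ 0 j reachable0); rewrite Ad0. Qed.

Definition conj_curve h j (s : R) : pt := opconj h (exp_curve op sigma (delta_mx 0 j) s).

Lemma reachable_conj_curve h j s : reachable h -> reachable (conj_curve h j s).
Proof.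
move=> rh; apply: reachable_op; last exact: reachable_inv.
by apply: reachable_op => //; exact: reachable_exp.
Qed.

Lemma conj_curve0 h j : conj_curve h j 0 = 0.
Proof. by rewrite /conj_curve (exp_curve0 G) opconj0. Qed.

Lemma smooth_conj_curve h j : smooth (conj_curve h j).
Proof.
apply: smooth_comp; first exact: smooth_opconj.
exact: smooth_exp_curve.
Qed.

Lemma row_mx_ej (j : 'I_N1) : row_mx (delta_mx 0 j) 0 = ej R M j.
Proof.
apply/rowP => k; rewrite mxE; case: (split_ordP k) => i ->; rewrite !mxE eqxx /=.
  by rewrite (inj_eq (@lshift_inj _ _)).
by rewrite eq_rlshift.
Qed.

Lemma is_derive_conj_curve h j : is_derive (0 : R) 1 (conj_curve h j) (Ad h (ej R M j)).
Proof.
have := is_derive_comp_smooth (smooth_opconj h) (is_derive_exp_curve G (delta_mx 0 j) 0).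
by rewrite (exp_curve0 G) (left_field0 G) row_mx_ej.
Qed.

(** By linearity in [v] it suffices to treat v = Ad(h) e_j, the initial velocity of the reachable
    curve [conj_curve h j]. Along this curve c(Ad(p) w) is identically 0, so its derivative at 0
    vanishes. *)
Lemma spanned_ad v w : spanned v -> spanned w -> spanned (ad v w).
Proof.
move=> sv sw c ac.
have E u : row_form (\row_k row_form c (ad (delta_mx 0 k) w)) u = row_form c (ad u w).
  rewrite /ad [in RHS](derive_smooth_sum _ _ (smooth_Ad w)) linear_sum /row_form.
  by apply: eq_bigr => k _; rewrite linearZ mxE.
rewrite -E; apply: sv => h j rh; rewrite E.
have sc : smooth (fun p => row_form c (Ad p w)).
  apply: smooth_comp_rV; last exact: smooth_Ad.
  by apply: smooth_linear; exact: rV_linear_continuous.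
have d1 := is_derive_comp_smooth (smooth_Ad w) (is_derive_conj_curve h j).
rewrite conj_curve0 in d1.
have sl : smooth (row_form c : pt -> R).
  by apply: smooth_linear; exact: rV_linear_continuous.
have [_ d2] := is_derive_comp_smoothR sl d1.
rewrite derive_linear in d2; last exact: rV_linear_continuous.
rewrite -[LHS]d2 (_ : (fun s => _) = fun=> 0) ?derive_cst//.
apply/funext => s; apply: spanned_Ad ac => //; exact: reachable_conj_curve.
Qed.

Lemma lie_gen_spanned X : lie_gen op X -> exists2 v, spanned v & X = left_field op v.
Proof.
elim=> [j|Y Z _ [v sv ->] _ [w sw ->]]; first by exists (ej R M j); [exact: spanned_ej|].
by exists (ad v w); [exact: spanned_ad|exact: bracket_left_field].
Qed.

Hypothesis horm : hormander op.

(** Every iterated bracket is the left-invariant field of a spanned vector; the rank condition at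
    the identity leaves no nonzero annihilator. *)
Lemma annihilator_eq0 c : annihilator c -> c = 0.
Proof.
move=> ac; have [A [fA HA]] := horm 0; apply: (row_form_eq0_unit fA) => i.
have [X lX ->] := HA i; have [v sv ->] := lie_gen_spanned lX.
by rewrite (left_field0 G); exact: sv.
Qed.

Lemma Ad_basis : exists (h : 'I_N -> pt) (j : 'I_N -> 'I_N1) (A : 'M[R]_N),
  [/\ A \in unitmx, forall i, reachable (h i) & forall i, row i A = Ad (h i) (ej R M (j i))].
Proof.
have [|A [uA HA]] := @spanning_basis R N [set u | exists h j, reachable h /\ u = Ad h (ej R M j)].
  move=> c Hc; apply: annihilator_eq0 => h j rh; apply: Hc.
  by exists h, j.
have /choice[hj Hhj] : forall i, exists p : pt * 'I_N1, reachable p.1 /\ row i A = Ad p.1 (ej R M p.2).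
  by move=> i; have [h [j H]] := HA i; exists (h, j).
exists (fun i => (hj i).1), (fun i => (hj i).2), A; split => // i.
- exact: (Hhj i).1.
- exact: (Hhj i).2.
Qed.

(** At the identity the differential of the multiplication is addition. *)
Lemma is_derive_op0 (E : normedModType R) (f g : E -> pt) x v :
  smooth f -> smooth g -> f x = 0 -> g x = 0 ->
  'D_v (fun y => op (f y) (g y)) x = 'D_v f x + 'D_v g x.
Proof.
move=> sf sg f0 g0.
pose OP (p : 'rV[R]_(N + N)) : pt := op (lsubmx p) (rsubmx p).
have sl : smooth (@lsubmx R 1 N N) by apply: smooth_linear; exact: rV_linear_continuous.
have sr : smooth (@rsubmx R 1 N N) by apply: smooth_linear; exact: rV_linear_continuous.
have sOP : smooth OP by exact: smooth_op sl sr.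
have srow : smooth (fun y => row_mx (f y) (g y)).
  apply: smooth_of_coord => j.
  case: (split_ordP j) => k ->.
    by under eq_fun do rewrite row_mxEl; exact: smooth_coord.
  by under eq_fun do rewrite row_mxEr; exact: smooth_coord.
have drow : is_derive x v (fun y => row_mx (f y) (g y)) (row_mx ('D_v f x) ('D_v g x)).
  have dr := smooth_derivable srow v x; apply: DeriveDef => //.
  apply/rowP => j; rewrite -(derive_coord j dr).
  case: (split_ordP j) => k ->.
    rewrite row_mxEl -(derive_coord k (smooth_derivable sf v x)).
    by congr (derive _ x v); apply/funext => y; rewrite row_mxEl.
  rewrite row_mxEr -(derive_coord k (smooth_derivable sg v x)).
  by congr (derive _ x v); apply/funext => y; rewrite row_mxEr.
have [_ E1] := is_derive_comp_smooth sOP drow.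
have -> : (fun y => op (f y) (g y)) = fun y => OP (row_mx (f y) (g y)).
  by apply/funext => y; rewrite /OP row_mxKl row_mxKr.
rewrite [LHS]E1 f0 g0 row_mx0.
set a := 'D_v f x; set b := 'D_v g x.
have -> : row_mx a b = 1 *: row_mx a 0 + row_mx 0 b.
  by rewrite scale1r add_row_mx addr0 add0r.
rewrite (derive_smooth_linear 0 1 (row_mx a 0) (row_mx 0 b) sOP) scale1r; congr (_ + _).
- rewrite -[RHS](derive_id (0 : pt)); apply: derive_eq_along => h.
  by rewrite /OP !addr0 scale_row_mx scaler0 row_mxKl row_mxKr (cg_x0 G).
- rewrite -[RHS](derive_id (0 : pt)); apply: derive_eq_along => h.
  by rewrite /OP !addr0 scale_row_mx scaler0 row_mxKl row_mxKr (cg_0x G).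
Qed.

Lemma cc_ball_nbhs : exists C rho : R, [/\ 0 <= C, 0 < rho &
  forall y, `|y| < rho -> exists2 T, T <= C & joined 0 y T].
Proof.
have [h [jj [A [uA rh HA]]]] := Ad_basis.
pose c i (s : pt) := conj_curve (h i) (jj i) (s 0 i).
have sc i : smooth (c i).
  apply: smooth_of_coord => k.
  apply: (@smooth_comp1 R pt (fun u => conj_curve (h i) (jj i) u 0 k) (fun s => s 0 i)).
    exact: smooth_coord (smooth_conj_curve _ _).
  exact: smooth_coord (@smooth_id _ _).
have c0 i : c i 0 = 0 by rewrite /c mxE conj_curve0.
have dc i v : 'D_v (c i) 0 = v 0 i *: Ad (h i) (ej R M (jj i)).
  have := is_derive_conj_curve (h i) (jj i); have dcc := smooth_derivable (smooth_conj_curve (h i) (jj i)) 1 0.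
  move=> [_ <-]; have dC : differentiable (conj_curve (h i) (jj i)) 0 by apply/derivable1_diffP.
  have d0 : is_derive (0 : pt) v (fun s : pt => s 0 i) (v 0 i).
    have dd := smooth_derivable (smooth_coord i (@smooth_id R pt)) v 0.
    by apply: DeriveDef => //; rewrite (derive_coord i (smooth_derivable (@smooth_id R pt) v 0)) derive_id.
  have [d1 d2] := d0.
  have dC' : differentiable (conj_curve (h i) (jj i)) ((fun s : pt => s 0 i) 0) by rewrite mxE.
  have [_ E] := derive_comp_diff d1 dC'.
  rewrite [LHS]E d2 mxE deriveE//.
  rewrite (_ : v 0 i = v 0 i *: (1 : R^o)) ?linearZ//; last by rewrite [_ *: _]mulr1.
  by rewrite [v 0 i *: 1]mulr1.
pose F := fun r : seq 'I_N => fun s : pt => foldr (fun i acc => op (c i s) acc) 0 r.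
have sF r : smooth (F r).
  by elim: r => [|i r IH]; [exact: smooth_cst|exact: smooth_op (sc i) IH].
have F0 r : F r 0 = 0.
  by elim: r => [|i r IH] //=; rewrite c0 (cg_0x G).
have dF r v : 'D_v (F r) 0 = \sum_(i <- r) v 0 i *: Ad (h i) (ej R M (jj i)).
  elim: r => [|i r IH]; first by rewrite big_nil derive_cst.
  rewrite big_cons -IH -dc; exact: is_derive_op0 (sc i) (sF r) (c0 i) (F0 r).
have DB v : 'D_v (F (index_enum _)) 0 = v *m A.
  by rewrite dF mulmx_sum_row; apply: eq_bigr => i _; rewrite HA.
have [r [rho [rho0 H]]] := local_surjectivity (sF _) (F0 _) DB uA.
have /choice[T HT] := rh.
(* The conjugate is reached by going to [h i], following the exponential for time |s_i|, then
   travelling by a path to the inverse of [h i]. *)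
have jc i s : joined 0 (c i s) (T i + (`|s 0 i| + T i)).
  apply: (joined_trans G (HT i)).
  have j2 := joined_op G (h i) (joined_exp (jj i) (s 0 i)); rewrite (cg_x0 G) in j2.
  apply: (joined_trans G j2).
  have j3 := joined_sym G (joined_op G (inv (h i)) (HT i)).
  rewrite (cg_x0 G) (cg_inv G _).2 in j3.
  have := joined_op G (op (h i) (exp_curve op sigma (delta_mx 0 (jj i)) (s 0 i))) j3.
  by rewrite (cg_x0 G).
have jF q s : joined 0 (F q s) (\sum_(i <- q) (T i + (`|s 0 i| + T i))).
  elim: q => [|i q IH]; first by rewrite big_nil; exact: joined00.
  rewrite big_cons; apply: (joined_trans G (jc i s)).
  by have := joined_op G (c i s) IH; rewrite (cg_x0 G).
have T0 i : 0 <= T i by have [] := HT i.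
exists (\sum_i (T i + (`|r| + T i))), rho; split => //.
  by apply: sumr_ge0 => i _; rewrite !addr_ge0.
move=> y /H[s sr <-]; exists (\sum_i (T i + (`|s 0 i| + T i))) => //.
apply: ler_sum => i _; rewrite lerD2l lerD2r.
by rewrite (le_trans (rV_coord_le_norm _ _))// (le_trans sr)// ler_norm.
Qed.

(** A dilation brings [x] into the neighbourhood reached above, and the path found there is scaled
    back. *)
Lemma joined_exists x : exists T, joined 0 x T.
Proof.
have [C [rho [C0 rho0 H]]] := cc_ball_nbhs.
have := smooth_continuous (smooth_dil_curve sigma x) 0.
move=> /cvgrPdist_lt/(_ _ rho0)/nbhs_ballP[d /= d0 Hd].
have l0 : 0 < d / 2 by rewrite divr_gt0.
have := Hd (d / 2); rewrite (dil_0 (sigma_gt0 G)) sub0r normrN => Hl.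
have [|T _ jT] := H (dil sigma (d / 2) x).
  apply: Hl; rewrite -ball_normE /= sub0r normrN gtr0_norm//.
  by rewrite ltr_pdivrMr// ltr_pMr// ltr1n.
exists ((d / 2)^-1 * T); have li : 0 < (d / 2)^-1 by rewrite invr_gt0.
by have := joined_dil G li jT; rewrite dil0 dilM mulVf ?dil1// gt_eqF.
Qed.

(** The dilation of ratio [l] = (C + 1) / [eta] turns travel times at most C into times at most
    [eta]; the added 1 keeps [l] positive when C = 0. *)
Lemma joined_near0 (eta : R) : 0 < eta ->
  exists2 d : R, 0 < d & forall x, `|x| < d -> exists2 T, T <= eta & joined 0 x T.
Proof.
move=> eta0; have [C [rho [C0 rho0 H]]] := cc_ball_nbhs.
pose l := (C + 1) / eta.
have C1 : 0 < C + 1 by rewrite ltr_wpDl.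
have l0 : 0 < l by rewrite divr_gt0.
have cl : continuous (dil sigma l) by exact: rV_linear_continuous.
have /cvgrPdist_lt/(_ _ rho0)/nbhs_ballP[d /= d0 Hd] := cl 0.
exists d => // x xd.
have [|T TC jT] := H (dil sigma l x).
  have := Hd x; rewrite dil0 sub0r normrN; apply.
  by rewrite -ball_normE /= sub0r normrN.
have li : 0 < l^-1 by rewrite invr_gt0.
exists (l^-1 * T).
  rewrite ler_pdivrMl// /l -mulrA mulVf ?mulr1 ?gt_eqF//.
  by rewrite (le_trans TC)// lerDl.
by have := joined_dil G li jT; rewrite dil0 dilM mulVf ?dil1// gt_eqF.
Qed.

Lemma joined_exists2 x y : exists T, joined x y T.
Proof.
have [T jT] := joined_exists (op (inv x) y); exists T.
by have := joined_op G x jT; rewrite (cg_x0 G) (opKV G).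
Qed.

Notation d := (cc_dist op).

(** Chow's theorem makes the set of times nonempty, so its infimum is approached; the triangle
    inequality, symmetry and invariance all rest on this. *)
Lemma cc_dist_adherent x y (e : R) : 0 < e -> exists2 T, joined x y T & T < d x y + e.
Proof.
move=> e0; rewrite (cc_distE G).
have hi : has_inf [set T | joined x y T].
  by split; [have [T jT] := joined_exists2 x y; exists T|exists 0 => T []].
by have [T jT ?] := inf_adherent e0 hi; exists T.
Qed.

Lemma cc_dist_triangle x y z : d x z <= d x y + d y z.
Proof.
apply/ler_addgt0Pr => e e0; have e2 : 0 < e / 2 by rewrite divr_gt0.
have [S jS Sd] := cc_dist_adherent x y e2.
have [T jT Td] := cc_dist_adherent y z e2.
have := cc_dist_le G (joined_trans G jS jT); lra.
Qed.

Lemma cc_dist_sym x y : d x y = d y x.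
Proof.
suff H u v : d u v <= d v u by apply/eqP; rewrite eq_le !H.
apply/ler_addgt0Pr => e e0; have [T jT Td] := cc_dist_adherent v u e0.
by have := cc_dist_le G (joined_sym G jT); lra.
Qed.

Lemma cc_dist_op z x y : d (op z x) (op z y) = d x y.
Proof.
have H u v w : d (op u v) (op u w) <= d v w.
  apply/ler_addgt0Pr => e e0; have [T jT Td] := cc_dist_adherent v w e0.
  by have := cc_dist_le G (joined_op G u jT); lra.
apply/eqP; rewrite eq_le H /=.
by rewrite -{1}(opVK G z x) -{1}(opVK G z y) H.
Qed.

Lemma cc_dist_exp_curve x (h : 'rV[R]_N1) (s : R) : 0 <= s ->
  \sum_j (h 0 j) ^+ 2 <= 1 -> d x (op x (exp_curve op sigma h s)) <= s.
Proof.
move=> s0 h1; have := joined_exp_curve G x s0 h1.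
by rewrite (exp_curve0 G) (cg_x0 G) subr0 => jx; exact: (cc_dist_le G jx).
Qed.

Lemma cc_dist_near x (eta : R) : 0 < eta -> \forall y \near x, d x y <= eta.
Proof.
move=> eta0; have [e e0 He] := joined_near0 eta0.
have c := smooth_continuous (smooth_opl G (inv x)) x.
move/cvgrPdist_lt/(_ _ e0): c; apply: filterS => y.
rewrite (cg_inv G x).2 sub0r normrN => /He[T Teta jT].
apply: le_trans Teta; apply: (cc_dist_le G).
by have := joined_op G x jT; rewrite (cg_x0 G) (opKV G).
Qed.

End chow.

(** * Invariance of Lebesgue measure under group translations *)

Section Rintegral_extra.
Context d (T : measurableType d) (R : realType) (mu : {measure set T -> \bar R}).

Lemma cvg_Rintegral (f_ : nat -> T -> R) (f g : T -> R) :
  (forall n, measurable_fun [set: T] (f_ n)) ->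
  (forall x, f_ ^~ x @ \oo --> f x) ->
  mu.-integrable setT (EFin \o g) ->
  (forall n x, `|f_ n x| <= g x) ->
  (fun n => \int[mu]_x f_ n x) @ \oo --> \int[mu]_x f x.
Proof.
move=> mf cf ig fg.
have mf' : measurable_fun [set: T] f.
  by apply: (measurable_fun_cvg mf) => x _; exact: cf.
have [|||||i1 _ H] := @dominated_convergence _ T R mu setT measurableT
  (fun n => EFin \o f_ n) (EFin \o f) (EFin \o g).
- by move=> n; exact/measurable_EFinP.
- exact/measurable_EFinP.
- apply: aeW => x _; apply: cvg_EFin; [exact: nearW|exact: cf].
- exact: ig.
- by apply: aeW => x n _; rewrite /= lee_fin.
apply: fine_cvg; rewrite /Rintegral fineK//.
exact: integrable_fin_num i1.
Qed.

Lemma bounded_integrable (f g : T -> R) : measurable_fun [set: T] f ->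
  mu.-integrable setT (EFin \o g) -> (forall x, `|f x| <= g x) ->
  mu.-integrable setT (EFin \o f).
Proof.
move=> mf ig fg; apply: (le_integrable measurableT _ _ ig).
  exact/measurable_EFinP.
by move=> x _ /=; rewrite lee_fin (le_trans (fg x))// ler_norm.
Qed.

End Rintegral_extra.

(** * Generators of the Borel sets *)

Section RN_measurable.
Variables (R : realType) (n : nat).
Notation V := 'rV[R]_n.
Notation T := (RN R n).

Lemma open_RN_measurable (A : set V) : open A -> measurable (A : set T).
Proof. by move=> oA; exact: sub_sigma_algebra. Qed.

Lemma continuous_RN_measurable (f : V -> R) : continuous f ->
  measurable_fun [set: T] (f : T -> R).
Proof.
move=> cf; apply: (measurability _ (RGenOInfty.measurableE R)).
move=> /= _ [_ [a ->]] <-; rewrite setTI; apply: open_RN_measurable.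
have -> : (`]a, +oo[%classic : set R) = [set y | a < y] by rewrite set_itvE.
by apply: (@open_comp _ _ (f : V -> R) [set y | a < y]) => [x _|]; [exact: cf|exact: open_gt].
Qed.

Lemma continuous_RN_measurable_map (f : V -> V) : continuous f ->
  measurable_fun [set: T] (f : T -> T).
Proof.
move=> cf; apply: (measurability _ (erefl : @measurable _ T = <<s @open V >>)).
move=> /= _ [A oA <-]; rewrite setTI; apply: open_RN_measurable.
by apply: open_comp => [x _|]; [exact: cf|exact: oA].
Qed.

Definition cbox (a b : V) : set T := [set x : T | forall i, a 0 i <= x 0 i <= b 0 i].

(** An open set is the union of countably many members of [G] attached to rational centres and radii
    1/(k+1), enumerated by [pickle]. The sandwich between a ball and its double accommodates closed
    boxes as well as positivity sets of bumps. *)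
Lemma open_bigcup_cubes (G : set (set T)) :
  (forall (q : V) (r : R), 0 < r -> exists2 g, G g &
     ball q r `<=` g /\ g `<=` ball q (2 * r)) ->
  forall A : set V, open A -> <<s G >> (A : set T).
Proof.
move=> HG A oA.
have /choice[g Hg] : forall p : 'rV[rat]_n * nat, exists g, G g /\
    (ball (map_mx ratr p.1 : V) (p.2.+1%:R^-1) `<=` g /\
     g `<=` ball (map_mx ratr p.1 : V) (2 * p.2.+1%:R^-1)).
  by move=> p; have [|g] := HG (map_mx ratr p.1) (p.2.+1%:R^-1); [rewrite invr_gt0|exists g].
pose h k : set T := if unpickle k is Some p then if `[< g p `<=` A >] then g p else set0 else set0.
have -> : (A : set T) = \bigcup_k h k.
  apply/seteqP; split => x; last first.
    move=> [k _]; rewrite /h; case: (unpickle k) => // p.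
    by case: asboolP => // sub gx; exact: sub.
  move=> Ax; have /nbhs_ballP[e /= e0 He] : nbhs (x : V) A by exact: open_nbhs_nbhs.
  (* The chosen set lies in the doubled ball around a centre that is itself within 1/(k+1) of x,
     whence the factor 3. *)
  have [k ke] : exists k : nat, 3 * k.+1%:R^-1 < e.
    have e3 : 0 < e / 3 by rewrite divr_gt0.
    have [k _ Hk] := near_infty_natSinv_lt (PosNum e3).
    by exists k; have := Hk k (leqnn k); rewrite /= ltr_pdivlMr// mulrC.
  have k0 : 0 < k.+1%:R^-1 :> R by rewrite invr_gt0.
  have /choice[q Hq] : forall i, exists q : rat, `|ratr q - x 0 i| < k.+1%:R^-1.
    move=> i; have [|q] := @rat_in_itvoo R (x 0 i - k.+1%:R^-1) (x 0 i + k.+1%:R^-1).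
      by rewrite ltrBlDr -addrA ltrDl addr_gt0.
    by rewrite in_itv /= => qi; exists q; rewrite ltr_distl.
  pose qv : 'rV[rat]_n := \row_i q i.
  have qx : ball (map_mx ratr qv : V) (k.+1%:R^-1) x.
    by rewrite /ball/=; split=> // i j; rewrite ord1 !mxE; exact: Hq.
  exists (pickle (qv, k)) => //; rewrite /h pickleK ifT; last first.
    apply/asboolP => y /(Hg (qv, k)).2.2 /= qy; apply: He.
    apply: (@le_ball _ _ x (2 * k.+1%:R^-1 + k.+1%:R^-1)).
      by move: k0 ke; move: (k.+1%:R^-1) => z z0 ze; lra.
    rewrite addrC; apply: ball_triangle qy; exact: ball_sym.
  exact: (Hg (qv, k)).2.1.
have sG : sigma_algebra setT (<<s G >>) by exact: smallest_sigma_algebra.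
case: sG => s0 _ sU; apply: sU => k; rewrite /h.
case: (unpickle k) => [p|//]; case: asboolP => // _.
by apply: sub_sigma_algebra; exact: (Hg p).1.
Qed.

Lemma RN_measurableE (G : set (set T)) : G `<=` measurable ->
  (forall (q : V) (r : R), 0 < r -> exists2 g, G g &
     ball q r `<=` g /\ g `<=` ball q (2 * r)) ->
  @measurable _ T = <<s G >>.
Proof.
move=> Gm HG; apply/seteqP; split.
  apply: smallest_sub; first exact: smallest_sigma_algebra.
  exact: open_bigcup_cubes.
by apply: smallest_sub => //; exact: sigma_algebra_measurable.
Qed.

End RN_measurable.

Section invariance.
Context d (T : measurableType d) (R : realType) (mu : {measure set T -> \bar R}).
Variables (f : T -> T).
Hypothesis mf : measurable_fun [set: T] f.

Lemma preimage_invariant_of_generator (G : set (set T)) (g : nat -> set T) :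
  measurable = <<s G >> -> setI_closed G -> (forall i, G (g i)) ->
  \bigcup_k (g k) = setT -> (forall A, G A -> mu (f @^-1` A) = mu A) ->
  (forall k, (mu (g k) < +oo)%E) ->
  forall A, measurable A -> mu (f @^-1` A) = mu A.
Proof.
move=> mG GI Gg gT Gmu goo A mA.
pose nu0 : {measure set T -> \bar R} := pushforward mu f.
apply/esym; exact: (@measure_unique d R T G g mG GI Gg gT mu (nu0 mf)
  (fun B GB => esym (Gmu B GB)) goo A mA).
Qed.

Hypothesis inv : forall A, measurable A -> mu (f @^-1` A) = mu A.

Lemma ge0_integral_invariant (g : T -> \bar R) : measurable_fun [set: T] g ->
  (forall x, (0 <= g x)%E) -> (\int[mu]_x g (f x) = \int[mu]_x g x)%E.
Proof.
move=> mg g0.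
have := @ge0_integral_pushforward _ _ _ _ R f mf mu setT g measurableT mg (fun x _ => g0 x).
rewrite preimage_setT => <-.
by apply: eq_measure_integral => A mA _; exact: inv.
Qed.

Lemma Rintegral_invariant (g : T -> R) : measurable_fun [set: T] g ->
  \int[mu]_x g (f x) = \int[mu]_x g x.
Proof.
move=> mg; rewrite /Rintegral; congr fine.
have mg' : measurable_fun [set: T] (EFin \o g) by exact/measurable_EFinP.
rewrite [LHS]integralE [RHS]integralE; congr (_ - _)%E.
  rewrite -(@ge0_integral_invariant (funepos (EFin \o g)) (measurable_funepos mg')).
    by apply: eq_integral => x _; rewrite !funeposE.
  by move=> x; exact: funepos_ge0.
rewrite -(@ge0_integral_invariant (funeneg (EFin \o g)) (measurable_funeneg mg')).
  by apply: eq_integral => x _; rewrite !funenegE.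
by move=> x; exact: funeneg_ge0.
Qed.

End invariance.

Section box_measure.
Variables (R : realType) (n : nat).
Notation V := 'rV[R]_n.
Notation T := (RN R n).
Variable lam : {measure set T -> \bar R}.
Hypothesis lam_box : forall a b : V, (forall i, a 0 i <= b 0 i) ->
  lam (cbox a b) = (\prod_i (b 0 i - a 0 i))%:E.

(** No order between [a] and [b] is imposed: empty boxes belong to the family, which is thus closed
    under intersection. *)
Definition cboxes : set (set T) := [set A | exists a b : V, A = cbox a b].

Lemma setI_closed_cboxes : setI_closed cboxes.
Proof.
move=> _ _ [a [b ->]] [c [e ->]].
exists (\row_i Num.max (a 0 i) (c 0 i)), (\row_i Num.min (b 0 i) (e 0 i)).
apply/seteqP; split => x.
  case.
  move=> H1 H2 i; rewrite !mxE ge_max le_min.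
  by have /andP[-> ->] := H1 i; have /andP[-> ->] := H2 i.
move=> H; split=> i; have := H i; rewrite !mxE ge_max le_min;
  by case/andP => /andP[h1 h2] /andP[h3 h4]; apply/andP; split.
Qed.

Lemma cbox_measurable (a b : V) : measurable (cbox a b).
Proof.
have -> : cbox a b = \bigcap_(i in [set: 'I_n]) [set x : T | a 0 i <= (x : V) 0 i <= b 0 i].
  by apply/seteqP; split=> x H i; [move=> _|]; exact: H.
apply: fin_bigcap_measurable => //= i _.
have -> : [set x : T | a 0 i <= (x : V) 0 i <= b 0 i] =
  [set: T] `&` (fun x : T => (x : V) 0 i) @^-1` `[a 0 i, b 0 i].
  by rewrite setTI; apply/seteqP; split => x /=; rewrite in_itv.
apply: (@continuous_RN_measurable R n (fun x => x 0 i)) => //.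
exact: coord_continuous.
Qed.

Lemma RN_measurable_cboxes : @measurable _ T = <<s cboxes >>.
Proof.
apply: RN_measurableE => [_ [a [b ->]]|q r r0]; first exact: cbox_measurable.
exists (cbox (\row_i (q 0 i - r)) (\row_i (q 0 i + r))).
  by exists (\row_i (q 0 i - r)), (\row_i (q 0 i + r)).
split=> x.
  move=> [_ H] i; have := H 0 i.
  by rewrite /ball/= ltr_distlC !mxE => /andP[/ltW-> /ltW->].
move=> H; split; first by rewrite mulr_gt0.
move=> j i; rewrite ord1; have := H i; rewrite !mxE /ball/= => /andP[h1 h2].
by rewrite ltr_distlC; apply/andP; split; lra.
Qed.

Definition cube (k : R) : set T := cbox (const_mx (- k)) (const_mx k).

Lemma cube_normP (k : R) (x : V) : 0 <= k -> cube k x <-> `|x| <= k.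
Proof.
move=> k0; split=> [H|xk i]; last by
  rewrite !mxE -ler_norml; exact: le_trans (rV_coord_le_norm _ _) xk.
by apply: rV_norm_le => // i; have := H i; rewrite !mxE ler_norml.
Qed.

Lemma cube_finite (k : R) : 0 <= k -> (lam (cube k) < +oo)%E.
Proof. by move=> k0; rewrite lam_box ?ltry// => i; rewrite !mxE; lra. Qed.

Lemma cube_cover : \bigcup_k cube k.+1%:R = setT.
Proof.
rewrite -subTset => x _.
exists (Num.trunc `|x : V|) => //.
by apply/cube_normP => //; apply: ltW; rewrite truncnS_gt.
Qed.

Lemma lam_shift (v : V) (A : set T) : measurable A ->
  lam ((fun x : T => (x : V) + v : T) @^-1` A) = lam A.
Proof.
have mf : measurable_fun [set: T] (fun x : T => (x : V) + v : T).
  have cv : continuous (fun x : V => x + v).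
    move=> x; have FF : Filter (nbhs x) := nbhs_filter x.
    apply: (@continuousD R V V id (fun=> v) x).
      exact: cvg_id.
    exact: cvg_cst.
  exact: continuous_RN_measurable_map cv.
apply: (preimage_invariant_of_generator mf RN_measurable_cboxes setI_closed_cboxes
  (g := fun k => cube k.+1%:R)).
- by move=> k; exists (const_mx (- k.+1%:R)), (const_mx k.+1%:R).
- exact: cube_cover.
- move=> _ [a [b ->]].
  have -> : (fun x : T => (x : V) + v : T) @^-1` cbox a b = cbox (a - v) (b - v).
    by apply/seteqP; split => x H i; have := H i;
      rewrite !mxE lerBlDr lerBrDr.
  have [ab|] := pselect (forall i, a 0 i <= b 0 i).
    rewrite !lam_box//; last by move=> i; rewrite !mxE lerD2r.
    by congr EFin; apply: eq_bigr => i _; rewrite !mxE; ring.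
  move=> /existsNP[i /negP]; rewrite -ltNge => ba.
  have cbox0 (c e : V) : e 0 i < c 0 i -> cbox c e = set0.
    by move=> ec; rewrite -subset0 => x /(_ i) /andP[h1 /(le_trans h1)]; rewrite leNgt ec.
  by rewrite !cbox0// !mxE ltrD2r.
- by move=> k; apply: cube_finite.
Qed.

End box_measure.

Section bump.
Variables (R : realType) (n : nat).
Notation V := 'rV[R]_n.

Definition bump_fun (x : V) : R := \prod_i (flat 0 (1 + x 0 i) * flat 0 (1 - x 0 i)).

Lemma bump_fun_ge0 x : 0 <= bump_fun x.
Proof. by apply: prodr_ge0 => i _; rewrite mulr_ge0// flat_ge0. Qed.

Lemma bump_fun_le1 x : bump_fun x <= 1.
Proof.
have -> : (1 : R) = \prod_(i < n) 1 by rewrite big1_eq.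
apply: ler_prod => i _; rewrite mulr_ge0 ?flat_ge0//=.
by rewrite mulr_ile1// ?flat_ge0 ?flat0_le1.
Qed.

Lemma bump_fun_gt0 x : (0 < bump_fun x) <-> (forall i, -1 < x 0 i < 1).
Proof.
split=> [b0 i|H]; last first.
  apply: prodr_gt0 => i _; rewrite mulr_gt0// flat_gt0; have /andP[h1 h2] := H i; lra.
have : bump_fun x != 0 by rewrite gt_eqF.
move=> /prodf_neq0/(_ i isT); rewrite mulf_eq0 negb_or.
have h (y : R) : flat 0 y != 0 -> 0 < y.
  by move=> yn0; rewrite -(flat_gt0 0) lt0r yn0 flat_ge0.
by case/andP => /h h1 /h h2; apply/andP; split; lra.
Qed.

Lemma smooth_bump_fun : smooth bump_fun.
Proof.
apply: smooth_prod => i.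
have sc : smooth (fun x : V => x 0 i) by exact: (@smooth_coord R n V id i (@smooth_id R V)).
apply: smoothM; apply: (smooth_comp1 (smooth_flat 0)).
  exact: smoothD (smooth_cst _) sc.
exact: smoothB (smooth_cst _) sc.
Qed.

End bump.

Lemma Rintegral_sum d (T : measurableType d) (R : realType) (mu : {measure set T -> \bar R})
    (I : Type) (r : seq I) (f : I -> T -> R) :
  (forall i, mu.-integrable setT (EFin \o f i)) ->
  \int[mu]_x (\sum_(i <- r) f i x) = \sum_(i <- r) \int[mu]_x f i x.
Proof.
move=> If; suff [] : mu.-integrable setT (fun x => (\sum_(i <- r) f i x)%:E) /\
  \int[mu]_x (\sum_(i <- r) f i x) = \sum_(i <- r) \int[mu]_x f i x by [].
elim: r => [|i r [IH1 IH2]].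
  under eq_fun do rewrite big_nil.
  split; first exact: integrable0.
  under eq_Rintegral do rewrite big_nil.
  by rewrite big_nil /Rintegral integral0.
have E : (fun x => (\sum_(j <- i :: r) f j x)%:E) =
    (EFin \o f i) \+ (fun x => (\sum_(j <- r) f j x)%:E).
  by apply/funext => x; rewrite big_cons EFinD.
split; first by rewrite E; exact: integrableD.
under eq_Rintegral do rewrite big_cons.
rewrite big_cons -IH2; exact: RintegralD.
Qed.

Section sequences.
Variables (R : realType) (V : normedModType R).

Lemma cvg_of_natSinv (u : nat -> V) x : (forall m, `|u m - x| < m.+1%:R^-1) -> u @ \oo --> x.
Proof.
move=> ux; apply/cvgrPdist_lt => e e0; near=> m.
rewrite distrC (lt_le_trans (ux m))//; apply: ltW.
by near: m; exact: (near_infty_natSinv_lt (PosNum e0)).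
Unshelve. all: by end_near. Qed.

(** A failure of continuity can be witnessed at the scales 1/(m+1), so sequences with this rate
    suffice; this puts continuity of integrals within reach of dominated convergence. *)
Lemma seq_continuous (f : V -> R) x :
  (forall u : nat -> V, (forall m, `|u m - x| < m.+1%:R^-1) -> f (u m) @[m --> \oo] --> f x) ->
  {for x, continuous f}.
Proof.
move=> H; apply/cvgrPdist_lt => e e0; apply: contrapT => Hn.
have /choice[u Hu] : forall m, exists y, `|y - x| < m.+1%:R^-1 /\ e <= `|f x - f y|.
  move=> m; apply: contrapT => /forallNP Hm; apply: Hn.
  have m0 : 0 < m.+1%:R^-1 :> R by rewrite invr_gt0.
  apply/nbhs_ballP; exists m.+1%:R^-1 => //= y; rewrite -ball_normE /= distrC => xy.
  by rewrite ltNge; apply/negP => fy; apply: (Hm y).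
have /cvgrPdist_lt/(_ _ e0)[N _ /(_ N (leqnn N))] := H u (fun m => (Hu m).1).
by rewrite /= ltNge (Hu N).2.
Qed.

End sequences.

(** * Smooth dependence of integrals on a parameter *)

Section parametric_integral.
Variables (R : realType) (n : nat).
Notation V := 'rV[R]_n.
Notation T := (RN R n).

Lemma closed_ball0_compact (r : R) : compact [set x : V | `|x| <= r].
Proof.
apply: bounded_closed_compact.
  exists r; split; first exact: num_real.
  by move=> M rM x /= xr; rewrite (le_trans xr)// ltW.
apply: (@preimage_closed _ _ _ [set y : R | y <= r]); last exact: closed_le.
by move=> x _; exact: norm_continuous.
Qed.

Lemma continuous_bounded_ball (f : V * V -> R) (r s : R) : continuous f ->
  exists2 B : R, 0 <= B & forall z x, `|z| <= s -> `|x| <= r -> `|f (z, x)| <= B.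
Proof.
move=> cf.
have cK : compact ([set z : V | `|z| <= s] `*` [set x : V | `|x| <= r]).
  by apply: compact_setX; exact: closed_ball0_compact.
have /compact_bounded[M [_ HM]] : compact (f @` ([set z : V | `|z| <= s] `*` [set x : V | `|x| <= r])).
  by apply: continuous_compact cK; exact: continuous_subspaceT.
exists (`|M| + 1); first by rewrite addr_ge0.
move=> z x zs xr; apply: (HM (`|M| + 1)).
  by rewrite (le_lt_trans (ler_norm M))// ltrDl.
by exists (z, x).
Qed.

Definition csupp (f : V -> R) := exists s, forall z, s < `|z| -> f z = 0.

(** Support in the integration variable bounded locally uniformly in the parameter, a condition
    stable under derivatives in the parameter. *)
Definition loc_csupp (f : V * V -> R) :=
  forall r, exists s, forall z x, `|x| <= r -> s < `|z| -> f (z, x) = 0.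

Lemma loc_csupp_derive f v : loc_csupp f -> loc_csupp ('D_(0, v) f).
Proof.
(* The derivative at x uses parameters near x, possibly outside the ball of radius r. *)
move=> Hf r; have [s Hs] := Hf (r + 1); exists s => z x xr sz.
have -> : 'D_(0, v) f (z, x) = 'D_v (fun x => f (z, x)) x.
  apply: derive_eq_along => h; congr f.
  have -> : h *: ((0, v) : V * V) + (z, x) = (h *: 0 + z, h *: v + x) by [].
  by rewrite scaler0 add0r.
have x1 : \forall y \near x, `|y - x| <= 1.
  by apply/nbhs_ballP; exists 1 => //= y; rewrite -ball_normE /= distrC => /ltW.
rewrite -(derive_cst (0 : R) x v); apply: near_eq_derive.
apply: filterS x1 => y xy; apply: Hs => //.
have -> : y = x + (y - x) by rewrite addrCA subrr addr0.
by rewrite (le_trans (ler_normD _ _))// lerD.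
Qed.

Variable lam : {measure set T -> \bar R}.
Hypothesis lam_cube : forall k, 0 <= k -> (lam (cube k) < +oo)%E.

Lemma cube_measurable (k : R) : measurable (cube k : set T).
Proof. exact: cbox_measurable. Qed.

Lemma integrable_cube (k c : R) : 0 <= k ->
  lam.-integrable setT (EFin \o (fun x : T => c * \1_(cube k) x)).
Proof.
move=> k0.
have H : lam.-integrable setT (EFin \o (\1_(cube k) : T -> R)).
  have mk := cube_measurable k.
  apply/integrableP; split; first exact/measurable_EFinP/measurable_indic.
  rewrite (eq_integral (fun x : T => (\1_(cube k) x)%:E)); last first.
    by move=> x _ /=; rewrite ger0_norm.
  by rewrite integral_indic// setIT; exact: lam_cube.
have := integrableZl measurableT c H.
by apply: eq_integrable => // x _ /=; rewrite EFinM.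
Qed.

Lemma csupp_integrable (f : V -> R) : continuous f -> csupp f ->
  lam.-integrable [set: T] (EFin \o (f : T -> R)).
Proof.
move=> cf [s Hs].
have [B B0 HB] := @continuous_bounded_ball (fun p => f p.1) 0 (Num.max 0 s)
  (fun p => continuous_comp (@cvg_fst _ _ _ _ _) (cf _)).
have k0 : 0 <= Num.max 0 s by rewrite le_max lexx.
apply: (bounded_integrable (continuous_RN_measurable cf) (integrable_cube B k0)) => x.
have [xs|xs] := leP `|x : V| (Num.max 0 s).
  rewrite indicE mem_set ?mulr1; last by apply/cube_normP.
  by have := HB x 0 xs; rewrite normr0; exact.
rewrite Hs ?normr0 ?mulr_ge0// ?(le_lt_trans _ xs)//.
  by rewrite le_max lexx orbT.
Qed.

Variables (w : V -> R) (C : R).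
Hypothesis mw : measurable_fun [set: T] (w : T -> R).
Hypothesis wC : forall x, `|w x| <= C.

Let C0 : 0 <= C. Proof. exact: le_trans (normr_ge0 _) (wC 0). Qed.

Lemma kernel_bound f : smooth f -> loc_csupp f -> forall r, exists B k : R,
  [/\ 0 <= B, 0 <= k & forall z x, `|x| <= r -> `|w z * f (z, x)| <= B * \1_(cube k) z].
Proof.
move=> sf Hf r; have [s Hs] := Hf r.
have [B B0 HB] := continuous_bounded_ball r (Num.max 0 s) (smooth_continuous sf).
exists (C * B), (Num.max 0 s); split; [by rewrite mulr_ge0|by rewrite le_max lexx|].
move=> z x xr; rewrite normrM.
have [zs|zs] := leP `|z| (Num.max 0 s).
  rewrite indicE mem_set ?mulr1; last by apply/cube_normP => //; rewrite le_max lexx.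
  by rewrite ler_pM// HB.
rewrite Hs ?normr0 ?mulr0 ?mulr_ge0// ?(le_lt_trans _ zs)//.
by rewrite le_max lexx orbT.
Qed.

Lemma kernel_measurable (f : V * V -> R) x : smooth f ->
  measurable_fun [set: T] (fun z : T => w z * f (z : V, x)).
Proof.
move=> sf; apply: measurable_funM => //.
apply: (@continuous_RN_measurable R n (fun z => f (z, x))).
exact: smooth_continuous (@smooth_comp_pair R n n V V f id (fun=> x) sf (@smooth_id R V) (smooth_cst x)).
Qed.

Lemma kernel_integrable f x : smooth f -> loc_csupp f ->
  lam.-integrable [set: T] (EFin \o (fun z : T => w z * f (z : V, x))).
Proof.
move=> sf Hf; have [B [k [B0 k0 HB]]] := kernel_bound sf Hf `|x|.
apply: (bounded_integrable _ (integrable_cube B k0)).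
  exact: kernel_measurable.
by move=> z; exact: HB.
Qed.

Notation I f := (fun x : V => \int[lam]_(z in [set: T]) (w z * f (z : V, x))).

(** Differentiation under the integral along x + h v with |h| < 1; the derivatives are dominated by
    the kernel bound on the ball of radius |x| + |v|. *)
Lemma is_derive_kernel f v x : smooth f -> loc_csupp f ->
  is_derive x v (I f) (I ('D_(0, v) f) x).
Proof.
move=> sf Hf.
have sD : smooth ('D_(0, v) f) by exact: smooth_D.
have HD := loc_csupp_derive v Hf.
have [B [k [B0 k0 HB]]] := kernel_bound sD HD (`|x| + `|v|).
have dh z (s : R) : is_derive s 1 (fun s : R => w z * f (z, x + s *: v))
    (w z * 'D_(0, v) f (z, x + s *: v)).
  have E (t : R) : (z, x + t *: v) = (z, x) + t *: ((0, v) : V * V).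
    have -> : (z, x) + t *: ((0, v) : V * V) = (z + t *: 0, x + t *: v) by [].
    by rewrite scaler0 addr0.
  under eq_fun do rewrite E; rewrite E; apply: is_deriveZ.
  by apply: derivable_line; exact: smooth_derivable.
have J0 : `]-1, 1[%classic (0 : R) by rewrite /= in_itv/=; lra.
pose F (h : R) (z : T) := w z * f (z : V, x + h *: v).
have F1 : forall h, `]-1, 1[%classic h -> lam.-integrable setT (EFin \o F h).
  by move=> h _; exact: kernel_integrable.
have F2 : forall h z, `]-1, 1[%classic h -> setT z -> derivable (F ^~ z) h 1.
  by move=> h z _ _; have [] := dh z h.
have F3 : forall z : T, 0 <= B * \1_(cube k) z by move=> z; rewrite mulr_ge0.
have F4 := integrable_cube B k0.
have F5 : forall h z, `]-1, 1[%classic h -> setT z -> `|partial1of2 F h z| <= B * \1_(cube k) z.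
  move=> h z; rewrite /= in_itv/= => /andP[h1 h2] _.
  rewrite partial1of2E (@derive_val _ _ _ _ _ _ _ (dh z h)); apply: HB.
  rewrite (le_trans (ler_normD _ _))// lerD// normrZ ler_piMl//.
  by rewrite ler_norml; apply/andP; split; exact: ltW.
have dI := derivable_under_integral measurableT J0 F1 F2 F3 F4 F5.
have dI' := @derivable_of_line R V R (I f) x v dI.
apply: DeriveDef => //.
rewrite -(@derive_val _ _ _ _ _ _ _ (derivable_line0 dI')).
rewrite -derive1E (differentiation_under_integral measurableT J0 F1 F2 F3 F4 F5).
apply: eq_Rintegral => z _.
by rewrite partial1of2E (@derive_val _ _ _ _ _ _ _ (dh z 0)) scale0r addr0.
Qed.

(** Differentiating replaces [f] by a derivative in its second variable, so such integrals form a
    stable class. The weight [w] carries no regularity: the parameter occurs only in the smooth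
    kernel. *)
Lemma smooth_kernel f : smooth f -> loc_csupp f -> smooth (I f).
Proof.
move=> sf Hf.
pose P (h : V -> R) := exists f, [/\ smooth f, loc_csupp f & h = I f].
apply: (smooth_coind P); last by exists f.
move=> _ [{sf Hf}f [sf Hf ->]]; split.
- move=> x; apply: seq_continuous => u ux.
  have [B [k [B0 k0 HB]]] := kernel_bound sf Hf (`|x| + 1).
  apply: (cvg_Rintegral _ _ (integrable_cube B k0)).
  + by move=> m; exact: kernel_measurable.
  + move=> z; have ch : continuous (fun y => w z * f (z : V, y)).
      apply: smooth_continuous; apply: smoothZ.
      exact: (@smooth_comp_pair R n n V V f (fun=> z : V) id sf (smooth_cst (z : V)) (@smooth_id R V)).
    exact: cvg_comp (cvg_of_natSinv ux) (ch x).
  + move=> m z; apply: HB; rewrite -(subrK x (u m)) (le_trans (ler_normD _ _))//.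
    rewrite addrC lerD2l (le_trans (ltW (ux m)))// invf_le1// ler1n//.
- by move=> v x; have [] := is_derive_kernel v x sf Hf.
- move=> v; exists ('D_(0, v) f); split; [exact: smooth_D|exact: loc_csupp_derive|].
  by apply/funext => x; have [_ ->] := is_derive_kernel v x sf Hf.
Qed.

End parametric_integral.

(** * Right invariance of Lebesgue measure *)

Section haar.
Variables (R : realType) (N1 M : nat).
Notation N := (N1 + M)%N.
Notation pt := 'rV[R]_N.
Notation T := (RN R N).
Variables (op : pt -> pt -> pt) (inv : pt -> pt) (sigma : 'I_N -> nat).
Hypothesis G : carnot_group op inv sigma.
Variable lam : {measure set T -> \bar R}.
Hypothesis lam_box : forall a b : pt, (forall i, a 0 i <= b 0 i) ->
  lam (cbox a b) = (\prod_i (b 0 i - a 0 i))%:E.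

Let lam_cube (k : R) : 0 <= k -> (lam (cube k) < +oo)%E.
Proof. exact: cube_finite. Qed.

(** If z x stays bounded and x stays in a ball, then z = (z x) x^(-1) lies in the image of a compact
    set under a continuous map. *)
Lemma csupp_comp_op (f : pt -> R) : csupp f -> loc_csupp (fun p => f (op p.1 p.2)).
Proof.
move=> [s Hs] r.
have so : smooth (fun p : pt * pt => op p.1 (inv p.2)).
  exact: (smooth_op G (@smooth_fst R pt pt) (smooth_inv G (@smooth_snd R pt pt))).
have /choice[B HB] : forall i, exists B : R, forall y x, `|y| <= Num.max 0 s -> `|x| <= r ->
    `|op y (inv x) 0 i| <= B.
  move=> i; have sc := smooth_continuous (smooth_coord i so).
  by have [B _ HB] := continuous_bounded_ball r (Num.max 0 s) sc; exists B => y x ys xr; apply: (HB y x).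
exists (\sum_i `|B i|) => z x xr zB.
apply: Hs; rewrite ltNge; apply/negP => zx; move: zB; rewrite ltNge => /negP; apply.
apply: rV_norm_le => [|i]; first by apply: sumr_ge0.
have zx' : `|op z x| <= Num.max 0 s by rewrite le_max zx orbT.
rewrite -(op_xK G x z) (le_trans (HB i _ _ zx' xr))// (bigD1 i)//= -[leLHS]addr0.
by rewrite lerD ?ler_norm ?sumr_ge0.
Qed.

Lemma csupp_derive (f : pt -> R) v : csupp f -> csupp ('D_v f).
Proof.
move=> [s Hs]; exists s => z sz; rewrite -(derive_cst (0 : R) z v); apply: near_eq_derive.
have o : open [set y : pt | s < `|y|].
  by apply: (@open_comp _ _ (fun y : pt => `|y|) [set y | s < y]) => [y _|];
    [exact: norm_continuous|exact: open_gt].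
by apply: filterS (open_nbhs_nbhs (conj o sz)) => y; exact: Hs.
Qed.

(** The function x |-> int f(z + x) dz is constant by invariance under vector translations; its
    derivative at 0 is the integral in question. *)
Lemma Rintegral_derive0 (f : pt -> R) v : smooth f -> csupp f ->
  \int[lam]_(z in [set: T]) 'D_v f (z : pt) = 0.
Proof.
move=> sf cf.
pose k (p : pt * pt) := f (p.1 + p.2).
have sk : smooth k.
  apply: (smooth_comp_rV sf); apply: smooth_of_coord => j; under eq_fun do rewrite mxE.
  exact: (smoothD (smooth_coord j (@smooth_fst R pt pt)) (smooth_coord j (@smooth_snd R pt pt))).
have ck : loc_csupp k.
  move: cf => [s Hs] r; exists (s + r) => z x xr zs; apply: Hs.
  rewrite -(ltrD2r r) (lt_le_trans zs)// -{1}(addrK x z) (le_trans (ler_normB _ _))//.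
  by rewrite lerD2l.
have mcst : measurable_fun [set: T] (fun=> 1 : R) by exact: measurable_cst.
have := is_derive_kernel lam_cube mcst (C := 1) (fun _ => _) v 0 sk ck.
have kE : (fun x : pt => \int[lam]_(z in [set: T]) (1 * k (z : pt, x))) =
    fun=> \int[lam]_(z in [set: T]) f (z : pt).
  apply/funext => x; under eq_Rintegral do rewrite mul1r.
  have cx : continuous (fun z : pt => z + x).
    move=> y; have F0 : Filter (nbhs y) := nbhs_filter y.
    apply: (@continuousD R pt pt id (fun=> x) y).
      exact: cvg_id.
    exact: cvg_cst.
  apply: (@Rintegral_invariant _ T R lam (fun z : T => (z : pt) + x : T)
    (continuous_RN_measurable_map cx) _ f).
    by move=> A mA; exact: (lam_shift lam_box x mA).
  exact: continuous_RN_measurable (smooth_continuous sf).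
rewrite kE => H; have [|_] := H; first by move=> _; rewrite normr1.
rewrite derive_cst => ->; apply: eq_Rintegral => z _; rewrite mul1r; apply/esym.
apply: derive_eq_along => h; rewrite /k; congr f.
have -> : h *: ((0, v) : pt * pt) + (z : pt, 0) = (h *: 0 + (z : pt), h *: v + 0) by [].
by rewrite scaler0 add0r addr0 addrC.
Qed.

Lemma csupp_mull (a f : pt -> R) : csupp f -> csupp (fun z => a z * f z).
Proof. by move=> [s Hs]; exists s => z /Hs ->; rewrite mulr0. Qed.

(** Zero divergence lets the components of the field be moved inside the partial derivatives, so X f
    is a sum of coordinate derivatives of compactly supported functions. *)
Lemma Rintegral_left_field0 (f : pt -> R) v : smooth f -> csupp f ->
  \int[lam]_(z in [set: T]) 'D_(left_field op v z) f (z : pt) = 0.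
Proof.
move=> sf cf.
have sL i : smooth (fun z => left_field op v z 0 i).
  exact: smooth_coord (smooth_left_field G _).
have E (z : pt) : 'D_(left_field op v z) f z =
    \sum_i 'D_(delta_mx 0 i) (fun z => left_field op v z 0 i * f z) z.
  rewrite derive_sumv; last 2 first.
  - by move=> u y; exact: smooth_derivable.
  - by move=> u; exact: smooth_continuous (smooth_D u sf).
  apply: eq_bigr => i _.
  have dL := derivableP (smooth_derivable (sL i) (delta_mx 0 i) z).
  have df := derivableP (smooth_derivable sf (delta_mx 0 i) z).
  have [_ ->] := is_deriveM dL df.
  have -> : 'D_(delta_mx 0 i) (fun z => left_field op v z 0 i) z = 0.
    have -> : (fun z => left_field op v z 0 i) =
        (fun z => \sum_k v 0 k * left_field op (delta_mx 0 k) z 0 i).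
      apply/funext => y; rewrite (left_field_sum G) summxE.
      by apply: eq_bigr => k _; rewrite mxE.
    rewrite (derive_sumM (a := fun k _ => v 0 k)
      (b := fun k z => left_field op (delta_mx 0 k) z 0 i)).
    - apply: big1 => k _; rewrite (left_field_derive0 G) mulr0 add0r.
      by rewrite derive_cst mulr0.
    - by move=> k; exact: derivable_cst.
    - by move=> k; apply: smooth_derivable; exact: smooth_coord (smooth_left_field G _).
  by rewrite scaler0 addr0.
under eq_Rintegral do rewrite E.
rewrite Rintegral_sum.
  apply: big1 => i _; apply: (Rintegral_derive0 _ (smoothM (sL i) sf)).
  exact: csupp_mull.
move=> i; apply: csupp_integrable => //.
  exact: smooth_continuous (smooth_D _ (smoothM (sL i) sf)).
by apply: csupp_derive; exact: csupp_mull.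
Qed.

Lemma smooth_translate_kernel (f : pt -> R) : smooth f ->
  smooth (fun p : pt * pt => f (op p.1 p.2)).
Proof.
move=> sf; apply: (smooth_comp_rV sf).
exact: (smooth_op G (@smooth_fst R pt pt) (@smooth_snd R pt pt)).
Qed.

Lemma csupp_opr (f : pt -> R) x : csupp f -> csupp (fun z => f (op z x)).
Proof.
move=> cf; have [s Hs] := csupp_comp_op cf `|x|.
by exists s => z sz; apply: (Hs z x).
Qed.

(** The derivative of I(x) = int f(z x) dz at the identity is the integral of a left-invariant field
    applied to f, which is 0. At any other point, absorbing a right translation into f reduces to
    the identity; hence I is constant. *)
Lemma Rintegral_opr_smooth (f : pt -> R) x : smooth f -> csupp f ->
  \int[lam]_(z in [set: T]) f (op z x) = \int[lam]_(z in [set: T]) f (z : pt).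
Proof.
move=> sf0 cf0.
pose I f x := \int[lam]_(z in [set: T]) (1 * f (op (z : pt) x)).
have mcst : measurable_fun [set: T] (fun=> 1 : R) by exact: measurable_cst.
have n1 (y : pt) : `|1 : R| <= 1 by rewrite normr1.
have sI g : smooth g -> csupp g -> smooth (I g).
  move=> sg cg.
  exact: (smooth_kernel lam_cube mcst n1 (smooth_translate_kernel sg) (csupp_comp_op cg)).
have D0 g v : smooth g -> csupp g -> 'D_v (I g) 0 = 0.
  move=> sg cg.
  have [_ ->] := is_derive_kernel lam_cube mcst n1 v 0 (smooth_translate_kernel sg) (csupp_comp_op cg).
  rewrite -[RHS](Rintegral_left_field0 v sg cg); apply: eq_Rintegral => z _.
  rewrite mul1r -(derive_pair2 (fun z x => g (op z x)) (z : pt) 0 v).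
  have dz : is_derive (0 : pt) v (op z) (left_field op v z).
    by apply: DeriveDef => //; apply: smooth_derivable; exact: (smooth_opl G).
  by have [_ ->] := is_derive_comp_smoothR sg dz; rewrite (cg_x0 G).
have D g x0 v : smooth g -> csupp g -> 'D_v (I g) x0 = 0.
  move=> sg cg; pose gx z := g (op z x0).
  have sgx : smooth gx := smooth_comp_rV sg (smooth_opr G x0).
  have cgx : csupp gx := csupp_opr x0 cg.
  have -> : I g = fun y => I gx (op y (inv x0)).
    apply/funext => y; apply: eq_Rintegral => z _.
    by rewrite /gx -(cg_assoc G) (op_xVK G).
  have dy : is_derive x0 v (fun y => op y (inv x0)) ('D_v (op^~ (inv x0)) x0).
    by apply: DeriveDef => //; apply: smooth_derivable; exact: (smooth_opr G).
  have [_ ->] := is_derive_comp_smoothR (sI _ sgx cgx) dy.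
  by rewrite (cg_inv G _).1 D0.
have [th _] := @line_MVT R pt (I f) 0 x (fun y => smooth_derivable (sI _ sf0 cf0) x y).
rewrite D// add0r => /eqP; rewrite subr_eq0 => /eqP.
rewrite /I; under eq_Rintegral do rewrite mul1r.
move=> ->; apply: eq_Rintegral => z _.
by rewrite mul1r (cg_x0 G).
Qed.

(** Right translates of boxes are not boxes, so another generating family is used: products of bumps
    make it closed under intersection, and right translation preserves smoothness and compact
    support. *)
Definition bump_sets : set (set T) := [set A | exists f : pt -> R,
  [/\ smooth f, csupp f, forall z, 0 <= f z <= 1 & A = [set z : T | 0 < f (z : pt)]]].

Notation pos f := ([set z : T | (0 < f (z : pt))%R]).

(** 1 - (1 - f)^m converges to the indicator of f > 0 under a common domination, so the measure of
    this set is determined by integrals of smooth compactly supported functions. *)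
Lemma measure_bump_set (f : pt -> R) : smooth f -> csupp f -> (forall z, 0 <= f z <= 1) ->
  (lam (pos f) < +oo)%E /\
  (fun m => \int[lam]_(z in [set: T]) (1 - (1 - f (z : pt)) ^+ m)) @ \oo -->
  fine (lam (pos f)).
Proof.
move=> sf [s Hs] f01.
have k0 : 0 <= Num.max 0 s by rewrite le_max lexx.
have mA : measurable ((pos f)).
  apply: open_RN_measurable; apply: (@open_comp _ _ f [set y | 0 < y]) => [y _|].
    exact: smooth_continuous.
  exact: open_gt.
have sub : (pos f) `<=` cube (Num.max 0 s).
  move=> z /= fz; apply/cube_normP => //; rewrite leNgt; apply/negP => zs.
  by move: fz; rewrite Hs ?ltxx// (le_lt_trans _ zs)// le_max lexx orbT.
split.
  apply: (le_lt_trans _ (lam_cube k0)); apply: le_measure => //; rewrite inE//.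
  exact: cube_measurable.
have -> : fine (lam (pos f)) =
    \int[lam]_(z in [set: T]) \1_((pos f)) z.
  by rewrite /Rintegral integral_indic// setIT.
apply: (cvg_Rintegral _ _ (integrable_cube lam_cube 1 k0)).
- move=> m; apply: (@continuous_RN_measurable R N (fun z => 1 - (1 - f z) ^+ m)).
  by apply: smooth_continuous; apply: smoothB (smooth_cst _) _; apply: smoothX;
     exact: smoothB (smooth_cst _) _.
- move=> z; rewrite indicE; have /andP[f0 f1] := f01 z.
  have [fz|fz] := ltP 0 (f z).
    rewrite mem_set//= -[X in _ --> X]subr0.
    have n1 : `|1 - f z| < 1 by rewrite ger0_norm; lra.
    have c1 : (fun _ : nat => 1 : R) @ \oo --> (1 : R) by exact: cvg_cst.
    exact: cvgB c1 (cvg_expr n1).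
  have -> : f z = 0 by apply/eqP; rewrite eq_le fz f0.
  rewrite memNset/= ?subr0; last by rewrite ltNge fz.
  by under eq_fun do rewrite expr1n subrr; exact: cvg_cst.
- move=> m z; have /andP[f0 f1] := f01 z.
  rewrite mul1r indicE; have [fz|fz] := ltP 0 (f z).
    rewrite mem_set; last exact: sub.
    have : 0 <= (1 - f z) ^+ m <= 1 by rewrite exprn_ge0 ?exprn_ile1//; lra.
    by rewrite /= mulr1n => /andP[e0 e1]; rewrite ger0_norm; lra.
  have -> : f z = 0 by apply/eqP; rewrite eq_le fz f0.
  by rewrite subr0 expr1n subrr normr0.
Qed.

Lemma lam_opr x (A : set T) : measurable A ->
  lam ((fun z : T => op z x : T) @^-1` A) = lam A.
Proof.
have mf : measurable_fun [set: T] (fun z : T => op z x : T).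
  exact: continuous_RN_measurable_map (smooth_continuous (smooth_opr G x)).
pose bq (q : pt) (r : R) z := bump_fun (r^-1 *: (z - q)).
have sbq q r : smooth (bq q r).
  apply: smooth_comp_rV (@smooth_bump_fun R N) _; apply: smooth_of_coord => j.
  under eq_fun do rewrite !mxE.
  apply: smoothZ; apply: smoothB (smooth_cst _); exact: smooth_coord (@smooth_id R pt).
have bqP q r z : 0 < r -> 0 < bq q r z <-> forall i, `|z 0 i - q 0 i| < r.
  move=> r0; rewrite /bq; split=> [/bump_fun_gt0 H i|H].
    have := H i; rewrite !mxE -ltr_norml normrM gtr0_norm ?invr_gt0//.
    by rewrite ltr_pdivrMl// mulr1.
  apply/bump_fun_gt0 => i; rewrite !mxE -ltr_norml normrM gtr0_norm ?invr_gt0//.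
  by rewrite ltr_pdivrMl// mulr1.
have bqG q r : 0 < r -> bump_sets [set z : T | 0 < bq q r (z : pt)].
  move=> r0; exists (bq q r); split => //; last by move=> z; rewrite bump_fun_ge0 bump_fun_le1.
  exists (`|q| + r) => z zr; apply/eqP; rewrite eq_le bump_fun_ge0 andbT leNgt; apply/negP.
  move=> /(bqP _ _ _ r0) H; move: zr; rewrite ltNge => /negP; apply.
  rewrite -[z](subrK q) addrC (le_trans (ler_normD _ _))// lerD2l.
  by apply: rV_norm_le => [|i]; [exact: ltW|rewrite !mxE; exact: ltW].
have mG : @measurable _ T = <<s bump_sets >>.
  apply: RN_measurableE => [_ [f [sf _ _ ->]]|q r r0].
    apply: open_RN_measurable; apply: (@open_comp _ _ f [set y | 0 < y]) => [y _|].
      exact: smooth_continuous.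
    exact: open_gt.
  exists [set z : T | 0 < bq q r (z : pt)]; first exact: bqG.
  split=> [z [_ H]|z /(bqP _ _ _ r0) H].
    by apply/(bqP _ _ _ r0) => i; rewrite distrC; exact: H.
  split; first by rewrite mulr_gt0.
  move=> i j; rewrite ord1 /ball/= distrC (lt_trans (H j))//; lra.
apply: (preimage_invariant_of_generator mf mG (g := fun k => [set z : T | 0 < bq 0 k.+1%:R (z : pt)])).
- move=> _ _ [f [sf [s Hs] f01 ->]] [g [sg _ g01 ->]].
  exists (fun z => f z * g z); split; first exact: smoothM.
  + by exists s => z /Hs ->; rewrite mul0r.
  + move=> z; have /andP[f0 f1] := f01 z; have /andP[g0 g1] := g01 z.
    by rewrite mulr_ge0// mulr_ile1.
  + apply/seteqP; split=> [z [/= fz gz]|z /= fgz]; first by rewrite mulr_gt0.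
    have /andP[f0 _] := f01 z; have /andP[g0 _] := g01 z.
    have : f z * g z != 0 by rewrite gt_eqF.
    by rewrite mulf_eq0 negb_or => /andP[fn gn]; split; rewrite lt0r ?fn ?gn.
- by move=> k; exact: bqG.
- rewrite -subTset => z _; exists (Num.trunc `|z : pt|) => //=.
  apply/bqP => // i; rewrite mxE subr0.
  by rewrite (le_lt_trans (rV_coord_le_norm _ _))// truncnS_gt.
- move=> _ [f [sf cf f01 ->]].
  have sfx : smooth (fun z => f (op z x)) := smooth_comp_rV sf (smooth_opr G x).
  have [l1 c1] := measure_bump_set sf cf f01.
  have [l2 c2] := measure_bump_set sfx (csupp_opr x cf) (fun z => f01 (op z x)).
  rewrite -[LHS]fineK ?ge0_fin_numE// -[RHS]fineK ?ge0_fin_numE//; congr EFin.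
  apply: (cvg_unique _ c2 _) => //.
  have -> : (fun m => \int[lam]_(z in [set: T]) (1 - (1 - f (op z x)) ^+ m)) =
     (fun m => \int[lam]_(z in [set: T]) (1 - (1 - f (z : pt)) ^+ m)).
    apply/funext => m.
    apply: (@Rintegral_opr_smooth (fun z => 1 - (1 - f z) ^+ m)).
      by apply: smoothB (smooth_cst _) _; apply: smoothX;
        exact: smoothB (smooth_cst _) _.
    by have [s Hs] := cf; exists s => z /Hs ->; rewrite subr0 expr1n subrr.
  exact: c1.
- move=> k; have [f [sf cf f01 ->]] := bqG 0 k.+1%:R (ltr0Sn _ _).
  by have [] := measure_bump_set sf cf f01.
Qed.

End haar.

(** * Monotonicity of the exponential means *)

Section bounded_functions.
Context d (T : measurableType d) (R : realType) (mu : {measure set T -> \bar R}).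
Hypothesis mu1 : mu [set: T] = 1%E.

Definition bmeas (f : T -> R) :=
  measurable_fun [set: T] f /\ exists C : R, forall x, `|f x| <= C.

Notation Ex f := (Rintegral mu [set: T] f).

Lemma bmeas_cst c : bmeas (fun=> c).
Proof. by split; [exact: measurable_cst|exists `|c|]. Qed.

Lemma bmeasD f g : bmeas f -> bmeas g -> bmeas (fun x => f x + g x).
Proof.
move=> [mf [C Cf]] [mg [D Dg]]; split; first exact: measurable_funD.
by exists (C + D) => x; rewrite (le_trans (ler_normD _ _))// lerD.
Qed.

Lemma bmeasM f g : bmeas f -> bmeas g -> bmeas (fun x => f x * g x).
Proof.
move=> [mf [C Cf]] [mg [D Dg]]; split; first exact: measurable_funM.
by exists (C * D) => x; rewrite normrM ler_pM.
Qed.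

Lemma bmeasZ k f : bmeas f -> bmeas (fun x => k * f x).
Proof. exact: bmeasM (bmeas_cst k). Qed.

Lemma bmeasB f g : bmeas f -> bmeas g -> bmeas (fun x => f x - g x).
Proof.
move=> bf bg; have := bmeasD bf (bmeasZ (-1) bg).
by congr bmeas; apply/funext => x; rewrite mulN1r.
Qed.

Lemma bmeas_expR f : bmeas f -> bmeas (fun x => expR (f x)).
Proof.
move=> [mf [C Cf]]; split; first exact: measurableT_comp.
exists (expR C) => x; rewrite ger0_norm ?expR_ge0// ler_expR.
exact: le_trans (ler_norm _) (Cf x).
Qed.

Lemma bmeas_integrable f : bmeas f -> mu.-integrable [set: T] (EFin \o f).
Proof.
move=> [mf [C Cf]]; apply: (@bounded_integrable _ _ _ mu _ (fun=> C)) => //.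
apply/integrableP; split; first exact/measurable_EFinP/measurable_cst.
by rewrite /= integral_cst// mu1 mule1 ltry.
Qed.
Hint Resolve bmeas_integrable : core.

Lemma ExD f g : bmeas f -> bmeas g -> Ex (fun x => f x + g x) = Ex f + Ex g.
Proof. by move=> bf bg; rewrite RintegralD//; exact: bmeas_integrable. Qed.

Lemma ExB f g : bmeas f -> bmeas g -> Ex (fun x => f x - g x) = Ex f - Ex g.
Proof. by move=> bf bg; rewrite RintegralB//; exact: bmeas_integrable. Qed.

Lemma ExZ k f : bmeas f -> Ex (fun x => k * f x) = k * Ex f.
Proof. by move=> bf; rewrite RintegralZl//; exact: bmeas_integrable. Qed.

Lemma Ex_cst c : Ex (fun=> c) = c.
Proof. by rewrite Rintegral_cst// mu1 mulr1. Qed.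

Lemma le_Ex f g : bmeas f -> bmeas g -> (forall x, f x <= g x) -> Ex f <= Ex g.
Proof. by move=> bf bg fg; apply: le_Rintegral => //; exact: bmeas_integrable. Qed.

Lemma Ex_expR_gt0 f : bmeas f -> 0 < Ex (fun x => expR (f x)).
Proof.
move=> bf; have [mf [C Cf]] := bf.
apply: (@lt_le_trans _ _ (Ex (fun=> expR (- C)))); first by rewrite Ex_cst expR_gt0.
apply: le_Ex; [exact: bmeas_cst|exact: bmeas_expR|move=> x].
by rewrite ler_expR; have := Cf x; rewrite ler_norml => /andP[].
Qed.

(** With Z = int e^f and A = int e^g, the tangent inequality e^y >= 1 + y at y = ln(Z/A) + g - f is
    multiplied by e^f and integrated. *)
Lemma gibbs_variational f g : bmeas f -> bmeas g ->
  Ex (fun x => (g x - f x) * expR (f x)) <=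
  Ex (fun x => expR (f x)) *
    (ln (Ex (fun x => expR (g x))) - ln (Ex (fun x => expR (f x)))).
Proof.
move=> bf bg; have bef := bmeas_expR bf; have beg := bmeas_expR bg.
have bgf := bmeasB bg bf.
have Z0 := Ex_expR_gt0 bf; have A0 := Ex_expR_gt0 bg.
set Z := Ex (fun x => expR (f x)) in Z0 *; set A := Ex (fun x => expR (g x)) in A0 *.
have H : Ex (fun x => expR (f x) * (1 + ln (Z / A)) + (g x - f x) * expR (f x)) <=
    Ex (fun x => Z / A * expR (g x)).
  apply: le_Ex.
  - by apply: bmeasD; apply: bmeasM => //; exact: bmeas_cst.
  - exact: bmeasZ.
  move=> x; have -> : Z / A * expR (g x) = expR (f x) * expR (ln (Z / A) + (g x - f x)).
    rewrite -{1}(lnK (x := Z / A)) ?posrE ?divr_gt0// -!expRD; congr expR; ring.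
  rewrite (mulrC (_ - _)) -mulrDr ler_pM2l ?expR_gt0// -addrA.
  exact: expR_ge1Dx.
move: H; rewrite ExD; last 2 first.
- by apply: bmeasM => //; exact: bmeas_cst.
- exact: bmeasM.
rewrite ExZ// -/A divfK ?gt_eqF// (_ : Ex (fun x => _ * (1 + _)) = (1 + ln (Z / A)) * Z).
  by clearbody Z A; rewrite ln_div ?posrE//; move: (ln Z) (ln A) => lZ lA; lra.
by rewrite -ExZ//; congr (Rintegral mu setT _); apply/funext => x; rewrite mulrC.
Qed.

(** The logarithm of the a-norm of e^u; the value at a = 0 is the limit, corresponding to the
    geometric mean. *)
Definition lexp (a : R) (u : T -> R) : R :=
  if a == 0 then Ex u else ln (Ex (fun x => expR (a * u x))) / a.

Lemma ln_Ex_mono f g : bmeas f -> bmeas g -> (forall x, f x <= g x) ->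
  ln (Ex (fun x => expR (f x))) <= ln (Ex (fun x => expR (g x))).
Proof.
move=> bf bg fg; rewrite ler_ln ?posrE ?Ex_expR_gt0//.
by apply: le_Ex; [exact: bmeas_expR|exact: bmeas_expR|move=> x; rewrite ler_expR].
Qed.

Lemma lexp_mono a u v : bmeas u -> bmeas v -> (forall x, u x <= v x) ->
  lexp a u <= lexp a v.
Proof.
move=> bu bv uv; rewrite /lexp; have [a0|a0|a0] := ltgtP a 0.
- apply: ler_wnM2r; first by rewrite invr_le0 ltW.
  by apply: ln_Ex_mono (bmeasZ a bv) (bmeasZ a bu) _ => x; rewrite ler_nM2l.
- apply: ler_wpM2r; first by rewrite invr_ge0 ltW.
  by apply: ln_Ex_mono (bmeasZ a bu) (bmeasZ a bv) _ => x; rewrite ler_pM2l.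
- exact: le_Ex.
Qed.

Lemma ln_Ex_lipschitz f g c : bmeas f -> bmeas g -> (forall x, f x <= g x + c) ->
  ln (Ex (fun x => expR (f x))) <= ln (Ex (fun x => expR (g x))) + c.
Proof.
move=> bf bg fg.
have := ln_Ex_mono bf (bmeasD bg (bmeas_cst c)) fg.
under [X in _ <= ln X -> _]eq_Rintegral do rewrite expRD mulrC.
by rewrite ExZ ?lnM ?posrE ?expR_gt0 ?Ex_expR_gt0 ?expRK 1?addrC//; exact: bmeas_expR.
Qed.

Lemma ln_Ex_cst c : ln (Ex (fun=> expR c)) = c.
Proof. by rewrite Ex_cst expRK. Qed.

(** L(p) = ln int e^(p u) is C-Lipschitz with L(0) = 0; the quotient L(p)/p is then estimated by
    splitting the variation of numerator and denominator. *)
Lemma lexp_near (a b : R) u (C : R) : a != 0 -> b != 0 -> bmeas u -> (forall x, `|u x| <= C) ->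
  `|lexp b u - lexp a u| <= 2 * C * `|b - a| / `|b|.
Proof.
move=> a0 b0 bu uC; rewrite /lexp (negbTE a0) (negbTE b0).
set L := fun a => ln (Ex (fun x => expR (a * u x))).
have HL (p q : R) : L p <= L q + C * `|p - q|.
  apply: ln_Ex_lipschitz; [exact: bmeasZ|exact: bmeasZ|move=> x].
  rewrite -lerBlDl -mulrBl (le_trans (ler_norm _))// normrM mulrC.
  by rewrite ler_wpM2r.
have L0 (p : R) : `|L p| <= C * `|p|.
  have E0 : L 0 = 0.
    by rewrite /L; under eq_Rintegral do rewrite mul0r; rewrite ln_Ex_cst.
  have := HL p 0; have := HL 0 p; rewrite E0 sub0r normrN subr0 add0r.
  move: (L p) => y h1 h2.
  by rewrite ler_norml h2 andbT; lra.
rewrite -/(L b) -/(L a); clearbody L.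
have -> : L b / b - L a / a = (L b - L a) / b - L a * (b - a) / (a * b).
  by field; rewrite a0 b0.
rewrite (le_trans (ler_normB _ _))// !normrM !normfV normrM.
have h1 : `|L b - L a| <= C * `|b - a|.
  rewrite ler_norml; have := HL a b; have := HL b a; rewrite (distrC a b); lra.
have -> : 2 * C * `|b - a| / `|b| = C * `|b - a| / `|b| + C * `|a| * `|b - a| / (`|a| * `|b|).
  by field; rewrite !normr_eq0 a0 b0.
apply: lerD; first by rewrite ler_wpM2r ?invr_ge0.
by rewrite ler_wpM2r ?invr_ge0 ?mulr_ge0// ler_wpM2r.
Qed.

Lemma expR_le_quad (x : R) : x <= 2^-1 -> expR x <= 1 + x + 2 * x ^+ 2.
Proof.
move=> x2; rewrite -[expR x]invrK -expRN.
have h := expR_ge1Dx (- x); have p : 0 < 1 - x by lra.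
have q : (1 - x)^-1 <= 1 + x + 2 * x ^+ 2.
  rewrite -[leLHS]mul1r ler_pdivrMr//.
  have -> : (1 + x + 2 * x ^+ 2) * (1 - x) = 1 + x ^+ 2 * (1 - 2 * x) by ring.
  by rewrite lerDl mulr_ge0 ?sqr_ge0//; lra.
by apply: le_trans q; rewrite lef_pV2 ?posrE ?expR_gt0.
Qed.

Lemma bound_ge0 u (C : R) : bmeas u -> (forall x, `|u x| <= C) -> 0 <= C.
Proof.
move=> bu uC.
have h1 := le_Ex bu (bmeas_cst C) (fun x => le_trans (ler_norm _) (uC x)).
have h2 : - C <= Ex u.
  rewrite -(Ex_cst (- C)); apply: le_Ex => //; first exact: bmeas_cst.
  by move=> x; have := uC x; rewrite ler_norml => /andP[].
by rewrite Ex_cst in h1; lra.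
Qed.

(** The lower bound a int u <= ln int e^(a u) is the Gibbs inequality with f = 0; the upper bound
    combines ln E <= E - 1 with e^y <= 1 + y + 2 y^2 for y <= 1/2. *)
Lemma lexp_near0 (a : R) u (C : R) : bmeas u -> (forall x, `|u x| <= C) -> C * `|a| <= 2^-1 ->
  `|lexp a u - Ex u| <= 2 * C ^+ 2 * `|a|.
Proof.
move=> bu uC aC; have C0 := bound_ge0 bu uC.
rewrite /lexp; case: eqP => [->|/eqP a0].
  by rewrite subrr normr0 mulr0.
have bau := bmeasZ a bu; have Z0 := Ex_expR_gt0 bau.
have lo : a * Ex u <= ln (Ex (fun x => expR (a * u x))).
  have := gibbs_variational (bmeas_cst 0) bau.
  under eq_Rintegral do rewrite expR0 mulr1 subr0.
  by rewrite ln_Ex_cst expR0 Ex_cst mul1r subr0 ExZ.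
have hi : ln (Ex (fun x => expR (a * u x))) <= a * Ex u + 2 * (C * `|a|) ^+ 2.
  apply: (@le_trans _ _ (Ex (fun x => expR (a * u x)) - 1)).
    move: Z0; set E := Ex _ => E0; have := @le_ln1Dx R (E - 1).
    by rewrite (_ : 1 + (E - 1) = E); [apply; lra|ring].
  have bq : bmeas (fun x => a * u x + 2 * (C * `|a|) ^+ 2) by apply: bmeasD => //; exact: bmeas_cst.
  have : Ex (fun x => expR (a * u x)) <= Ex (fun x => 1 + (a * u x + 2 * (C * `|a|) ^+ 2)).
    apply: le_Ex; [exact: bmeas_expR|apply: bmeasD => //; exact: bmeas_cst|move=> x].
    have auC : `|a * u x| <= C * `|a| by rewrite normrM mulrC ler_wpM2r.
    have h : a * u x <= 2^-1 by rewrite (le_trans (ler_norm _))// (le_trans auC).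
    apply: (le_trans (expR_le_quad h)); rewrite -!addrA !lerD2l ler_wpM2l//.
    by rewrite -(real_normK (num_real (a * u x))) lerXn2r ?nnegrE// mulr_ge0.
  rewrite !ExD ?Ex_cst ?ExZ//; try exact: bmeas_cst.
  lra.
have -> : ln (Ex (fun x => expR (a * u x))) / a - Ex u = (ln (Ex (fun x => expR (a * u x))) - a * Ex u) / a.
  by field.
rewrite normrM normfV ler_pdivrMr ?normr_gt0// ger0_norm ?subr_ge0//.
have -> : 2 * C ^+ 2 * `|a| * `|a| = 2 * (C * `|a|) ^+ 2 by ring.
lra.
Qed.

End bounded_functions.

(** * Monotonicity from one-sided increments *)

Section dini.
Variable R : realType.

(** The set of t with g t <= g a + k (t - a) contains its supremum by the semicontinuity from the
    left, and a single admissible step from there would exceed it unless it is b. *)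
Lemma dini_right (g : R -> R) (a b : R) : a <= b ->
  (forall t : R, a <= t < b -> forall e : R, 0 < e -> exists2 s : R, 0 < s & t + s <= b /\ g (t + s) <= g t + e * s) ->
  (forall t : R, a < t <= b -> forall e : R, 0 < e -> exists2 de : R, 0 < de &
     forall x : R, a <= x <= t -> t - de < x -> g t <= g x + e) ->
  g b <= g a.
Proof.
move=> ab Hd Hc; apply/ler_addgt0Pr => /= e e0.
(* The slope k costs at most e over the whole interval; the [+ 1] admits a = b. *)
pose k : R := e / (b - a + 1).
have k0 : 0 < k by rewrite divr_gt0//; lra.
pose S := [set t : R | a <= t <= b /\ g t <= g a + k * (t - a)].
have Sa : S a by split; [rewrite lexx|rewrite subrr mulr0 addr0].
have Sb : ubound S b by move=> t [/andP[]].
have hS : has_sup S by split; [exists a|exists b].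
have aS : a <= sup S by exact: ub_le_sup (ex_intro _ b Sb) _ Sa.
have Ssb : sup S <= b by exact: ge_sup (ex_intro _ a Sa) Sb.
have SS : S (sup S).
  split; first by rewrite aS.
  have [E|aS'] := eqVneq (sup S) a; first by rewrite E subrr mulr0 addr0.
  have {}aS' : a < sup S by rewrite lt_neqAle eq_sym aS'.
  apply/ler_addgt0Pr => e' e'0.
  have [|de de0 H] := Hc (sup S) _ e' e'0; first by rewrite aS' Ssb.
  have [t St tS] := sup_adherent de0 hS.
  have tS' : t <= sup S by exact: ub_le_sup (ex_intro _ b Sb) _ St.
  have [/andP[ta tb] gt] := St.
  apply: (le_trans (H t _ tS)); first by rewrite ta.
  by rewrite lerD2r; apply: (le_trans gt); rewrite lerD2l ler_pM2l// lerB.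
have [E|Sb'] := eqVneq (sup S) b.
  have [_] := SS; rewrite E => h; apply: (le_trans h); rewrite lerD2l.
  rewrite /k mulrAC ler_pdivrMr; last lra.
  by rewrite ler_wpM2l ?ltW//; lra.
have {}Sb' : sup S < b by rewrite lt_neqAle Sb'.
have [|s s0 [sb gs]] := Hd (sup S) _ k k0; first by rewrite aS.
have : S (sup S + s).
  have [_ h] := SS; split; first by rewrite sb andbT; lra.
  apply: (le_trans gs); have -> : g a + k * (sup S + s - a) = g a + k * (sup S - a) + k * s by ring.
  by rewrite lerD2r.
by move=> /(ub_le_sup (ex_intro _ b Sb)); rewrite leNgt ltrDl s0.
Qed.

(** The forward version applied to t |-> - g (- t). *)
Lemma dini_left (g : R -> R) (a b : R) : a <= b ->
  (forall t : R, a < t <= b -> forall e : R, 0 < e -> exists2 s : R, 0 < s & a <= t - s /\ g t <= g (t - s) + e * s) ->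
  (forall t : R, a <= t < b -> forall e : R, 0 < e -> exists2 de : R, 0 < de &
     forall x : R, t <= x <= b -> x < t + de -> g x <= g t + e) ->
  g b <= g a.
Proof.
move=> ab Hd Hc; suff : - g (- - a) <= - g (- - b) by rewrite !opprK lerN2.
apply: (@dini_right (fun t : R => - g (- t)) (- b) (- a)); first by rewrite lerN2.
- move=> t /andP[bt ta] e e0.
  have [|s s0 [h1 h2]] := Hd (- t) _ e e0; first by apply/andP; split; lra.
  by exists s => //; rewrite opprD; split; lra.
- move=> t /andP[bt ta] e e0.
  have [|de de0 h] := Hc (- t) _ e e0; first by apply/andP; split; lra.
  exists de => // x /andP[bx xt] dx.
  have := h (- x); lra.
Qed.

End dini.

(** * Monotonicity along an abstract Hamilton-Jacobi flow *)

Section hypercontractivity.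
Context d (T : measurableType d) (R : realType) (mu : {measure set T -> \bar R}).
Hypothesis mu1 : mu [set: T] = 1%E.
Notation Ex f := (Rintegral mu [set: T] f).
Notation bmeas := (@bmeas d T R).
Notation lexp := (@lexp d T R mu).

(** One-sided form of dominated convergence: only asymptotic lower bounds on [u_ n] are given, so it
    is truncated from above by [g], and the truncations converge to [g]. *)
Lemma cvg_Ex_min (u_ : nat -> T -> R) (g : T -> R) : (forall n, bmeas (u_ n)) -> bmeas g ->
  (forall n x, 0 <= u_ n x) -> (forall x, 0 <= g x) ->
  (forall x (e : R), 0 < e -> \forall n \near \oo, g x - e <= u_ n x) ->
  forall w, bmeas w -> (forall x, 0 <= w x) -> forall e : R, 0 < e ->
  exists n, Ex (fun x => g x * w x) - e <= Ex (fun x => u_ n x * w x).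
Proof.
move=> bu bg u0 g0 Hu w bw w0 e e0.
have bm n : bmeas (fun x => Num.min (u_ n x) (g x)).
  have [mu_ [C Cu]] := bu n; have [mg [D Dg]] := bg; split; first exact: measurable_minr.
  exists (C + D) => x; rewrite /Num.min; case: ifP => _.
    by rewrite (le_trans (Cu x))// lerDl (le_trans _ (Dg x)).
  by rewrite (le_trans (Dg x))// lerDr (le_trans _ (Cu x)).
have cv : (fun n => Ex (fun x => Num.min (u_ n x) (g x) * w x)) @ \oo --> Ex (fun x => g x * w x).
  have bgw := bmeasM bg bw.
  apply: (cvg_Rintegral (g := fun x => g x * w x)).
  - by move=> n; have [] := bmeasM (bm n) bw.
  - move=> x; have c : (fun n => Num.min (u_ n x) (g x)) @ \oo --> g x.
      apply/cvgrPdist_le => e' e'0; apply: filterS (Hu x e' e'0) => n gu.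
      rewrite /Num.min; case: ifP => [ug|_]; last by rewrite subrr normr0 ltW.
      rewrite ger0_norm; last by rewrite subr_ge0 ltW.
      by rewrite lerBlDr addrC -lerBlDr.
    have cw : (fun _ : nat => w x) @ \oo --> w x by exact: cvg_cst.
    exact: cvgM c cw.
  - exact: bmeas_integrable.
  - move=> n x; rewrite ger0_norm; last by rewrite mulr_ge0// le_min u0 g0.
    by rewrite ler_wpM2r// ge_min lexx orbT.
have /cvgrPdist_le/(_ _ e0)[n _ /(_ n (leqnn n))/= H] := cv.
exists n; rewrite lerBlDl -lerBlDr; apply: le_trans (le_trans (ler_norm _) H).
rewrite lerD2l lerN2; apply: le_Ex => //; [exact: bmeasM|exact: bmeasM|].
by move=> x; rewrite ler_wpM2r// ge_min lexx.
Qed.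

(** [Gam t] plays the part of |grad u(t)|^2, [lsi] is the log-Sobolev inequality for e^(k u/2), and
    [u_right], [u_left] are the one-sided inequalities du/dt <= - |grad u|^2 / 2, with thresholds
    depending on the point. *)
Variables (rho : R) (u : R -> T -> R) (Gam : R -> T -> R) (C : R).
Hypothesis rho_gt0 : 0 < rho.
Hypothesis um : forall t : R, 0 <= t -> measurable_fun [set: T] (u t).
Hypothesis uC : forall (t : R) x, 0 <= t -> `|u t x| <= C.
Hypothesis bG : forall t : R, 0 <= t -> bmeas (Gam t).
Hypothesis G0 : forall (t : R) x, 0 <= Gam t x.
Hypothesis lsi : forall k t : R, 0 <= t ->
  rho * (Ex (fun x => k * u t x * expR (k * u t x)) -
    Ex (fun x => expR (k * u t x)) * ln (Ex (fun x => expR (k * u t x)))) <=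
  k ^+ 2 / 2 * Ex (fun x => Gam t x * expR (k * u t x)).
Hypothesis u_mono : forall (t s : R) x, 0 <= t -> 0 <= s -> u (t + s) x <= u t x.
Hypothesis u_right : forall (t : R) x (e : R), 0 <= t -> 0 < e ->
  exists2 de : R, 0 < de &
    forall s : R, 0 < s < de -> u (t + s) x - u t x <= s * (e - Gam t x / 2).
Hypothesis u_left : forall (t : R) x (e : R), 0 < t -> 0 < e ->
  exists2 de : R, 0 < de &
    forall s : R, 0 < s < de -> u t x - u (t - s) x <= s * (e - Gam t x / 2).

Let bu (t : R) : 0 <= t -> bmeas (u t).
Proof. by move=> t0; split; [exact: um|exists C => x; exact: uC]. Qed.


Let C0 : 0 <= C.
Proof. exact: (bound_ge0 mu1 (bu (lexx 0)) (fun x => uC x (lexx 0))). Qed.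

(** Here p, q are the old and new exponents, z = ln Z, and X, V the weighted integrals of the old
    and new functions. The tangent bound splits into the change of the function and the change of
    the exponent, the latter multiplying the entropy p X - Z z. *)
Lemma step_identity (p q z X V Z : R) : p != 0 -> q != 0 -> Z != 0 ->
  (z + (q * V - p * X) / Z) / q - z / p =
  (V - X) / Z + (q - p) * (p * X - Z * z) / (p * q * Z).
Proof. by move=> p0 q0 Z0; field; rewrite p0 q0 Z0. Qed.

(** A change of at most |p|/2 keeps |q| >= |p|/2, so p/q exceeds 1 by at most 2 rho s / |p|. *)
Lemma step_ratio (p q s Z G e : R) : 0 < p * q -> `|q - p| = rho * s -> 0 < s ->
  0 < Z -> 0 <= G -> 0 < e -> rho * s <= `|p| / 2 ->
  2 * rho * s * (G + 1) <= e * Z * `|p| -> 0 <= p * s / q /\ (p / q - 1) * G <= e * Z.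
Proof.
move=> pq qp s0 Z0 GG e0 sp sG.
have p0 : p != 0 by apply: contraTneq pq => ->; rewrite mul0r ltxx.
have q0 : q != 0 by apply: contraTneq pq => ->; rewrite mulr0 ltxx.
have P0 : 0 < `|p| by rewrite normr_gt0.
have Q0 : 0 < `|q| by rewrite normr_gt0.
have E : p / q = `|p| / `|q|.
  rewrite -normfV -normrM ger0_norm//.
  have -> : p / q = p * q / q ^+ 2 by field.
  by rewrite divr_ge0 ?sqr_ge0// ltW.
split; first by rewrite mulrAC E mulr_ge0 ?divr_ge0// ltW.
have hq : `|p| / 2 <= `|q|.
  have := ler_normB q (q - p); rewrite opprB addrC subrK qp; lra.
have pq1 : p / q - 1 <= 2 * rho * s / `|p|.
  rewrite E ler_pdivlMr//.
  have -> : (`|p| / `|q| - 1) * `|p| = (`|p| - `|q|) * (`|p| / `|q|) by field; rewrite gt_eqF.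
  have h1 : `|p| - `|q| <= rho * s by rewrite -qp distrC lerB_dist.
  have h2 : `|p| / `|q| <= 2 by rewrite ler_pdivrMr//; lra.
  have h3 : 0 <= `|p| / `|q| by rewrite divr_ge0.
  apply: (@le_trans _ _ (rho * s * (`|p| / `|q|))); first by rewrite ler_wpM2r.
  by rewrite (_ : 2 * rho * s = rho * s * 2); [rewrite ler_pM2l// mulr_gt0|ring].
apply: (@le_trans _ _ (2 * rho * s / `|p| * (G + 1))).
  apply: (@le_trans _ _ (2 * rho * s / `|p| * G)); first by rewrite ler_wpM2r.
  by rewrite ler_wpM2l ?lerDl// divr_ge0// mulr_ge0 ?mulr_ge0// ltW.
by rewrite mulrAC ler_pdivrMr.
Qed.

(** The decrease of the flow contributes about - s G / (2 Z) and the log-Sobolev inequality at most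
    s (p/q) G / (2 Z); these cancel up to p/q - 1 and the error e. *)
Lemma step_bound (p q z X Z G s e D : R) : 0 < p * q -> 0 < Z ->
  rho * (p * X - Z * z) <= p ^+ 2 / 2 * G -> `|q - p| = rho * s -> 0 < s ->
  0 <= G -> 0 < e -> rho * s <= `|p| / 2 -> 2 * rho * s * (G + 1) <= e * Z * `|p| ->
  s * (G / 2 - e * Z / 2) <= D ->
  - D / Z + rho * s * (p * X - Z * z) / (p * q * Z) <= e * s.
Proof.
move=> pq Z0 hl qp s0 GG e0 sp sG hD.
have [_ hr] := step_ratio pq qp s0 Z0 GG e0 sp sG.
have p0 : p != 0 by apply: contraTneq pq => ->; rewrite mul0r ltxx.
have q0 : q != 0 by apply: contraTneq pq => ->; rewrite mulr0 ltxx.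
have pqZ : 0 < p * q * Z by rewrite mulr_gt0.
apply: (@le_trans _ _ (- (s * (G / 2 - e * Z / 2)) / Z + s * (p / q) * G / (2 * Z))).
  apply: lerD; first by rewrite ler_pM2r ?invr_gt0// lerN2.
  have -> : s * (p / q) * G / (2 * Z) = s * (p ^+ 2 / 2 * G) / (p * q * Z).
    by field; rewrite p0 q0 gt_eqF.
  by rewrite ler_pM2r ?invr_gt0// [rho * s]mulrC -[s * rho * _]mulrA ler_pM2l.
have -> : - (s * (G / 2 - e * Z / 2)) / Z + s * (p / q) * G / (2 * Z) =
    s * ((p / q - 1) * G / (2 * Z) + e / 2).
  by field; rewrite q0 gt_eqF.
rewrite [e * s]mulrC ler_pM2l//.
suff : (p / q - 1) * G / (2 * Z) <= e / 2 by lra.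
by rewrite ler_pdivrMr ?mulr_gt0//; lra.
Qed.

(** [k s] is the decrease of the flow over a step s. Its quotients are bounded below only beyond
    thresholds depending on x, so the integrated bound is obtained in the limit along the steps s0 /
    (n + 1). *)
Lemma small_step (k : R -> T -> R) (t p b e : R) : 0 <= t -> p != 0 -> 0 < b -> 0 < e ->
  (forall s : R, 0 < s < b -> bmeas (k s)) ->
  (forall (s : R) x, 0 < s < b -> 0 <= k s x) ->
  (forall x (e : R), 0 < e -> exists2 de : R, 0 < de & forall s : R, 0 < s < de ->
     Gam t x / 2 - e <= k s x / s) ->
  let w x := expR (p * u t x) in
  let Z := Ex w in let G := Ex (fun x => Gam t x * w x) in
  exists s : R, [/\ 0 < s < b, rho * s <= `|p| / 2,
    2 * rho * s * (G + 1) <= e * Z * `|p| &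
    s * (G / 2 - e * Z / 2) <= Ex (fun x => k s x * w x)].
Proof.
move=> t0 p0 b0 e0 bk k0 kG w Z G.
have bw : bmeas w by apply: bmeas_expR; apply: bmeasZ; exact: bu.
have Z0 : 0 < Z by apply: (Ex_expR_gt0 mu1); apply: bmeasZ; exact: bu.
have GG : 0 <= G by apply: Rintegral_ge0 => x _; rewrite mulr_ge0// expR_ge0.
have P0 : 0 < `|p| by rewrite normr_gt0.
(* The entries secure, in order, an admissible step, a change of exponent of at most |p|/2, and the
   third required inequality. *)
pose s0 := Num.min (b / 2) (Num.min (`|p| / (2 * rho)) (e * Z * `|p| / (2 * rho * (G + 1)))).
have G1 : 0 < G + 1 by lra.
have s00 : 0 < s0.
  by rewrite !lt_min !divr_gt0//= ?mulr_gt0 ?divr_gt0 ?mulr_gt0.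
have s0b : s0 < b by rewrite /s0 gt_min; apply/orP; left; lra.
pose s (n : nat) : R := s0 / n.+1%:R.
have sn0 n : 0 < s n by rewrite divr_gt0.
have sn1 n : s n <= s0 by rewrite ler_pdivrMr// ler_peMr ?ler1n// ltW.
have snb n : 0 < s n < b by rewrite sn0 (le_lt_trans (sn1 n)).
have [||||||||n Hn] := @cvg_Ex_min (fun n x => k (s n) x / s n) (fun x => Gam t x / 2) _ _ _ _ _ w _ _ (e * Z / 2).
- move=> n; apply: (bmeasM (bk _ (snb n))); exact: bmeas_cst.
- by apply: bmeasM; [exact: bG|exact: bmeas_cst].
- by move=> n x; rewrite divr_ge0 ?k0// ltW.
- by move=> x; rewrite divr_ge0.
- move=> x e' e'0; have [de de0 H] := kG x e' e'0.
  have ds : 0 < de / s0 by rewrite divr_gt0.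
  near=> n; apply: H; rewrite sn0 /= /s mulrC -ltr_pdivlMr//.
  by near: n; exact: (near_infty_natSinv_lt (PosNum ds)).
- exact: bw.
- by move=> x; exact: expR_ge0.
- by rewrite divr_gt0 ?mulr_gt0.
exists (s n); split=> //.
- have : s n <= `|p| / (2 * rho) by rewrite (le_trans (sn1 n))// /s0 !ge_min lexx !orbT.
  by rewrite !ler_pdivlMr ?mulr_gt0//; lra.
- have : s n <= e * Z * `|p| / (2 * rho * (G + 1)).
    by rewrite (le_trans (sn1 n))// /s0 !ge_min lexx !orbT.
  by rewrite ler_pdivlMr ?mulr_gt0//; lra.
- have bkw := bmeasM (bk _ (snb n)) bw.
  rewrite -ler_pdivlMl ?sn0//.
  have -> : (s n)^-1 * Ex (fun x => k (s n) x * w x) = Ex (fun x => k (s n) x / s n * w x).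
    rewrite -ExZ//; congr (Rintegral mu setT _); apply/funext => x.
    by rewrite mulrA (mulrC _ (k _ _)).
  apply: le_trans Hn; rewrite lerD2r.
  have bGw := bmeasM (bG t0) bw.
  rewrite [_ / 2]mulrC -ExZ//; apply: le_Ex => //; first exact: bmeasZ.
    by apply: bmeasM => //; apply: bmeasM; [exact: bG|exact: bmeas_cst].
  by move=> x; rewrite mulrA (mulrC 2^-1).
Unshelve. all: by end_near. Qed.

(* Both one-sided estimates at once: [sg = 1] looks forward from [t] and is used
   where the exponent is negative, [sg = -1] looks backward and is used where it
   is positive.  In either case [u t], whose gradient enters, is the weight. *)
Lemma lexp_step (sg a t b e : R) : `|sg| = 1 -> 0 <= t -> sg * (a + rho * t) < 0 ->
  0 < b -> 0 < e ->
  (forall s, 0 < s < b -> 0 <= t + sg * s) ->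
  (forall s x, 0 < s < b -> 0 <= sg * (u t x - u (t + sg * s) x)) ->
  (forall x (e : R), 0 < e -> exists2 de : R, 0 < de & forall s : R, 0 < s < de ->
     sg * (u (t + sg * s) x - u t x) <= s * (e - Gam t x / 2)) ->
  exists2 s : R, 0 < s < b &
    sg * (lexp (a + rho * (t + sg * s)) (u (t + sg * s)) - lexp (a + rho * t) (u t)) <= e * s.
Proof.
move=> sg1 t0; set p := a + rho * t => sp b0 e0 ts kge kdini.
have sg2 : sg * sg = 1 by rewrite -expr2 -real_normK ?num_real// sg1 expr1n.
have sg0 : sg != 0 by rewrite -normr_eq0 sg1 oner_eq0.
have sgV : sg^-1 = sg by apply: (mulfI sg0); rewrite divff// sg2.
have p0 : p != 0 by apply: contraTneq sp => ->; rewrite mulr0 ltxx.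
have [|||s [sb h1 h2 h3]] :=
  @small_step (fun s x => sg * (u t x - u (t + sg * s) x)) t p b e t0 p0 b0 e0.
- by move=> s sb; apply: bmeasZ; apply: bmeasB; apply: bu => //; exact: ts.
- by move=> s x; exact: kge.
- move=> x e' e'0; have [de de0 H] := kdini x e' e'0; exists de => // s sde.
  have /andP[s0 _] := sde; rewrite ler_pdivlMr//; have := H s sde.
  by rewrite -opprB mulrN => h; move: (sg * _) h => y h; lra.
have /andP[s0 _] := sb.
pose q := a + rho * (t + sg * s); have qp : q - p = sg * (rho * s) by rewrite /q /p; ring.
have sq : sg * q < 0.
  have P0 : `|p| = - (sg * p) by rewrite -[LHS]mul1r -sg1 -normrM ltr0_norm.
  have -> : sg * q = sg * p + rho * s.
    by rewrite -[q](subrK p) qp mulrDr mulrA sg2 mul1r addrC.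
  by rewrite P0 in h1; lra.
have q0 : q != 0 by apply: contraTneq sq => ->; rewrite mulr0 ltxx.
have pq : 0 < p * q.
  by rewrite -[p * q]mul1r -sg2 mulrACA nmulr_rgt0.
exists s => //; rewrite -/p -/q /lexp (negbTE p0) (negbTE q0).
have bt' := bu (ts s sb); have bt := bu t0.
have bp : bmeas (fun x => p * u t x) by exact: bmeasZ.
have bq : bmeas (fun x => q * u (t + sg * s) x) by exact: bmeasZ.
have Z0 := Ex_expR_gt0 mu1 bp.
have gv := gibbs_variational mu1 bp bq.
have hl := lsi p t0.
have bw := bmeas_expR bp.
have GG : 0 <= Ex (fun x => Gam t x * expR (p * u t x)).
  by apply: Rintegral_ge0 => x _; rewrite mulr_ge0// expR_ge0.
move: h1 h2 h3 hl GG gv Z0.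
set w := fun x => expR (p * u t x).
have buw := bmeasM bt bw; have bu'w := bmeasM bt' bw.
set Z := Ex w; set G := Ex (fun x => Gam t x * w x).
have -> : Ex (fun x => p * u t x * w x) = p * Ex (fun x => u t x * w x).
  by rewrite -ExZ//; congr (Rintegral mu setT _); apply/funext => x; rewrite mulrA.
have -> : Ex (fun x => (q * u (t + sg * s) x - p * u t x) * w x) =
    q * Ex (fun x => u (t + sg * s) x * w x) - p * Ex (fun x => u t x * w x).
  rewrite -!ExZ// -ExB//; try exact: bmeasZ.
  by congr (Rintegral mu setT _); apply/funext => x; rewrite mulrBl !mulrA.
have -> : Ex (fun x => sg * (u t x - u (t + sg * s) x) * w x) =
    sg * (Ex (fun x => u t x * w x) - Ex (fun x => u (t + sg * s) x * w x)).
  rewrite -ExB// -ExZ//; last exact: bmeasB.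
  by congr (Rintegral mu setT _); apply/funext => x; rewrite -mulrBl mulrA.
move: (Ex (fun x => u t x * w x)) (Ex (fun x => u (t + sg * s) x * w x)) => X V.
move: (ln (Ex (fun x => expR (q * u (t + sg * s) x)))) (ln Z) => A z.
clearbody Z G => h1 h2 h3 hl GG gv Z0.
have nqp : `|q - p| = rho * s by rewrite qp normrM sg1 mul1r gtr0_norm// mulr_gt0.
have H := step_bound pq Z0 hl nqp s0 GG e0 h1 h2 h3.
(* The Gibbs inequality bounds the new logarithm from below; since [sg * q] < 0, dividing turns this
   into the upper bound required. This is where direction and sign of the exponent must match. *)
have gz : z + (q * V - p * X) / Z <= A by rewrite -lerBrDl ler_pdivrMr// [leRHS]mulrC.
apply: (le_trans _ H); apply: (@le_trans _ _ (sg * ((z + (q * V - p * X) / Z) / q - z / p))).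
  rewrite !mulrBr lerD2r.
  have E y : sg * (y / q) = y / (sg * q).
    by rewrite invfM sgV mulrCA.
  by rewrite !E ler_nM2r ?invr_lt0.
rewrite step_identity ?(gt_eqF Z0)// qp mulrDr.
have -> : sg * ((V - X) / Z) = - (sg * (X - V)) / Z by rewrite -mulrN opprB mulrA.
by rewrite lerD2l -!mulrA [sg * (sg * _)]mulrA sg2 mul1r.
Qed.

Lemma lexp_right_step (a t t1 e : R) : 0 <= t -> t < t1 -> a + rho * t1 <= 0 -> 0 < e ->
  exists2 s : R, 0 < s & t + s <= t1 /\
    lexp (a + rho * (t + s)) (u (t + s)) <= lexp (a + rho * t) (u t) + e * s.
Proof.
move=> t0 tt1 at1 e0.
have [|||||s /andP[s0 sb]] := @lexp_step 1 a t (t1 - t) e (normr1 _) t0 _ _ e0.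
- by rewrite mul1r (lt_le_trans _ at1)// ltrD2l ltr_pM2l.
- by rewrite subr_gt0.
- by move=> s /andP[s0 _]; rewrite mul1r addr_ge0// ltW.
- by move=> s x /andP[s0 _]; rewrite !mul1r subr_ge0 u_mono// ltW.
- move=> x e' e'0; have [de de0 H] := u_right x t0 e'0; exists de => // s.
  by rewrite !mul1r; exact: H.
rewrite !mul1r lerBlDl => H; exists s => //; split => //.
by rewrite addrC -lerBrDr ltW.
Qed.

Lemma lexp_left_step (a t b e : R) : 0 < t -> 0 < a + rho * t -> 0 < e -> 0 < b <= t ->
  exists2 s : R, 0 < s & s <= b /\
    lexp (a + rho * t) (u t) <= lexp (a + rho * (t - s)) (u (t - s)) + e * s.
Proof.
move=> t0 at0 e0 /andP[b0 bt].
have st s : s < b -> 0 <= t - s by move=> sb; rewrite subr_ge0 ltW// (lt_le_trans sb).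
have [||||s /andP[s0 sb]] := @lexp_step (-1) a t b e (normrN1 _) (ltW t0) _ b0 e0.
- by rewrite mulN1r oppr_lt0.
- by move=> s /andP[_ sb]; rewrite mulN1r st.
- move=> s x /andP[s0 sb]; rewrite !mulN1r opprB subr_ge0.
  by rewrite -{1}(subrK s t) u_mono ?st// ltW.
- move=> x e' e'0; have [de de0 H] := u_left x t0 e'0; exists de => // s.
  by rewrite !mulN1r opprB; exact: H.
rewrite !mulN1r opprB lerBlDl => H; exists s => //; split => //; exact: ltW.
Qed.

Lemma lexp_mono_negative (a t0 t1 : R) : 0 <= t0 -> t0 <= t1 -> a + rho * t1 < 0 ->
  lexp (a + rho * t1) (u t1) <= lexp (a + rho * t0) (u t0).
Proof.
move=> t00 t01 at1.
apply: (@dini_right R (fun t => lexp (a + rho * t) (u t)) t0 t1 t01).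
  move=> t /andP[tt0 tt1] e e0.
  by apply: lexp_right_step => //; [exact: le_trans tt0|exact: ltW].
move=> t /andP[tt0 tt1] e e0.
have lt0 : a + rho * t < 0 by apply: le_lt_trans at1; rewrite lerD2l ler_pM2l.
(* Keeps the error 2 C rho (t - x) / |a + rho t| from the change of exponent below e; the [+ 1]
   covers C = 0. *)
pose de := e * `|a + rho * t| / (2 * C * rho + 1).
have K0 : 0 < 2 * C * rho + 1 by rewrite ltr_wpDl// !mulr_ge0// ltW.
exists de; first by rewrite !divr_gt0 ?mulr_gt0// normr_gt0 lt_eqF.
move=> x /andP[x0 xt] dx.
have x0' : 0 <= x by exact: le_trans x0.
have t0' : 0 <= t by exact: le_trans xt.
(* Monotonicity of the flow replaces [u t] by [u x], so that afterwards only the exponent varies. *)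
apply: (@le_trans _ _ (lexp (a + rho * t) (u x))).
  apply: lexp_mono => //; [exact: bu|exact: bu|move=> y].
  by rewrite -{1}(subrK x t) addrC u_mono// subr_ge0.
have xl0 : a + rho * x < 0 by apply: le_lt_trans lt0; rewrite lerD2l ler_pM2l.
have := @lexp_near d T R mu mu1 (a + rho * x) (a + rho * t) (u x) C.
rewrite !lt_eqF// => /(_ isT isT (bu x0') (fun y => uC y x0')) H.
have -> : lexp (a + rho * t) (u x) =
  lexp (a + rho * x) (u x) + (lexp (a + rho * t) (u x) - lexp (a + rho * x) (u x)) by ring.
rewrite lerD2l (le_trans (ler_norm _))// (le_trans H)//.
rewrite ler_pdivrMr ?normr_gt0 ?lt_eqF//.
have -> : a + rho * t - (a + rho * x) = rho * (t - x) by ring.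
rewrite ger0_norm; last by rewrite mulr_ge0 ?subr_ge0// ltW.
have hd : t - x <= de by lra.
rewrite /de ler_pdivlMr// in hd; apply: le_trans hd.
have tx : 0 <= t - x by lra.
have -> : (t - x) * (2 * C * rho + 1) = 2 * C * (rho * (t - x)) + (t - x) by ring.
by rewrite lerDl.
Qed.

Lemma lexp_mono_positive (a t0 t1 : R) : 0 <= t0 -> t0 <= t1 -> 0 < a + rho * t0 ->
  lexp (a + rho * t1) (u t1) <= lexp (a + rho * t0) (u t0).
Proof.
move=> t00 t01 at0.
apply: (@dini_left R (fun t => lexp (a + rho * t) (u t)) t0 t1 t01).
  move=> t /andP[tt0 tt1] e e0.
  have [||||s s0 [sb H]] := @lexp_left_step a t (t - t0) e.
  - exact: le_lt_trans tt0.
  - by apply: lt_trans at0 _; rewrite ltrD2l ltr_pM2l.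
  - exact: e0.
  - by rewrite subr_gt0 tt0 lerBlDr lerDl.
  by exists s => //; split => //; lra.
move=> t /andP[tt0 tt1] e e0.
have lt0 : 0 < a + rho * t by apply: lt_le_trans at0 _; rewrite lerD2l ler_pM2l.
pose de := e * `|a + rho * t| / (2 * C * rho + 1).
have K0 : 0 < 2 * C * rho + 1 by rewrite ltr_wpDl// !mulr_ge0// ltW.
exists de; first by rewrite !divr_gt0 ?mulr_gt0// normr_gt0 gt_eqF.
move=> x /andP[tx xt1] dx.
have t0' : 0 <= t by exact: le_trans tt0.
have x0' : 0 <= x by exact: le_trans tx.
apply: (@le_trans _ _ (lexp (a + rho * x) (u t))).
  apply: lexp_mono => //; [exact: bu|exact: bu|move=> y].
  by rewrite -{1}(subrK t x) addrC u_mono// subr_ge0.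
have xl0 : 0 < a + rho * x by apply: lt_le_trans lt0 _; rewrite lerD2l ler_pM2l.
have := @lexp_near d T R mu mu1 (a + rho * x) (a + rho * t) (u t) C.
rewrite !gt_eqF// => /(_ isT isT (bu t0') (fun y => uC y t0')) H.
have -> : lexp (a + rho * x) (u t) =
  lexp (a + rho * t) (u t) - (lexp (a + rho * t) (u t) - lexp (a + rho * x) (u t)) by ring.
rewrite lerD2l -normrN in H *; rewrite (le_trans (ler_norm _))// (le_trans H)//.
rewrite ler_pdivrMr ?normr_gt0 ?gt_eqF//.
have -> : a + rho * t - (a + rho * x) = - (rho * (x - t)) by ring.
have xt : 0 <= x - t by lra.
rewrite normrN ger0_norm; last by rewrite mulr_ge0// ltW.
have hd : x - t <= de by lra.
rewrite /de ler_pdivlMr// in hd; apply: le_trans hd.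
have -> : (x - t) * (2 * C * rho + 1) = 2 * C * (rho * (x - t)) + (x - t) by ring.
by rewrite lerDl.
Qed.

(** Uniform in t: of the two quotients in [de], one makes 2 C^2 rho de at most e, the other makes C
    rho de at most 1/2, the range of [lexp_near0]. *)
Lemma lexp_cross0 (b e : R) : 0 < b -> 0 < e -> exists2 de : R, 0 < de <= b &
  forall t k : R, 0 <= t -> `|k| = rho * de -> `|lexp k (u t) - Ex (u t)| <= e.
Proof.
move=> b0 e0.
have K0 : 0 < 2 * C ^+ 2 * rho + 1 by rewrite ltr_wpDl// !mulr_ge0 ?sqr_ge0// ltW.
have K1 : 0 < 2 * (C * rho) + 1 by rewrite ltr_wpDl// !mulr_ge0// ltW.
pose de := Num.min b (Num.min (e / (2 * C ^+ 2 * rho + 1)) (2 * (C * rho) + 1)^-1).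
have d0 : 0 < de by rewrite !lt_min b0 divr_gt0// invr_gt0.
have d1 : de <= e / (2 * C ^+ 2 * rho + 1) by rewrite !ge_min lexx !orbT.
have d2 : de <= (2 * (C * rho) + 1)^-1 by rewrite !ge_min lexx !orbT.
rewrite ler_pdivlMr// in d1; rewrite -[leRHS]mul1r ler_pdivlMr// in d2.
exists de; first by rewrite d0 ge_min lexx.
move=> t k t0 kd.
have H := @lexp_near0 d T R mu mu1 k (u t) C (bu t0) (fun x => uC x t0).
rewrite kd in H; apply: (le_trans (H _)).
  have -> : 2^-1 = 1 / 2 :> R by rewrite mul1r.
  rewrite ler_pdivlMr//; apply: le_trans d2.
  have -> : de * (2 * (C * rho) + 1) = C * (rho * de) * 2 + de by ring.
  by rewrite lerDl ltW.
apply: le_trans d1.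
have -> : de * (2 * C ^+ 2 * rho + 1) = 2 * C ^+ 2 * (rho * de) + de by ring.
by rewrite lerDl ltW.
Qed.

(** The exponent vanishes at t0' = - a / rho. On each side of it one stops at distance de, replaces
    the flow there by [u t0'] through monotonicity in time, and lets the remaining exponent, of size
    rho de, tend to 0; both sides meet at int u(t0'). *)
Theorem lexp_hypercontractive (a t : R) : 0 <= t ->
  lexp (a + rho * t) (u t) <= lexp a (u 0).
Proof.
move=> t0.
have E0 : lexp a (u 0) = lexp (a + rho * 0) (u 0) by rewrite mulr0 addr0.
have [a0|a0] := ltP 0 a.
  by rewrite E0; apply: lexp_mono_positive => //; rewrite mulr0 addr0.
have [at0|at0] := ltP (a + rho * t) 0.
  by rewrite E0; exact: lexp_mono_negative.
pose t0' := - a / rho.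
have at0' : a + rho * t0' = 0 by rewrite /t0' mulrCA divff ?gt_eqF// mulr1 subrr.
have t00 : 0 <= t0' by rewrite divr_ge0 ?oppr_ge0// ltW.
have t0t : t0' <= t by rewrite ler_pdivrMr// mulrC; lra.
apply: (@le_trans _ _ (Ex (u t0'))).
  have [E|tn] := eqVneq t t0'.
    by rewrite E at0' /lexp eqxx.
  have tt : 0 < t - t0' by rewrite subr_gt0 lt_neqAle eq_sym tn.
  apply/ler_addgt0Pr => /= e e0.
  have [de /andP[d0 db] H] := lexp_cross0 tt e0.
  apply: (@le_trans _ _ (lexp (a + rho * (t0' + de)) (u (t0' + de)))).
    apply: lexp_mono_positive; [lra|lra|].
    by rewrite mulrDr addrA at0' add0r mulr_gt0.
  rewrite mulrDr addrA at0' add0r.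
  apply: (@le_trans _ _ (lexp (rho * de) (u t0'))).
    apply: lexp_mono => //; [by apply: bu; lra|exact: bu|].
    by move=> x; apply: u_mono => //; exact: ltW.
  have := H t0' (rho * de) t00; rewrite gtr0_norm ?mulr_gt0// => /(_ erefl).
  by rewrite ler_norml => /andP[_]; rewrite lerBlDl.
have [E|an] := eqVneq a 0.
  have -> : t0' = 0 by rewrite /t0' E oppr0 mul0r.
  by rewrite /lexp E eqxx.
have tt : 0 < t0' by rewrite divr_gt0// oppr_gt0 lt_neqAle an.
apply/ler_addgt0Pr => /= e e0.
have [de /andP[d0 db] H] := lexp_cross0 tt e0.
have := H t0' (- (rho * de)) t00; rewrite normrN gtr0_norm ?mulr_gt0// => /(_ erefl).
rewrite ler_norml => /andP[h _].
have h1 : lexp (- (rho * de)) (u t0') <= lexp (a + rho * (t0' - de)) (u (t0' - de)).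
  have -> : a + rho * (t0' - de) = - (rho * de) by rewrite mulrBr addrA at0' add0r.
  apply: lexp_mono => //; [exact: bu|by apply: bu; lra|].
  by move=> x; rewrite -{1}(subrK de t0') u_mono//; lra.
have h2 : lexp (a + rho * (t0' - de)) (u (t0' - de)) <= lexp a (u 0).
  rewrite E0; apply: lexp_mono_negative => //; first lra.
  by rewrite mulrBr addrA at0' add0r oppr_lt0 mulr_gt0.
move: h h1 h2; move: (lexp _ _) (lexp _ _) (lexp _ _) (Ex _) => c1 c2 c3 c4; lra.
Qed.

End hypercontractivity.

(** * The Hopf-Lax semigroup and its mollification *)

Section hopf_lax.
Variables (R : realType) (N1 M : nat).
Notation N := (N1 + M)%N.
Notation pt := 'rV[R]_N.
Variables (op : pt -> pt -> pt) (inv : pt -> pt) (sigma : 'I_N -> nat).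
Hypothesis G : carnot_group op inv sigma.
Hypothesis horm : hormander op.
Notation d := (cc_dist op).
Variables (f : pt -> R) (C : R).
Hypothesis fC : forall x, `|f x| <= C.
Notation Q t := (hopf_lax op t f).

Let f_le x : f x <= C. Proof. by have := fC x; rewrite ler_norml => /andP[]. Qed.
Let f_ge x : - C <= f x. Proof. by have := fC x; rewrite ler_norml => /andP[]. Qed.

Lemma hopf_lax_le (t : R) x y : 0 < t -> Q t x <= d x y ^+ 2 / (2 * t) + f y.
Proof.
move=> t0; rewrite /hopf_lax gt_eqF//; apply: ge_inf; last by exists y.
exists (- C) => _ [z _ <-]; rewrite -[leLHS]add0r lerD//.
by rewrite divr_ge0 ?sqr_ge0// mulr_ge0// ltW.
Qed.

Lemma hopf_lax_ge (t : R) x c : 0 < t -> (forall y, c <= d x y ^+ 2 / (2 * t) + f y) ->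
  c <= Q t x.
Proof.
move=> t0 H; rewrite /hopf_lax gt_eqF//; apply: lb_le_inf.
  by exists (d x x ^+ 2 / (2 * t) + f x); exists x.
by move=> _ [z _ <-].
Qed.

Lemma cc_dist_refl x : d x x = 0.
Proof.
have h0 : \sum_j ((0 : 'rV[R]_N1) 0 j) ^+ 2 <= 1.
  by rewrite big1 ?ler01// => j _; rewrite mxE expr0n.
have := @cc_dist_exp_curve _ _ _ _ _ _ G x 0 0 (lexx 0) h0.
rewrite (exp_curve0 G) (cg_x0 G) => h; apply/eqP; rewrite eq_le h.
exact: (cc_dist_ge0 G).
Qed.

Lemma hopf_lax_le_id (t : R) x : 0 <= t -> Q t x <= f x.
Proof.
rewrite le_eqVlt => /orP[/eqP <-|t0]; first by rewrite /hopf_lax eqxx.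
by apply: (le_trans (hopf_lax_le x x t0)); rewrite cc_dist_refl expr0n mul0r add0r.
Qed.

Lemma hopf_lax_bound (t : R) x : 0 <= t -> `|Q t x| <= C.
Proof.
move=> t0; rewrite ler_norml (le_trans (hopf_lax_le_id x t0) (f_le x)) andbT.
move: t0; rewrite le_eqVlt => /orP[/eqP <-|t0]; first by rewrite /hopf_lax eqxx.
apply: hopf_lax_ge => // y; rewrite -[leLHS]add0r lerD//.
by rewrite divr_ge0 ?sqr_ge0// mulr_ge0// ltW.
Qed.

(** Joint convexity of length^2 / time: the difference of the two sides is (t a - s b)^2 / (2 s t (t
    + s)). *)
Lemma sqr_div_convex (a b s t : R) : 0 < s -> 0 < t ->
  (a + b) ^+ 2 / (2 * (t + s)) <= a ^+ 2 / (2 * s) + b ^+ 2 / (2 * t).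
Proof.
move=> s0 t0; rewrite -subr_ge0.
have -> : a ^+ 2 / (2 * s) + b ^+ 2 / (2 * t) - (a + b) ^+ 2 / (2 * (t + s)) =
    (t * a - s * b) ^+ 2 / (2 * s * t * (t + s)).
  by field; rewrite !gt_eqF ?addr_gt0.
by rewrite divr_ge0 ?sqr_ge0// !mulr_ge0 ?addr_ge0// ltW.
Qed.

(** A path from x through y to a competitor z is a candidate for time t + s, with cost bounded by
    the convexity inequality. *)
Lemma hopf_lax_semigroup (t s : R) x y : 0 <= t -> 0 < s ->
  Q (t + s) x <= d x y ^+ 2 / (2 * s) + Q t y.
Proof.
move=> t0 s0; move: t0; rewrite le_eqVlt => /orP[/eqP <-|t0].
  by rewrite add0r {2}/hopf_lax eqxx; exact: hopf_lax_le.
rewrite -lerBlDl; apply: hopf_lax_ge => // z; rewrite lerBlDl.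
apply: (le_trans (hopf_lax_le x z (addr_gt0 t0 s0))).
rewrite addrA lerD2r; apply: le_trans (sqr_div_convex _ _ s0 t0).
rewrite ler_pM2r ?invr_gt0 ?mulr_gt0 ?addr_gt0// lerXn2r ?nnegrE ?addr_ge0 ?(cc_dist_ge0 G)//.
exact: (cc_dist_triangle G horm).
Qed.

Lemma hopf_lax_mono (t s : R) x : 0 <= t -> 0 <= s -> Q (t + s) x <= Q t x.
Proof.
move=> t0; rewrite le_eqVlt => /orP[/eqP <-|s0]; first by rewrite addr0.
by apply: (le_trans (hopf_lax_semigroup x x t0 s0)); rewrite cc_dist_refl expr0n mul0r add0r.
Qed.

Lemma hopf_lax_lipschitz (t : R) : 0 < t -> exists2 L : R, 0 <= L &
  forall x y, d x y <= 1 -> Q t x <= Q t y + L * d x y.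
Proof.
move=> t0; have C0 : 0 <= C := le_trans (normr_ge0 _) (fC 0).
(* A competitor z farther than D from y already costs at least 2 C, the oscillation of f. Within
   that range d(x,z)^2 - d(y,z)^2 is at most (2 D + 1) d(x,y), using d(x,y) <= 1. *)
pose D := 2 * t * (2 * C + 1) + 1.
have D1 : 1 <= D by rewrite /D lerDr !mulr_ge0 ?addr_ge0 ?mulr_ge0// ltW.
exists ((2 * D + 1) / (2 * t)) => [|x y xy].
  by rewrite divr_ge0 ?addr_ge0 ?mulr_ge0 ?(le_trans ler01 D1)// ltW.
have d0 := cc_dist_ge0 G x y.
rewrite -lerBlDr; apply: hopf_lax_ge => // z; rewrite lerBlDr.
have [dz|dz] := leP (d y z) D.
  apply: (le_trans (hopf_lax_le x z t0)).
  have h : d x z ^+ 2 <= d y z ^+ 2 + (2 * D + 1) * d x y.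
    have tr := cc_dist_triangle G horm x y z.
    apply: (@le_trans _ _ ((d x y + d y z) ^+ 2)).
      by rewrite lerXn2r ?nnegrE ?addr_ge0 ?(cc_dist_ge0 G).
    have dyz := cc_dist_ge0 G y z.
    have h1 : d x y * d x y <= d x y * 1 by rewrite ler_wpM2l.
    have h2 : d x y * d y z <= d x y * D by rewrite ler_wpM2l.
    by rewrite !expr2; lra.
  have -> : d y z ^+ 2 / (2 * t) + f z + (2 * D + 1) / (2 * t) * d x y =
     (d y z ^+ 2 + (2 * D + 1) * d x y) / (2 * t) + f z by field; rewrite gt_eqF.
  by rewrite lerD2r ler_pM2r ?invr_gt0 ?mulr_gt0.
have h := hopf_lax_bound x (ltW t0); rewrite ler_norml in h; case/andP: h => _ h.
apply: (le_trans h); apply: (@le_trans _ _ (d y z ^+ 2 / (2 * t) + f z)); last first.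
  by rewrite lerDl mulr_ge0 ?divr_ge0 ?addr_ge0 ?mulr_ge0 ?(le_trans ler01 D1)// ltW.
have h1 : 2 * C <= d y z ^+ 2 / (2 * t).
  rewrite ler_pdivlMr ?mulr_gt0//; apply: (@le_trans _ _ (D * D)).
    apply: (@le_trans _ _ (D * 1)); last by rewrite ler_wpM2l// (le_trans ler01).
    by rewrite mulr1 /D; lra.
  by rewrite expr2 ler_pM ?(le_trans ler01 D1)// ltW.
have := f_ge z; lra.
Qed.

Lemma hopf_lax_continuous (t : R) : 0 < t -> continuous (Q t).
Proof.
move=> t0 x; have [L L0 HL] := hopf_lax_lipschitz t0.
have FF : Filter (nbhs x) := nbhs_filter x.
apply/cvgrPdist_le => /= e e0.
have L1 : 0 < L + 1 by lra.
have eta0 : 0 < Num.min 1 (e / (L + 1)) by rewrite lt_min ltr01 divr_gt0.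
apply: filterS (cc_dist_near G horm x eta0) => y.
rewrite le_min => /andP[xy1 xye].
have yx1 : d y x <= 1 by rewrite (cc_dist_sym G horm).
have h1 := HL _ _ xy1; have h2 := HL _ _ yx1; rewrite (cc_dist_sym G horm y x) in h2.
have h3 : L * d x y <= e.
  apply: (@le_trans _ _ ((L + 1) * d x y)).
    by rewrite ler_wpM2r ?(cc_dist_ge0 G)// lerDl.
  by rewrite -ler_pdivlMl// mulrC.
by rewrite ler_norml; apply/andP; split; lra.
Qed.

End hopf_lax.

(** * The sub-gradient along horizontal exponentials *)

Section subgradient.
Variables (R : realType) (N1 M : nat).
Notation N := (N1 + M)%N.
Notation pt := 'rV[R]_N.
Variables (op : pt -> pt -> pt) (inv : pt -> pt) (sigma : 'I_N -> nat).
Hypothesis G : carnot_group op inv sigma.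
Hypothesis horm : hormander op.

Lemma ZopE j (g : pt -> R) x : smooth g ->
  Zop op j g x = 'D_(left_field op (ej R M j) x) g x.
Proof.
move=> sg; rewrite /Zop derive1E.
have dx : is_derive (0 : R) 1 (fun s : R => op x (s *: ej R M j)) (left_field op (ej R M j) x).
  have dop : derivable (op x) 0 (ej R M j) by apply: smooth_derivable; exact: (smooth_opl G).
  by have := derivable_line0 dop; under eq_fun do rewrite add0r.
have := is_derive_comp_smoothR sg dx; rewrite scale0r (cg_x0 G) => H.
exact: derive_val.
Qed.

Lemma smooth_Zop j (g : pt -> R) : smooth g -> smooth (Zop op j g).
Proof.
move=> sg.
have -> : Zop op j g =
    fun x => \sum_i left_field op (ej R M j) x 0 i * 'D_(delta_mx 0 i) g x.
  apply/funext => x; rewrite ZopE// derive_sumv//.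
    by move=> v y; exact: smooth_derivable.
  by move=> v; exact: smooth_continuous (smooth_D v sg).
apply: smooth_sum => i; apply: smoothM (smooth_D _ sg).
exact: smooth_coord (smooth_left_field G _).
Qed.

Lemma derive_horizontal (h : 'rV[R]_N1) (g : pt -> R) x : smooth g ->
  'D_(left_field op (row_mx h 0) x) g x = \sum_j h 0 j * Zop op j g x.
Proof.
move=> sg; rewrite (left_field_horizontal G).
have dg : differentiable g x by exact: smooth_differentiable.
rewrite deriveE// linear_sum; apply: eq_bigr => j _ /=.
by rewrite linearZ /= -deriveE// ZfieldE ZopE.
Qed.

Lemma exp_curve_expansion (h : 'rV[R]_N1) (g : pt -> R) x (e : R) : smooth g -> 0 < e ->
  exists2 de : R, 0 < de & forall s : R, 0 <= s < de ->
   `|g (op x (exp_curve op sigma h s)) - g x - s * \sum_j h 0 j * Zop op j g x| <= e * s.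
Proof.
move=> sg e0.
have dc : is_derive (0 : R) 1 (fun s => g (op x (exp_curve op sigma h s))) (\sum_j h 0 j * Zop op j g x).
  have := is_derive_comp_smoothR sg (is_derive_op_exp_curve G h x 0).
  by rewrite (exp_curve0 G) (cg_x0 G) derive_horizontal.
have dd : differentiable (fun s : R => g (op x (exp_curve op sigma h s))) 0.
  by apply/derivable1_diffP; have [] := dc.
have /nbhs_ballP[de /= de0 H] := differentiable_eps dd e0.
exists de => // s /andP[s0 sde].
have := H s; rewrite -ball_normE /= sub0r normrN ger0_norm// => /(_ sde).
rewrite addr0 (exp_curve0 G) (cg_x0 G).
have -> : 'd (fun s : R => g (op x (exp_curve op sigma h s))) 0 s = s * \sum_j h 0 j * Zop op j g x.
  have E : s = s *: (1 : R) by rewrite [RHS]mulr1.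
  rewrite {1}E linearZ /= -deriveE// (@derive_val _ _ _ _ _ _ _ dc) //.
by [].
Qed.

Definition gamma2 (g : pt -> R) x := \sum_(j < N1) (Zop op j g x) ^+ 2.

Lemma gamma2_ge0 g x : 0 <= gamma2 g x.
Proof. by apply: sumr_ge0 => j _; exact: sqr_ge0. Qed.

(** The control is c grad g / |grad g|; c = 1 and c = -1 give the directions of steepest ascent and
    descent. *)
Lemma gamma2_unit (p : R) g x : 0 < p -> p ^+ 2 = gamma2 g x -> forall c : R, `|c| = 1 ->
  exists h : 'rV[R]_N1, \sum_j (h 0 j) ^+ 2 <= 1 /\ \sum_j h 0 j * Zop op j g x = c * p.
Proof.
move=> p0 pg c c1; exists (\row_j (c * Zop op j g x / p)).
have pn : p != 0 by rewrite gt_eqF.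
split; under eq_bigr do rewrite mxE.
  have -> : \sum_j (c * Zop op j g x / p) ^+ 2 = gamma2 g x / p ^+ 2.
    rewrite /gamma2 mulr_suml; apply: eq_bigr => j _.
    by rewrite !exprMn -[c ^+ 2]real_normK ?num_real// c1 expr1n mul1r exprVn.
  by rewrite -pg divff// expf_neq0.
have -> : \sum_j c * Zop op j g x / p * Zop op j g x = c / p * gamma2 g x.
  by rewrite /gamma2 mulr_sumr; apply: eq_bigr => j _; rewrite expr2; ring.
by rewrite -pg; field.
Qed.

(** If |grad g| > L, moving a short time s in the gradient direction raises g by more than L s while
    the distance travelled is at most s. *)
Lemma gamma2_le_lipschitz (L : R) (g : pt -> R) x : smooth g -> 0 <= L ->
  (forall y z, cc_dist op y z <= 1 -> g y <= g z + L * cc_dist op y z) ->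
  gamma2 g x <= L ^+ 2.
Proof.
move=> sg L0 HL; rewrite leNgt; apply/negP => Lg.
pose p := Num.sqrt (gamma2 g x).
have g0 := gamma2_ge0 g x.
have pg : p ^+ 2 = gamma2 g x by rewrite sqr_sqrtr.
have p0 : 0 < p by rewrite sqrtr_gt0 (le_lt_trans _ Lg)// sqr_ge0.
have Lp : L < p by rewrite -(@ltr_pXn2r _ 2)// ?nnegrE ?ltW// pg.
have [h [h1 h2]] := gamma2_unit p0 pg (normr1 R).
have e0 : 0 < (p - L) / 2 by lra.
have [de de0 H] := exp_curve_expansion h x sg e0.
pose s := Num.min (de / 2) 1.
have s0 : 0 < s by rewrite lt_min ltr01 andbT; lra.
have s1 : s <= 1 by rewrite ge_min lexx orbT.
have sd : s < de by rewrite gt_min; apply/orP; left; lra.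
have ds := @cc_dist_exp_curve _ _ _ _ _ _ G x h s (ltW s0) h1.
have := H s; rewrite ltW//= => /(_ sd); rewrite h2 mul1r ler_norml => /andP[h3 _].
have := HL (op x (exp_curve op sigma h s)) x.
rewrite (cc_dist_sym G horm) => /(_ (le_trans ds s1)) h4.
have h5 : L * cc_dist op x (op x (exp_curve op sigma h s)) <= L * s by rewrite ler_wpM2l.
have h6 : (p - L) / 2 * s = s * p - L * s - (p - L) * s / 2 by field.
have h7 : 0 < (p - L) * s by rewrite mulr_gt0// subr_gt0.
move: h3 h4 h5 h6 h7; move: (g _) (g x) => c1 c2; lra.
Qed.

End subgradient.

(** * Left mollification *)

Section mollifier.
Variables (R : realType) (N1 M : nat).
Notation N := (N1 + M)%N.
Notation pt := 'rV[R]_N.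
Notation T := (RN R N).
Variables (op : pt -> pt -> pt) (inv : pt -> pt) (sigma : 'I_N -> nat).
Hypothesis G : carnot_group op inv sigma.
Variable lam : {measure set T -> \bar R}.
Hypothesis lam_box : forall a b : pt, (forall i, a 0 i <= b 0 i) ->
  lam (cbox a b) = (\prod_i (b 0 i - a 0 i))%:E.

Let lam_cube (k : R) : 0 <= k -> (lam (cube k) < +oo)%E.
Proof. exact: cube_finite. Qed.

Lemma Rintegral_gt0 (g : T -> R) (c k : R) : lam.-integrable [set: T] (EFin \o g) ->
  (forall x, 0 <= g x) -> 0 < c -> 0 < k -> (forall x : pt, `|x| <= k -> c <= g x) ->
  0 < \int[lam]_(x in [set: T]) g x.
Proof.
move=> ig g0 c0 k0 gc.
have ic := integrable_cube lam_cube c (ltW k0).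
apply: (@lt_le_trans _ _ (\int[lam]_(x in [set: T]) (c * \1_(cube k) x))).
  rewrite RintegralZl//; last first.
    have := integrable_cube lam_cube 1 (ltW k0).
    by apply: eq_integrable => // x _ /=; rewrite mul1r.
  rewrite mulr_gt0// /Rintegral integral_indic//; last exact: cube_measurable.
  rewrite setIT /cube lam_box /=; last by move=> i; rewrite !mxE; lra.
  by apply: prodr_gt0 => i _; rewrite !mxE; lra.
apply: le_Rintegral => // x _; rewrite indicE.
have [xk|xk] := leP `|x : pt| k.
  by rewrite mem_set ?mulr1; [exact: gc|apply/cube_normP => //; exact: ltW].
rewrite memNset ?mulr0//= => /cube_normP; rewrite ltW// => /(_ isT).
by rewrite leNgt xk.
Qed.

(** Each coordinate contributes two factors with arguments at least 1/2, where [flat 0] is at least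
    e^(-2). The bound makes the mass of the bump positive. *)
Lemma bump_fun_lower (x : pt) : `|x| <= 2^-1 -> expR (- 4) ^+ N <= bump_fun x.
Proof.
move=> x2; rewrite /bump_fun -[X in _ ^+ X]card_ord -prodr_const.
apply: ler_prod => i _; rewrite expR_ge0 /=.
have := le_trans (rV_coord_le_norm x i) x2; rewrite ler_norml => /andP[h1 h2].
have h (y : R) : 2^-1 <= y -> expR (- 2) <= flat 0 y.
  move=> y2; have y0 : 0 < y by apply: lt_le_trans y2; rewrite invr_gt0.
  rewrite /flat y0 expr0 invr1 mul1r ler_expR lerN2 -[leRHS]invrK.
  by rewrite lef_pV2 ?posrE ?invr_gt0.
have -> : (- 4 : R) = - 2 + - 2 by ring.
rewrite expRD ler_pM ?expR_ge0//; apply: h; lra.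
Qed.

Definition scaled_bump (m : nat) (z : pt) : R := bump_fun (m.+1%:R *: z).
Definition bump_mass (m : nat) := \int[lam]_(z in [set: T]) scaled_bump m z.
Definition mollifier m z := scaled_bump m z / bump_mass m.

Lemma smooth_scaled_bump m : smooth (scaled_bump m).
Proof.
apply: smooth_comp_rV (@smooth_bump_fun R N) _; apply: smooth_of_coord => j.
under eq_fun do rewrite !mxE.
by apply: smoothZ; exact: (@smooth_coord R N pt id j (@smooth_id R pt)).
Qed.

Lemma scaled_bump_supp m z : m.+1%:R^-1 < `|z| -> scaled_bump m z = 0.
Proof.
move=> mz; apply/eqP; rewrite eq_le bump_fun_ge0 andbT leNgt; apply/negP.
move=> /bump_fun_gt0 H; move: mz; rewrite ltNge => /negP; apply.
apply: rV_norm_le => [|i]; first by rewrite invr_ge0.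
have := H i; rewrite !mxE -ltr_norml normrM ger0_norm// => /ltW.
by rewrite -ler_pdivlMl// mulr1.
Qed.

Lemma scaled_bump_csupp m : csupp (scaled_bump m).
Proof. by exists m.+1%:R^-1 => z; exact: scaled_bump_supp. Qed.

Lemma bump_mass_gt0 m : 0 < bump_mass m.
Proof.
apply: (@Rintegral_gt0 _ (expR (- 4) ^+ N) (m.+1%:R^-1 / 2)).
- apply: csupp_integrable => //; last exact: scaled_bump_csupp.
  exact: smooth_continuous (smooth_scaled_bump m).
- by move=> x; exact: bump_fun_ge0.
- by rewrite exprn_gt0// expR_gt0.
- by rewrite divr_gt0// invr_gt0.
move=> x xm; apply: bump_fun_lower; rewrite normrZ ger0_norm//.
by rewrite -ler_pdivlMl// mulrC.
Qed.

Lemma mollifier_ge0 m z : 0 <= mollifier m z.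
Proof. by rewrite divr_ge0 ?bump_fun_ge0// ltW// bump_mass_gt0. Qed.

Lemma mollifier_supp m z : m.+1%:R^-1 < `|z| -> mollifier m z = 0.
Proof. by move=> mz; rewrite /mollifier scaled_bump_supp// mul0r. Qed.

Lemma mollifier_csupp m : csupp (mollifier m).
Proof. by exists m.+1%:R^-1 => z; exact: mollifier_supp. Qed.

Lemma smooth_mollifier m : smooth (mollifier m).
Proof.
have := smoothZ (bump_mass m)^-1 (smooth_scaled_bump m).
by congr smooth; apply/funext => z; rewrite mulrC.
Qed.

Lemma integrable_mollifier m : lam.-integrable [set: T] (EFin \o (mollifier m : T -> R)).
Proof.
apply: csupp_integrable => //; last exact: mollifier_csupp.
exact: smooth_continuous (smooth_mollifier m).
Qed.

Lemma Rintegral_mollifier m : \int[lam]_(z in [set: T]) mollifier m z = 1.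
Proof.
have i := csupp_integrable lam_cube (smooth_continuous (smooth_scaled_bump m)) (scaled_bump_csupp m).
rewrite /mollifier; under eq_Rintegral do rewrite mulrC.
by rewrite RintegralZl// mulVf// gt_eqF// bump_mass_gt0.
Qed.

(** In this form x enters only through the smooth kernel, which gives smoothness; right invariance
    turns it into the average of w(z x) against the mollifier, which gives the comparison
    inequalities. *)
Definition mollify m (w : pt -> R) (x : pt) : R :=
  \int[lam]_(z in [set: T]) (w z * mollifier m (op (z : pt) (inv x))).

Notation bounded_measurable w := (@bmeas _ T R w).

Let kernel m (p : pt * pt) := mollifier m (op p.1 (inv p.2)).

Lemma smooth_mollify m w : bounded_measurable w -> smooth (mollify m w).
Proof.
move=> [mw [C wC]].
have sk : smooth (kernel m).
  apply: smooth_comp_rV (smooth_mollifier m) _.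
  exact: (smooth_op G (@smooth_fst R pt pt) (smooth_inv G (@smooth_snd R pt pt))).
have ck : loc_csupp (kernel m).
  move=> r.
  have [B B0 HB] : exists2 B : R, 0 <= B & forall x, `|x| <= r -> `|inv x| <= B.
    have [K K0 HK] := smooth_lipschitz_ball (Num.max 0 r) (cg_inv_smooth G).
    have m0 : 0 <= Num.max 0 r by rewrite le_max lexx.
    exists (K * Num.max 0 r) => [|x xr]; first by rewrite mulr_ge0.
    have xm : `|x| <= Num.max 0 r by rewrite le_max xr orbT.
    have := HK x 0 xm; rewrite normr0 (op_inv0 G) !subr0 => /(_ m0) h.
    by rewrite (le_trans h)// ler_wpM2l.
  have [s Hs] := csupp_comp_op G (mollifier_csupp m) B.
  by exists s => z x xr zs; apply: (Hs z (inv x)) => //; exact: HB.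
exact: (smooth_kernel lam_cube mw wC sk ck).
Qed.

Lemma mollifyE m w x : bounded_measurable w ->
  mollify m w x = \int[lam]_(z in [set: T]) (w (op z x) * mollifier m (z : pt)).
Proof.
move=> [mw _].
have mf : measurable_fun [set: T] (fun z : T => op z x : T).
  exact: continuous_RN_measurable_map (smooth_continuous (smooth_opr G x)).
rewrite /mollify -(Rintegral_invariant mf (fun A mA => lam_opr G lam_box x mA)).
  by apply: eq_Rintegral => z _; rewrite (op_xK G).
apply: measurable_funM => //.
apply: (@continuous_RN_measurable R N (fun z => mollifier m (op z (inv x)))).
exact: smooth_continuous (smooth_comp_rV (smooth_mollifier m) (smooth_opr G (inv x))).
Qed.

Lemma integrable_mollify m w x : bounded_measurable w ->
  lam.-integrable [set: T] (EFin \o (fun z : T => w (op z x) * mollifier m (z : pt))).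
Proof.
move=> [mw [C wC]].
have mf : measurable_fun [set: T] (fun z : T => op z x : T).
  exact: continuous_RN_measurable_map (smooth_continuous (smooth_opr G x)).
have iC : lam.-integrable [set: T] (EFin \o (fun z : T => C * mollifier m z)).
  have := integrableZl measurableT C (integrable_mollifier m).
  by apply: eq_integrable => // z _ /=; rewrite EFinM.
apply: (bounded_integrable _ iC).
  apply: measurable_funM.
    exact: (measurableT_comp mw mf).
  exact: continuous_RN_measurable (smooth_continuous (smooth_mollifier m)).
by move=> z; rewrite normrM [X in _ * X]ger0_norm ?mollifier_ge0// ler_wpM2r// mollifier_ge0.
Qed.

(** Both averages run over the same z, and the constant passes through because the mollifier has
    integral 1; inequalities invariant under left translation are thus inherited. *)
Lemma mollify_le m w1 w2 x1 x2 (c : R) : bounded_measurable w1 -> bounded_measurable w2 ->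
  (forall z, `|z| <= m.+1%:R^-1 -> w1 (op z x1) <= c + w2 (op z x2)) ->
  mollify m w1 x1 <= c + mollify m w2 x2.
Proof.
move=> b1 b2 H; rewrite !mollifyE//.
have i1 := integrable_mollify m x1 b1; have i2 := integrable_mollify m x2 b2.
have ic : lam.-integrable [set: T] (EFin \o (fun z : T => c * mollifier m z)).
  have := integrableZl measurableT c (integrable_mollifier m).
  by apply: eq_integrable => // z _ /=; rewrite EFinM.
have -> : c = \int[lam]_(z in [set: T]) (c * mollifier m z).
  by rewrite RintegralZl ?Rintegral_mollifier ?mulr1//; exact: integrable_mollifier.
rewrite -RintegralD//; apply: le_Rintegral => //.
  by have := integrableD measurableT ic i2; apply: eq_integrable.
move=> z _; rewrite -mulrDl.
have [zm|zm] := leP `|z : pt| m.+1%:R^-1.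
  by rewrite ler_wpM2r ?mollifier_ge0// H.
by rewrite mollifier_supp// !mulr0.
Qed.

Lemma mollify_cst m (c : R) x : mollify m (fun=> c) x = c.
Proof.
rewrite mollifyE; last exact: bmeas_cst.
by rewrite RintegralZl ?Rintegral_mollifier ?mulr1//; exact: integrable_mollifier.
Qed.

Lemma mollify_bound m w (C : R) x : bounded_measurable w -> (forall x, `|w x| <= C) ->
  `|mollify m w x| <= C.
Proof.
move=> bw wC; rewrite ler_norml; apply/andP; split.
  rewrite -[leLHS](mollify_cst m (- C) x) -[leRHS]add0r.
  apply: mollify_le => //; first exact: bmeas_cst.
  by move=> z _; rewrite add0r; have := wC (op z x); rewrite ler_norml => /andP[].
rewrite -[leRHS](mollify_cst m C x) -[leRHS]add0r.
apply: mollify_le => //; first exact: bmeas_cst.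
by move=> z _; rewrite add0r; have := wC (op z x); rewrite ler_norml => /andP[].
Qed.

Lemma mollify_cvg w x : bounded_measurable w -> continuous w ->
  (fun m => mollify m w x) @ \oo --> w x.
Proof.
move=> bw cw; apply/cvgrPdist_le => /= e e0.
have c0 : continuous (fun z => w (op z x)).
  move=> z; apply: (@continuous_comp _ _ _ (op^~ x) w); last exact: cw.
  exact: smooth_continuous (smooth_opr G x) z.
have FF : Filter (nbhs (0 : pt)) := nbhs_filter _.
have /cvgrPdist_le/(_ e e0)/nbhs_ballP[de /= de0 H] := c0 0.
near=> m.
have md : m.+1%:R^-1 < de by near: m; exact: (near_infty_natSinv_lt (PosNum de0)).
have Hz z : `|z| <= m.+1%:R^-1 -> `|w x - w (op z x)| <= e.
  move=> zm; have := H z; rewrite -ball_normE /= sub0r normrN (cg_0x G); apply.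
  exact: le_lt_trans md.
have h1 : mollify m w x <= e + w x.
  rewrite -(mollify_cst m (w x) x); apply: mollify_le => //; first exact: bmeas_cst.
  by move=> z /Hz; rewrite ler_norml => /andP[h _]; lra.
have h2 : w x <= e + mollify m w x.
  rewrite -{1}(mollify_cst m (w x) x); apply: mollify_le => //; first exact: bmeas_cst.
  by move=> z /Hz; rewrite ler_norml => /andP[_ h]; lra.
by rewrite ler_norml; apply/andP; split; lra.
Unshelve. all: by end_near. Qed.

End mollifier.

(** * Extension of the log-Sobolev inequality *)

Section lexp_limits.
Context d (T : measurableType d) (R : realType) (mu : {measure set T -> \bar R}).
Hypothesis mu1 : mu [set: T] = 1%E.
Notation Ex f := (Rintegral mu [set: T] f).

Lemma cvg_Ex_bounded (u_ : nat -> T -> R) w (C : R) :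
  (forall m, measurable_fun [set: T] (u_ m)) -> (forall m x, `|u_ m x| <= C) ->
  (forall x, u_ ^~ x @ \oo --> w x) -> (fun m => Ex (u_ m)) @ \oo --> Ex w.
Proof.
move=> mu_ uC uw; apply: (cvg_Rintegral (g := fun=> C)) => //.
apply: bmeas_integrable => //; exact: bmeas_cst.
Qed.

Lemma lexp_cvg (a : R) (u_ : nat -> T -> R) w (C : R) :
  (forall m, measurable_fun [set: T] (u_ m)) -> (forall m x, `|u_ m x| <= C) ->
  (forall x, u_ ^~ x @ \oo --> w x) -> bmeas w ->
  (fun m => lexp mu a (u_ m)) @ \oo --> lexp mu a w.
Proof.
move=> mu_ uC uw bw; rewrite /lexp; case: eqP => [_|_]; first exact: cvg_Ex_bounded uw.
have bu m : bmeas (u_ m) by split => //; exists C.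
have cE : (fun m => Ex (fun x => expR (a * u_ m x))) @ \oo --> Ex (fun x => expR (a * w x)).
  apply: (@cvg_Ex_bounded _ _ (expR (`|a| * C))).
  - by move=> m; have [] := bmeas_expR (bmeasZ a (bu m)).
  - move=> m x; rewrite ger0_norm ?expR_ge0// ler_expR (le_trans (ler_norm _))//.
    by rewrite normrM ler_wpM2l.
  - move=> x; have ca : (fun _ : nat => a) @ \oo --> a by exact: cvg_cst.
    exact: (continuous_cvg _ (@continuous_expR R (a * w x)) (cvgM ca (uw x))).
have p := Ex_expR_gt0 mu1 (bmeasZ a bw).
have cl := continuous_cvg _ (continuous_ln p) cE.
have ca : (fun _ : nat => a^-1) @ \oo --> a^-1 by exact: cvg_cst.
exact: cvgM (cl _) ca.
Qed.

Lemma lexp_continuous (b e : R) u (C : R) : bmeas u -> (forall x, `|u x| <= C) -> 0 < e ->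
  exists2 de : R, 0 < de & forall c, `|c - b| <= de -> `|lexp mu c u - lexp mu b u| <= e.
Proof.
move=> bu uC e0; have C0 := bound_ge0 mu1 bu uC.
have [->|b0] := eqVneq b 0.
  exists (Num.min (e / (2 * C ^+ 2 + 1)) (2 * C + 1)^-1).
    by rewrite lt_min divr_gt0 ?invr_gt0// ltr_wpDl ?mulr_ge0 ?sqr_ge0.
  move=> c; rewrite subr0 le_min => /andP[h1 h2].
  rewrite ler_pdivlMr ?ltr_wpDl ?mulr_ge0 ?sqr_ge0// in h1.
  rewrite -[leRHS]mul1r ler_pdivlMr ?ltr_wpDl ?mulr_ge0// in h2.
  have -> : lexp mu 0 u = Ex u by rewrite /lexp eqxx.
  have c0 := normr_ge0 c.
  have h3 : C * `|c| <= 2^-1.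
    by rewrite -[2^-1]mul1r ler_pdivlMr//; move: h2; rewrite mulrDr; lra.
  apply: (le_trans (lexp_near0 mu1 bu uC h3)).
  by move: h1; rewrite mulrDr [_ * (2 * _)]mulrC; lra.
have B0 : 0 < `|b| by rewrite normr_gt0.
have K0 : 0 < 2 * C + 1 by rewrite ltr_wpDl ?mulr_ge0.
exists (Num.min (`|b| / 2) (e * `|b| / (2 * C + 1))).
  by rewrite lt_min !divr_gt0// mulr_gt0.
move=> c; rewrite le_min => /andP[h1 h2].
have c0 : c != 0.
  by apply: contraTneq h1 => ->; rewrite sub0r normrN -ltNge; lra.
have := lexp_near mu1 c0 b0 bu uC; rewrite distrC (distrC b) => h.
apply: (le_trans h); rewrite ler_pdivrMr//.
rewrite ler_pdivlMr// in h2; apply: le_trans h2.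
have := normr_ge0 (c - b); move: `|c - b| => x x0; rewrite mulrDr mulr1 mulrC.
by rewrite lerDl.
Qed.

End lexp_limits.

(** * Calculus of the horizontal derivatives and dilated cutoffs *)

Section subgradient_calculus.
Variables (R : realType) (N1 M : nat).
Notation N := (N1 + M)%N.
Notation pt := 'rV[R]_N.
Variables (op : pt -> pt -> pt) (inv : pt -> pt) (sigma : 'I_N -> nat).
Hypothesis G : carnot_group op inv sigma.
Notation dil := (@dil R N1 M sigma).

Lemma is_derive_Zop j (g : pt -> R) x : smooth g ->
  is_derive (0 : R) 1 (fun s : R => g (op x (s *: ej R M j))) (Zop op j g x).
Proof.
move=> sg.
have dx : is_derive (0 : R) 1 (fun s : R => op x (s *: ej R M j)) (left_field op (ej R M j) x).
  have dop : derivable (op x) 0 (ej R M j) by apply: smooth_derivable; exact: (smooth_opl G).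
  by have := derivable_line0 dop; under eq_fun do rewrite add0r.
have := is_derive_comp_smoothR sg dx; rewrite scale0r (cg_x0 G) => H.
by rewrite (ZopE G).
Qed.

Lemma ZopM j (f g : pt -> R) x : smooth f -> smooth g ->
  Zop op j (fun y => f y * g y) x = f x * Zop op j g x + g x * Zop op j f x.
Proof.
move=> sf sg.
have := is_deriveM (is_derive_Zop j x sf) (is_derive_Zop j x sg).
rewrite scale0r (cg_x0 G) => H.
by rewrite /Zop derive1E (@derive_val _ _ _ _ _ _ _ H).
Qed.

Lemma Zop_expR j (k : R) (u : pt -> R) x : smooth u ->
  Zop op j (fun y => expR (k * u y)) x = k * Zop op j u x * expR (k * u x).
Proof.
move=> su.
have d1 : is_derive (0 : R) 1 (fun s : R => k * u (op x (s *: ej R M j))) (k * Zop op j u x).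
  exact: is_deriveZ (is_derive_Zop j x su).
have := @is_derive1_comp R expR _ 0 _ _ (is_derive_expR _) d1.
rewrite scale0r (cg_x0 G) => H.
by rewrite /Zop derive1E (@derive_val _ _ _ _ _ _ _ H) mulrC.
Qed.

(** The first layer has weight 1, so dilating the argument multiplies Z_j by l; the horizontal
    gradient of [cutoff_seq n] is therefore O(1/(n+1)) uniformly. *)
Lemma Zop_dil j (l : R) (g : pt -> R) x : smooth g -> 0 < l ->
  Zop op j (fun y => g (dil l y)) x = l * Zop op j g (dil l x).
Proof.
move=> sg l0.
have d1 : is_derive (l * 0 + 0) 1 (fun s : R => g (op (dil l x) (s *: ej R M j))) (Zop op j g (dil l x)).
  by rewrite mulr0 addr0; exact: is_derive_Zop.
have := is_derive_comp_affine d1.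
have -> : (fun s : R => g (op (dil l x) ((l * s + 0) *: ej R M j))) =
    (fun s : R => g (dil l (op x (s *: ej R M j)))).
  apply/funext => s; rewrite (cg_dil_aut G)//; congr (g (op _ _)).
  by rewrite addr0 linearZ/= dil_delta (cg_sigma_1 G) expr1 scalerA mulrC.
by move=> H; rewrite /Zop derive1E (@derive_val _ _ _ _ _ _ _ H).
Qed.

Lemma csupp_Zop j (g : pt -> R) : smooth g -> csupp g -> csupp (Zop op j g).
Proof.
move=> sg [s Hs]; exists s => z sz; rewrite (ZopE G)//.
set v := left_field _ _ _.
rewrite -(derive_cst (0 : R) z v); apply: near_eq_derive.
have o : open [set y : pt | s < `|y|].
  by apply: (@open_comp _ _ (fun y : pt => `|y|) [set y | s < y]) => [y _|];
    [exact: norm_continuous|exact: open_gt].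
by apply: filterS (open_nbhs_nbhs (conj o sz)) => y; exact: Hs.
Qed.

Lemma csupp_bounded (g : pt -> R) : smooth g -> csupp g ->
  exists2 B : R, 0 <= B & forall x, `|g x| <= B.
Proof.
move=> sg [s Hs].
have sk : smooth (fun p : pt * pt => g p.1) by exact: smooth_comp_rV sg (@smooth_fst R pt pt).
have [B B0 HB] := @continuous_bounded_ball R N _ 0 s (smooth_continuous sk).
exists B => // x; have [xs|xs] := leP `|x| s; first by apply: (HB x 0) => //; rewrite normr0.
by rewrite Hs// normr0.
Qed.

Definition cutoff (x : pt) : R := bump_fun x / bump_fun (0 : pt).

Lemma bump_fun0_gt0 : 0 < bump_fun (0 : pt).
Proof. by apply/bump_fun_gt0 => i; rewrite mxE; lra. Qed.

Lemma cutoff0 : cutoff 0 = 1.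
Proof. by rewrite /cutoff divff// gt_eqF// bump_fun0_gt0. Qed.

Lemma smooth_cutoff : smooth cutoff.
Proof.
have := smoothZ (bump_fun (0 : pt))^-1 (@smooth_bump_fun R N).
by congr smooth; apply/funext => z; rewrite mulrC.
Qed.

Lemma cutoff_supp (x : pt) : 1 < `|x| -> cutoff x = 0.
Proof.
move=> x1; rewrite /cutoff; suff -> : bump_fun x = 0 by rewrite mul0r.
apply/eqP; rewrite eq_le bump_fun_ge0 andbT leNgt; apply/negP.
move=> /bump_fun_gt0 H; move: x1; rewrite ltNge => /negP; apply.
by apply: rV_norm_le => // i; have := H i; rewrite ler_norml => /andP[/ltW -> /ltW ->].
Qed.

Definition cutoff_seq (n : nat) (x : pt) : R := cutoff (dil n.+1%:R^-1 x).

Lemma smooth_dil l : smooth (dil l).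
Proof. exact: smooth_linear (@rV_linear_continuous R _ _ (dil l)). Qed.

Lemma smooth_cutoff_seq n : smooth (cutoff_seq n).
Proof. exact: smooth_comp_rV smooth_cutoff (smooth_dil _). Qed.

Lemma csupp_cutoff_seq n : csupp (cutoff_seq n).
Proof.
pose l : R := n.+1%:R^-1; have l0 : 0 < l by rewrite invr_gt0.
exists (\sum_i l ^- sigma i) => x xs; apply: cutoff_supp; rewrite ltNge; apply/negP => dx.
move: xs; rewrite ltNge => /negP; apply; apply: rV_norm_le => [|i].
  by apply: sumr_ge0 => i _; rewrite invr_ge0 exprn_ge0// ltW.
have := le_trans (rV_coord_le_norm _ i) dx; rewrite mxE -/l normrM.
rewrite [`|l ^+ _|]ger0_norm; last by rewrite exprn_ge0// ltW.
move=> h.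
have {}h : `|x 0 i| <= l ^- sigma i by rewrite -[leRHS]mulr1 ler_pdivlMl ?exprn_gt0.
apply: (le_trans h); rewrite (bigD1 i)//= lerDl; apply: sumr_ge0 => k _.
by rewrite invr_ge0 exprn_ge0// ltW.
Qed.

Lemma cutoff_seq_cvg x : cutoff_seq ^~ x @ \oo --> (1 : R).
Proof.
have -> : (1 : R) = cutoff (dil 0 x) by rewrite (dil_0 (sigma_gt0 G)) cutoff0.
have sc : smooth (fun s : R => cutoff (dil s x)).
  exact: smooth_comp_rV smooth_cutoff (smooth_dil_curve sigma x).
have c0 : (fun n : nat => n.+1%:R^-1 : R) @ \oo --> (0 : R).
  apply/cvgrPdist_lt => e e0; near=> n; rewrite sub0r normrN ger0_norm ?invr_ge0//.
  by near: n; exact: (near_infty_natSinv_lt (PosNum e0)).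
exact: (continuous_cvg _ (smooth_continuous sc 0) c0).
Unshelve. all: by end_near. Qed.

End subgradient_calculus.

(** Uniform domination of the entropy integrands, including the zeros of the cutoff. Both sides come
    from ln y <= y - 1, at y = t and y = 1/t. *)
Lemma xlnx_bound (R : realType) (t D : R) : 0 <= t <= D -> `|t * ln t| <= D ^+ 2 + 1.
Proof.
move=> /andP[]; rewrite le_eqVlt => /orP[/eqP <- _|t0 tD].
  by rewrite mul0r normr0 addr_ge0// sqr_ge0.
have h1 : ln t <= t - 1.
  by have := @le_ln1Dx R (t - 1); rewrite (_ : 1 + (t - 1) = t); [apply; lra|ring].
have h2 : - ln t <= t^-1 - 1.
  have tV : 0 < t^-1 by rewrite invr_gt0.
  rewrite -lnV ?posrE//; have := @le_ln1Dx R (t^-1 - 1).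
  by rewrite (_ : 1 + (t^-1 - 1) = t^-1); [apply; lra|ring].
have h3 : t * (- ln t) <= 1 - t.
  have -> : 1 - t = t * (t^-1 - 1) by rewrite mulrBr divff ?gt_eqF// mulr1.
  by rewrite ler_pM2l.
have h4 : t * ln t <= t * (t - 1) by rewrite ler_pM2l.
have h5 : t * t <= D * D by rewrite ler_pM// ltW.
rewrite mulrBr mulr1 in h4; rewrite mulrN in h3.
have h6 : 0 <= t * t by rewrite mulr_ge0// ltW.
by rewrite ler_norml expr2; apply/andP; split; lra.
Qed.

(** * From compactly supported functions to exponentials *)

Section lsi_extension.
Variables (R : realType) (N1 M : nat).
Notation N := (N1 + M)%N.
Notation pt := 'rV[R]_N.
Notation T := (RN R N).
Variables (op : pt -> pt -> pt) (inv : pt -> pt) (sigma : 'I_N -> nat).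
Hypothesis G : carnot_group op inv sigma.
Variable mu : {measure set T -> \bar R}.
Hypothesis mu1 : mu [set: T] = 1%E.
Variable rho : R.
Hypothesis LSI : forall f : pt -> R, smooth f ->
  (exists K : set pt, compact K /\ forall x, ~ K x -> f x = 0) ->
  rho * (Rintegral mu [set: T] (fun x => f x ^+ 2 * ln (f x ^+ 2))
         - Rintegral mu [set: T] (fun x => f x ^+ 2)
           * ln (Rintegral mu [set: T] (fun x => f x ^+ 2)))
  <= 2 * Rintegral mu [set: T] (fun x => subgrad_norm op f x ^+ 2).
Notation Ex f := (Rintegral mu [set: T] f).

Lemma subgrad_norm_sqr f x : subgrad_norm op f x ^+ 2 = gamma2 op f x.
Proof. by rewrite /subgrad_norm sqr_sqrtr//; exact: gamma2_ge0. Qed.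

Lemma smooth_gamma2 (f : pt -> R) : smooth f -> smooth (gamma2 op f).
Proof.
by move=> sf; apply: smooth_sum => j; apply: smoothX; exact: (smooth_Zop G).
Qed.

(** The inequality is applied to v times a dilated cutoff and passed to the limit by bounded
    convergence, the cutoff's gradient tending to 0. The lower bound a > 0 makes the logarithms
    continuous at their limits. *)
Lemma lsi_bounded (v : pt -> R) (a B K : R) : smooth v -> 0 < a -> (forall x, a <= v x <= B) ->
  (forall x, gamma2 op v x <= K) ->
  rho * (Ex (fun x => v x ^+ 2 * ln (v x ^+ 2)) -
    Ex (fun x => v x ^+ 2) * ln (Ex (fun x => v x ^+ 2))) <= 2 * Ex (gamma2 op v).
Proof.
move=> sv a0 vab gK.
have vB x : 0 < v x <= B by have /andP[h1 ->] := vab x; rewrite (lt_le_trans a0 h1).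
have B0 : 0 <= B by have /andP[h1 h2] := vB 0; exact: ltW (lt_le_trans h1 h2).
pose chi := @cutoff_seq R N1 M sigma; pose f n x := v x * chi n x.
have schi n : smooth (chi n) by exact: smooth_cutoff_seq.
have sf n : smooth (f n) := smoothM sv (schi n).
have cf n : exists K : set pt, compact K /\ forall x, ~ K x -> f n x = 0.
  have [s Hs] := @csupp_cutoff_seq R N1 M sigma n.
  exists [set x : pt | `|x| <= s]; split; first exact: closed_ball0_compact.
  by move=> x /negP; rewrite -ltNge => /Hs h; rewrite /f /chi h mulr0.
have ccut : csupp (@cutoff R N1 M) by exists 1 => x x1; exact: cutoff_supp.
have [b b0 Hb] := csupp_bounded (@smooth_cutoff R N1 M) ccut.
have /choice[bZ HbZ] : forall j, exists c : R, forall x, `|Zop op j (@cutoff R N1 M) x| <= c.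
  move=> j; have [c _ Hc] := csupp_bounded (smooth_Zop G j (@smooth_cutoff R N1 M))
    (csupp_Zop G j (@smooth_cutoff R N1 M) ccut).
  by exists c.
have chib n x : `|chi n x| <= b by exact: Hb.
have Zchi n j x : Zop op j (chi n) x = n.+1%:R^-1 * Zop op j (@cutoff R N1 M) (dil sigma n.+1%:R^-1 x).
  by apply: (Zop_dil G); [exact: smooth_cutoff|rewrite invr_gt0].
have Zchib n j x : `|Zop op j (chi n) x| <= bZ j.
  rewrite Zchi normrM ger0_norm ?invr_ge0// -[leRHS]mul1r ler_pM ?invr_ge0//.
  by rewrite invf_le1// ler1n.
have nbv x : `|v x| <= B by have /andP[h1 h2] := vB x; rewrite gtr0_norm.
have fB n x : f n x ^+ 2 <= (B * b) ^+ 2.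
  rewrite -[f n x ^+ 2]real_normK ?num_real// lerXn2r ?nnegrE ?mulr_ge0//.
  by rewrite normrM ler_pM.
have mS (g : pt -> R) : smooth g -> measurable_fun [set: T] (g : T -> R).
  by move=> sg; exact: continuous_RN_measurable (smooth_continuous sg).
have fv x : f ^~ x @ \oo --> v x.
  have cv : (fun _ : nat => v x) @ \oo --> v x by exact: cvg_cst.
  by rewrite -[X in _ --> X]mulr1; exact: cvgM cv (cutoff_seq_cvg G x).
have f2 x : (fun n => f n x ^+ 2) @ \oo --> v x ^+ 2 by exact: cvgM (fv x) (fv x).
have c1 : (fun n => Ex (fun x => f n x ^+ 2)) @ \oo --> Ex (fun x => v x ^+ 2).
  apply: (cvg_Ex_bounded mu1 (C := (B * b) ^+ 2)) => //.
    by move=> n; exact: mS _ (smoothX 2 (sf n)).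
  by move=> n x; rewrite ger0_norm ?sqr_ge0.
have c2 : (fun n => Ex (fun x => f n x ^+ 2 * ln (f n x ^+ 2))) @ \oo -->
    Ex (fun x => v x ^+ 2 * ln (v x ^+ 2)).
  apply: (cvg_Ex_bounded mu1 (C := ((B * b) ^+ 2) ^+ 2 + 1)).
  - move=> n; have m2 : measurable_fun [set: T] (fun x : T => f n x ^+ 2).
      exact: mS _ (smoothX 2 (sf n)).
    apply: measurable_funM => //.
    exact: (measurableT_comp (@measurable_ln R) m2).
  - by move=> n x; apply: xlnx_bound; rewrite sqr_ge0 fB.
  - move=> x; have v2 : 0 < v x ^+ 2 by rewrite exprn_gt0//; have /andP[] := vB x.
    have cl := continuous_cvg _ (continuous_ln v2) (f2 x).
    exact: cvgM (f2 x) (cl _).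
have Zf n j x : Zop op j (f n) x = v x * Zop op j (chi n) x + chi n x * Zop op j v x.
  exact: (ZopM G j x sv (schi n)).
have c3 : (fun n => Ex (gamma2 op (f n))) @ \oo --> Ex (gamma2 op v).
  apply: (cvg_Ex_bounded mu1 (C := 2 * (B ^+ 2 * \sum_j bZ j ^+ 2 + b ^+ 2 * K))).
  - by move=> n; exact: mS _ (smooth_gamma2 (sf n)).
  - move=> n x; rewrite ger0_norm ?gamma2_ge0//.
    apply: (@le_trans _ _ (\sum_j (2 * (B ^+ 2 * bZ j ^+ 2) + 2 * (b ^+ 2 * Zop op j v x ^+ 2)))).
      apply: ler_sum => j _; rewrite Zf.
      set p := v x * _; set q := chi n x * _.
      have h1 : p ^+ 2 <= B ^+ 2 * bZ j ^+ 2.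
        rewrite -exprMn -[p ^+ 2]real_normK ?num_real// lerXn2r ?nnegrE ?mulr_ge0//.
          exact: le_trans (Zchib n j x).
        by rewrite normrM ler_pM.
      have h2 : q ^+ 2 <= b ^+ 2 * Zop op j v x ^+ 2.
        rewrite /q exprMn ler_wpM2r ?sqr_ge0//.
        by rewrite -[chi n x ^+ 2]real_normK ?num_real// lerXn2r ?nnegrE.
      have h3 := sqr_ge0 (p - q).
      have h4 : (p + q) ^+ 2 + (p - q) ^+ 2 = 2 * p ^+ 2 + 2 * q ^+ 2 by ring.
      by move: h1 h2 h3 h4; move: ((p + q) ^+ 2) ((p - q) ^+ 2) (p ^+ 2) (q ^+ 2) => *; lra.
    rewrite big_split/= -!mulr_sumr -mulrDr ler_wpM2l// lerD2l ler_wpM2l ?sqr_ge0//.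
    exact: gK.
  - move=> x; apply: cvg_sumr => j.
    have h : (fun n => Zop op j (f n) x) @ \oo --> Zop op j v x.
      have h1 : (fun n => Zop op j (chi n) x) @ \oo --> (0 : R).
        apply/cvgrPdist_le => e e0; have bj0 : 0 <= bZ j := le_trans (normr_ge0 _) (HbZ j 0).
        have eb : 0 < e / (bZ j + 1) by rewrite divr_gt0// ltr_wpDl.
        near=> n; rewrite sub0r normrN Zchi normrM ger0_norm ?invr_ge0//.
        apply: (@le_trans _ _ (n.+1%:R^-1 * (bZ j + 1))).
          by rewrite ler_wpM2l ?invr_ge0// (le_trans (HbZ j _))// lerDl.
        rewrite -ler_pdivlMr ?ltr_wpDl//; apply: ltW.
        by near: n; exact: (near_infty_natSinv_lt (PosNum eb)).
      have cv : (fun _ : nat => v x) @ \oo --> v x by exact: cvg_cst.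
      have cz : (fun _ : nat => Zop op j v x) @ \oo --> Zop op j v x by exact: cvg_cst.
      have E : Zop op j v x = v x * 0 + 1 * Zop op j v x by rewrite mulr0 add0r mul1r.
      rewrite [X in _ --> X]E.
      have -> : (fun n => Zop op j (f n) x) =
        (fun n => v x * Zop op j (chi n) x + chi n x * Zop op j v x) by apply/funext.
      apply: cvgD; first exact: cvgM cv h1.
      exact: cvgM (cutoff_seq_cvg G x) cz.
    by have h' := h; exact: cvgM h h'.
have v2 : 0 < Ex (fun x => v x ^+ 2).
  apply: (@lt_le_trans _ _ (Ex (fun=> a ^+ 2))); first by rewrite Ex_cst// exprn_gt0.
  apply: le_Ex => //; first exact: bmeas_cst.
    split; first exact: mS _ (smoothX 2 sv).
    by exists (B ^+ 2) => x; rewrite normrX lerXn2r ?nnegrE.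
  by move=> x; have /andP[h1 h2] := vab x; rewrite lerXn2r ?nnegrE ?(ltW a0)// (le_trans (ltW a0)).
have cl := continuous_cvg _ (continuous_ln v2) c1.
have cr : (fun _ : nat => rho) @ \oo --> rho by exact: cvg_cst.
have c22 : (fun _ : nat => 2 : R) @ \oo --> (2 : R) by exact: cvg_cst.
apply: (ler_cvg_to (cvgM cr (cvgB c2 (cvgM c1 (cl _)))) (cvgM c22 c3)).
near=> n; have := LSI (sf n) (cf n).
by under [X in _ <= 2 * X]eq_Rintegral do rewrite subgrad_norm_sqr.
Unshelve. all: by end_near.
Qed.

(** Take v = e^(k u / 2): then |grad v|^2 = (k^2 / 4) |grad u|^2 e^(k u), and the factor 2 of the
    inequality gives k^2 / 2. *)
Lemma lsi_exp (u : pt -> R) (C K k : R) : smooth u -> (forall x, `|u x| <= C) ->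
  (forall x, gamma2 op u x <= K) ->
  rho * (Ex (fun x => k * u x * expR (k * u x)) -
    Ex (fun x => expR (k * u x)) * ln (Ex (fun x => expR (k * u x)))) <=
  k ^+ 2 / 2 * Ex (fun x => gamma2 op u x * expR (k * u x)).
Proof.
move=> su uC gK.
pose v x := expR (k / 2 * u x).
have v2 x : v x ^+ 2 = expR (k * u x).
  by rewrite /v -expRM_natl; congr expR; field.
have sv : smooth v by apply: (smooth_comp1 (@smooth_expR R)); exact: smoothZ.
have gv x : gamma2 op v x = k ^+ 2 / 4 * (gamma2 op u x * expR (k * u x)).
  rewrite /gamma2 mulr_suml mulr_sumr; apply: eq_bigr => j _.
  by rewrite (Zop_expR G)// -/(v x) -v2; field.
have ku x : `|k * u x| <= `|k| * C by rewrite normrM ler_wpM2l.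
have vB x : expR (- (`|k| * C)) <= v x <= expR (`|k| * C).
  rewrite !ler_expR -ler_norml -mulrA (mulrC 2^-1) mulrA normrM.
  have -> : `|2^-1 : R| = 2^-1 by rewrite ger0_norm ?invr_ge0.
  by have := ku x; have := normr_ge0 (k * u x); lra.
have gvB x : gamma2 op v x <= k ^+ 2 / 4 * (K * expR (`|k| * C)).
  rewrite gv ler_wpM2l ?divr_ge0 ?sqr_ge0// ler_pM ?gamma2_ge0 ?expR_ge0//.
  by rewrite ler_expR (le_trans (ler_norm _)).
have := lsi_bounded sv (expR_gt0 _) vB gvB.
have -> : (fun x => v x ^+ 2 * ln (v x ^+ 2)) = (fun x => k * u x * expR (k * u x)).
  by apply/funext => x; rewrite v2 expRK mulrC.
have -> : (fun x => v x ^+ 2) = (fun x => expR (k * u x)) by apply/funext => x; exact: v2.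
have -> : gamma2 op v = (fun x => k ^+ 2 / 4 * (gamma2 op u x * expR (k * u x))).
  by apply/funext.
rewrite ExZ//; last first.
  apply: bmeasM.
    split; first exact: continuous_RN_measurable (smooth_continuous (smooth_gamma2 su)).
    by exists K => x; rewrite ger0_norm ?gamma2_ge0.
  apply: bmeas_expR; apply: bmeasZ; split; last by exists C.
  exact: continuous_RN_measurable (smooth_continuous su).
move=> h; apply: (le_trans h); rewrite mulrA.
by rewrite (_ : 2 * (k ^+ 2 / 4) = k ^+ 2 / 2)//; field.
Qed.

End lsi_extension.

(** * Hypercontractivity *)

Section regularized_flow.
Variables (R : realType) (N1 M : nat).
Notation N := (N1 + M)%N.
Notation pt := 'rV[R]_N.
Notation T := (RN R N).
Variables (op : pt -> pt -> pt) (inv : pt -> pt) (sigma : 'I_N -> nat).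
Hypothesis G : carnot_group op inv sigma.
Hypothesis horm : hormander op.
Variable lam : {measure set T -> \bar R}.
Hypothesis lam_box : forall a b : pt, (forall i, a 0 i <= b 0 i) ->
  lam (cbox a b) = (\prod_i (b 0 i - a 0 i))%:E.
Variables (f : pt -> R) (C t0 : R) (m : nat).
Hypothesis fC : forall x, `|f x| <= C.
Hypothesis t0_gt0 : 0 < t0.

(** The shift by [t0] > 0 makes the mollified function continuous and locally Lipschitz for d
    already at flow time 0, which bounds its gradient. *)
Definition flow (t : R) : pt -> R := mollify op inv lam m (hopf_lax op (t0 + t) f).

Lemma hopf_lax_bmeas (t : R) : 0 < t -> @bmeas _ T R (hopf_lax op t f).
Proof.
move=> t_gt0; split; last by exists C => x; apply: (hopf_lax_bound G fC); exact: ltW.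
exact: continuous_RN_measurable (hopf_lax_continuous G horm fC t_gt0).
Qed.

Let pos (t : R) : 0 <= t -> 0 < t0 + t. Proof. by move=> t_ge0; exact: ltr_wpDr. Qed.
Let bQ (t : R) (ht : 0 <= t) := hopf_lax_bmeas (pos ht).

Lemma smooth_flow (t : R) : 0 <= t -> smooth (flow t).
Proof. by move=> ht; exact: (smooth_mollify G lam_box m (bQ ht)). Qed.

Lemma flow_bound (t : R) x : 0 <= t -> `|flow t x| <= C.
Proof.
move=> ht; apply: (mollify_bound G lam_box m x (bQ ht)) => y.
by apply: (hopf_lax_bound G fC); exact: ltW (pos ht).
Qed.

Lemma flow_mono (t s : R) x : 0 <= t -> 0 <= s -> flow (t + s) x <= flow t x.
Proof.
move=> ht hs; rewrite -[leRHS]add0r.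
apply: (mollify_le G lam_box (bQ (addr_ge0 ht hs)) (bQ ht)) => z _.
by rewrite add0r addrA; apply: (hopf_lax_mono G horm fC) => //; exact: ltW (pos ht).
Qed.

(* The Hopf-Lax semigroup inequality survives the mollification because
   left translations are isometries. *)
Lemma flow_step (t s al : R) x y : 0 <= t -> 0 < s -> 0 <= al ->
  cc_dist op x y <= al -> flow (t + s) x <= al ^+ 2 / (2 * s) + flow t y.
Proof.
move=> ht hs hal dxy.
apply: (mollify_le G lam_box (bQ (addr_ge0 ht (ltW hs))) (bQ ht)) => z _.
rewrite addrA; apply: (le_trans (hopf_lax_semigroup G horm fC _ (op z y) (ltW (pos ht)) hs)).
rewrite lerD2r (cc_dist_op G horm) ler_pM2r ?invr_gt0 ?mulr_gt0//.
by rewrite lerXn2r ?nnegrE// (cc_dist_ge0 G).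
Qed.

Lemma flow_gamma2_bound (t : R) : 0 <= t -> exists K, forall x, gamma2 op (flow t) x <= K.
Proof.
move=> ht; have [L L0 HL] := hopf_lax_lipschitz G horm fC (pos ht).
exists (L ^+ 2) => x; apply: (gamma2_le_lipschitz G horm x (smooth_flow ht) L0) => y z yz.
rewrite addrC; apply: (mollify_le G lam_box (bQ ht) (bQ ht)) => a _.
by rewrite [leRHS]addrC -(cc_dist_op G horm a y z); apply: HL; rewrite (cc_dist_op G horm).
Qed.

Lemma gamma2_direction (g : pt -> R) x : 0 < gamma2 op g x -> forall c : R, `|c| = 1 ->
  exists p : R, exists h : 'rV[R]_N1, [/\ 0 < p, p ^+ 2 = gamma2 op g x,
    \sum_j (h 0 j) ^+ 2 <= 1 & \sum_j h 0 j * Zop op j g x = c * p].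
Proof.
move=> g0 c c1; have p0 : 0 < Num.sqrt (gamma2 op g x) by rewrite sqrtr_gt0.
have pg : Num.sqrt (gamma2 op g x) ^+ 2 = gamma2 op g x by rewrite sqr_sqrtr// ltW.
have [h [h1 h2]] := gamma2_unit p0 pg c1.
by exists (Num.sqrt (gamma2 op g x)), h.
Qed.

(** With p = |grad u(t)|(x), the unit descent control is followed for time p s. The cost (p s)^2 /
    (2 s) is s p^2 / 2 and u(t) drops by s p^2 up to e s. Where the gradient vanishes, monotonicity
    in time suffices. *)
Lemma flow_right (t : R) x (e : R) : 0 <= t -> 0 < e -> exists2 de : R, 0 < de &
  forall s, 0 < s < de -> flow (t + s) x - flow t x <= s * (e - gamma2 op (flow t) x / 2).
Proof.
move=> ht e0; have := gamma2_ge0 op (flow t) x; rewrite le_eqVlt => /orP[/eqP <-|g0].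
  exists 1 => // s /andP[s0 _]; rewrite mul0r subr0.
  apply: (@le_trans _ _ 0); last by rewrite mulr_ge0// ltW.
  by rewrite subr_le0; apply: flow_mono => //; exact: ltW.
have c1 : `|-1 : R| = 1 by rewrite normrN1.
have [p [h [p0 pg h1 h2]]] := gamma2_direction g0 c1.
have ep : 0 < e / p by rewrite divr_gt0.
have [de de0 H] := exp_curve_expansion G h x (smooth_flow ht) ep.
exists (de / p); first by rewrite divr_gt0.
move=> s /andP[s0 sd]; have ps : 0 <= p * s < de.
  by rewrite mulr_ge0 ?ltW//= mulrC -ltr_pdivlMr.
have ps0 : 0 <= p * s by case/andP: ps.
have := H (p * s) ps; rewrite h2 ler_norml => /andP[_ h3].
have := flow_step ht s0 ps0 (cc_dist_exp_curve G x ps0 h1).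
have -> : (p * s) ^+ 2 / (2 * s) = s * p ^+ 2 / 2 by field; rewrite gt_eqF.
have E : e / p * (p * s) = e * s by field; rewrite gt_eqF.
rewrite E in h3; rewrite -pg.
have E2 : p * s * (-1 * p) = - (s * p ^+ 2) by ring.
rewrite E2 in h3; move: h3; move: (flow t _) (flow _ x) (flow t x) => c2 c3 c4.
have -> : s * (e - p ^+ 2 / 2) = e * s - s * p ^+ 2 / 2 by ring.
by move: (s * p ^+ 2) (e * s) => c5 c6; lra.
Qed.

(** The displaced point y now lies uphill and is the endpoint of the step from t - s to t: u(t)(y)
    <= s p^2 / 2 + u(t - s)(x). Only u(t) is expanded, so the gradient that appears is that of u(t)
    and not of u(t - s). *)
Lemma flow_left (t : R) x (e : R) : 0 < t -> 0 < e -> exists2 de : R, 0 < de &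
  forall s, 0 < s < de -> flow t x - flow (t - s) x <= s * (e - gamma2 op (flow t) x / 2).
Proof.
move=> ht0 e0; have ht := ltW ht0.
have := gamma2_ge0 op (flow t) x; rewrite le_eqVlt => /orP[/eqP <-|g0].
  exists t => // s /andP[s0 st]; rewrite mul0r subr0.
  apply: (@le_trans _ _ 0); last by rewrite mulr_ge0// ltW.
  by rewrite subr_le0 -{1}(subrK s t); apply: flow_mono; lra.
have [p [h [p0 pg h1 h2]]] := gamma2_direction g0 (normr1 R).
have ep : 0 < e / p by rewrite divr_gt0.
have [de de0 H] := exp_curve_expansion G h x (smooth_flow ht) ep.
exists (Num.min t (de / p)); first by rewrite lt_min ht0 divr_gt0.
move=> s /andP[s0]; rewrite lt_min => /andP[st sd]; have ps : 0 <= p * s < de.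
  by rewrite mulr_ge0 ?ltW//= mulrC -ltr_pdivlMr.
have ps0 : 0 <= p * s by case/andP: ps.
have := H (p * s) ps; rewrite h2 ler_norml => /andP[h3 _].
have ts : 0 <= t - s by rewrite subr_ge0 ltW.
have dy := cc_dist_exp_curve G x ps0 h1; rewrite (cc_dist_sym G horm) in dy.
have := flow_step ts s0 ps0 dy; rewrite subrK.
have -> : (p * s) ^+ 2 / (2 * s) = s * p ^+ 2 / 2 by field; rewrite gt_eqF.
have E : e / p * (p * s) = e * s by field; rewrite gt_eqF.
rewrite E in h3; rewrite -pg.
have E2 : p * s * (1 * p) = s * p ^+ 2 by ring.
rewrite E2 in h3; move: h3; move: (flow t _) (flow _ x) (flow t x) => c2 c3 c4.
have -> : s * (e - p ^+ 2 / 2) = e * s - s * p ^+ 2 / 2 by ring.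
by move: (s * p ^+ 2) (e * s) => c5 c6; lra.
Qed.

Variable mu : {measure set T -> \bar R}.
Hypothesis mu1 : mu [set: T] = 1%E.
Variable rho : R.
Hypothesis rho_gt0 : 0 < rho.
Hypothesis LSI : forall f : pt -> R, smooth f ->
  (exists K : set pt, compact K /\ forall x, ~ K x -> f x = 0) ->
  rho * (Rintegral mu [set: T] (fun x => f x ^+ 2 * ln (f x ^+ 2))
         - Rintegral mu [set: T] (fun x => f x ^+ 2)
           * ln (Rintegral mu [set: T] (fun x => f x ^+ 2)))
  <= 2 * Rintegral mu [set: T] (fun x => subgrad_norm op f x ^+ 2).

Lemma flow_hypercontractive (a t : R) : 0 <= t ->
  lexp mu (a + rho * t) (flow t : T -> R) <= lexp mu a (flow 0 : T -> R).
Proof.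
apply: (lexp_hypercontractive mu1 (Gam := fun t => gamma2 op (flow t)) (C := C) rho_gt0).
- by move=> s hs; exact: continuous_RN_measurable (smooth_continuous (smooth_flow hs)).
- by move=> s x; exact: flow_bound.
- move=> s hs; split.
    exact: continuous_RN_measurable (smooth_continuous (smooth_gamma2 G (smooth_flow hs))).
  have [K HK] := flow_gamma2_bound hs.
  by exists K => x; rewrite ger0_norm ?gamma2_ge0.
- by move=> s x; exact: gamma2_ge0.
- move=> k s hs; have [K HK] := flow_gamma2_bound hs.
  exact: (lsi_exp G mu1 LSI k (smooth_flow hs) (fun x => flow_bound x hs) HK).
- by move=> s r x; exact: flow_mono.
- by move=> s x e; exact: flow_right.
- by move=> s x e; exact: flow_left.
Qed.

End regularized_flow.

Lemma Lnorm_a_lexp (R : realType) (n : nat) (mu : {measure set (RN R n) -> \bar R})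
    (a : R) (w : 'rV[R]_n -> R) : mu [set: RN R n] = 1%E ->
  bmeas (w : RN R n -> R) ->
  Lnorm_a mu a (fun x => expR (w x)) = expR (lexp mu a (w : RN R n -> R)).
Proof.
move=> mu1 bw; rewrite /Lnorm_a /lexp; case: eqP => [_|_].
  by congr expR; apply: eq_Rintegral => x _; rewrite ger0_norm ?expR_ge0// expRK.
have -> : (fun x => `|expR (w x)| `^ a) = (fun x => expR (a * w x)).
  by apply/funext => x; rewrite ger0_norm ?expR_ge0// mulrC expRM.
have Z0 : 0 < Rintegral mu setT (fun x => expR (a * w x)) := Ex_expR_gt0 mu1 (bmeasZ a bw).
by rewrite /powR (gt_eqF Z0) mulrC.
Qed.

Section gibbs_measure.
Variables (R : realType) (N1 M : nat).
Notation N := (N1 + M)%N.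
Notation pt := 'rV[R]_N.
Notation T := (RN R N).
Variables (op : pt -> pt -> pt) (inv : pt -> pt) (sigma : 'I_N -> nat).
Hypothesis G : carnot_group op inv sigma.
Hypothesis horm : hormander op.
Variable lam : {measure set T -> \bar R}.
Hypothesis lam_box : forall a b : pt, (forall i, a 0 i <= b 0 i) ->
  lam (cbox a b) = (\prod_i (b 0 i - a 0 i))%:E.
Variables (U : R -> R) (U_incr : {homo U : s t / s <= t}).
Hypothesis U_int : lam.-integrable [set: T] (fun x => (expR (- U (cc_dist op x 0)))%:E).

(** By continuity of d, some Euclidean ball around 0 lies in d <= 1, where the density is at least
    e^(-U(1)) because U increases. *)
Lemma gibbs_mass_gt0 :
  0 < fine (\int[lam]_(x in [set: T]) (expR (- U (cc_dist op (x : pt) 0)))%:E)%E.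
Proof.
have near0 := cc_dist_near G horm 0 (ltr01 : 0 < 1 :> R).
have /nbhs_ballP[k /= k0 Hk] := near0.
apply: (Rintegral_gt0 lam_box (g := fun x : T => expR (- U (cc_dist op (x : pt) 0)))
  (c := expR (- U 1)) (k := k / 2)) => //.
- exact: expR_gt0.
- by rewrite divr_gt0.
move=> x xk; rewrite ler_expR lerN2; apply: U_incr; rewrite (cc_dist_sym G horm).
by apply: Hk; rewrite -ball_normE /= sub0r normrN (le_lt_trans xk)//; lra.
Qed.

Lemma gibbs_measure_setT (mu : {measure set T -> \bar R}) :
  (forall A : set T, measurable A ->
      mu A = ((\int[lam]_(x in A) (expR (- U (cc_dist op x 0)))%:E) *
              ((fine (\int[lam]_x (expR (- U (cc_dist op x 0)))%:E))^-1)%:E)%E) ->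
  mu [set: T] = 1%E.
Proof.
move=> ->//; have Z0 := gibbs_mass_gt0.
have fin := integrable_fin_num measurableT U_int.
by rewrite -{1}(fineK fin) -EFinM divff// gt_eqF.
Qed.

End gibbs_measure.

Theorem theorem15
  (R : realType) (N1 M : nat)
  (* the group law on R^N, N = N1 + M, with identity 0 and inverse inv *)
  (op : 'rV[R]_(N1 + M) -> 'rV[R]_(N1 + M) -> 'rV[R]_(N1 + M))
  (inv : 'rV[R]_(N1 + M) -> 'rV[R]_(N1 + M))
  (op_assoc : forall x y z, op x (op y z) = op (op x y) z)
  (op_0x : forall x, op 0 x = x) (op_x0 : forall x, op x 0 = x)
  (op_inv : forall x, op x (inv x) = 0 /\ op (inv x) x = 0)
  (* Lie group: smooth group operations *)
  (op_smooth : smooth (fun p : 'rV[R]_(N1 + M) * 'rV[R]_(N1 + M) => op p.1 p.2))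
  (inv_smooth : smooth inv)
  (* homogeneous dilations: weights 1 on the first layer R^N1, then 2, ..., r *)
  (sigma : 'I_(N1 + M) -> nat)
  (sigma_1 : forall i : 'I_N1, sigma (lshift M i) = 1%N)
  (sigma_2 : forall i : 'I_M, (2 <= sigma (rshift N1 i))%N)
  (sigma_mono : forall i j : 'I_(N1 + M), (i <= j)%N -> (sigma i <= sigma j)%N)
  (sigma_step : forall i j : 'I_(N1 + M), j = i.+1 :> nat -> (sigma j <= (sigma i).+1)%N)
  (dil_aut : forall l : R, 0 < l -> forall x y,
      dil sigma l (op x y) = op (dil sigma l x) (dil sigma l y))
  (* Hormander rank condition for Z_1, ..., Z_N1 *)
  (horm : hormander op)
  (* Lebesgue measure lambda on the Borel sets of R^N *)
  (lam : {measure set (RN R (N1 + M)) -> \bar R})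
  (lam_box : forall a b : 'rV[R]_(N1 + M), (forall i, a 0 i <= b 0 i) ->
      lam [set x : RN R (N1 + M) | forall i, a 0 i <= x 0 i <= b 0 i]
      = (\prod_i (b 0 i - a 0 i))%:E)
  (* the potential U and the probability measure mu = Z^-1 e^{-U(d)} lambda *)
  (U : R -> R) (U_incr : {homo U : s t / s <= t})
  (U_int : lam.-integrable [set: RN R (N1 + M)]
      (fun x => (expR (- U (cc_dist op x 0)))%:E))
  (mu : {measure set (RN R (N1 + M)) -> \bar R})
  (mu_def : forall A : set (RN R (N1 + M)), measurable A ->
      mu A = ((\int[lam]_(x in A) (expR (- U (cc_dist op x 0)))%:E) *
              ((fine (\int[lam]_x (expR (- U (cc_dist op x 0)))%:E))^-1)%:E)%E)
  (* the 2-logarithmic Sobolev inequality with constant rho *)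
  (rho : R) (rho_gt0 : 0 < rho)
  (LSI : forall f : 'rV[R]_(N1 + M) -> R, smooth f ->
      (exists K : set 'rV[R]_(N1 + M), compact K /\ forall x, ~ K x -> f x = 0) ->
      rho * (Rintegral mu [set: RN R (N1 + M)] (fun x => f x ^+ 2 * ln (f x ^+ 2))
             - Rintegral mu [set: RN R (N1 + M)] (fun x => f x ^+ 2)
               * ln (Rintegral mu [set: RN R (N1 + M)] (fun x => f x ^+ 2)))
      <= 2 * Rintegral mu [set: RN R (N1 + M)] (fun x => subgrad_norm op f x ^+ 2))
  (* f bounded measurable *)
  (f : 'rV[R]_(N1 + M) -> R)
  (f_meas : measurable_fun [set: RN R (N1 + M)] (f : RN R (N1 + M) -> R))
  (f_bnd : exists C : R, forall x, `|f x| <= C)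
  (t : R) (t_ge0 : 0 <= t) (a : R) :
  Lnorm_a mu (a + rho * t) (fun x => expR (hopf_lax op t f x))
  <= Lnorm_a mu a (fun x => expR (f x)).
Proof.
have G : carnot_group op inv sigma by split.
have lam_box' : forall a b : 'rV[R]_(N1 + M), (forall i, a 0 i <= b 0 i) ->
  lam (cbox a b) = (\prod_i (b 0 i - a 0 i))%:E by [].
have mu1 := gibbs_measure_setT G horm lam_box' U_incr U_int mu_def.
have [C fC] := f_bnd.
have bf : @bmeas _ (RN R (N1 + M)) R f by split.
have [->|t_neq0] := eqVneq t 0.
  have -> : hopf_lax op 0 f = f by apply/funext => x; rewrite /hopf_lax eqxx.
  by rewrite mulr0 addr0.
have t_gt0 : 0 < t by rewrite lt_neqAle eq_sym t_neq0.
have bQ s : 0 < s -> @bmeas _ (RN R (N1 + M)) R (hopf_lax op s f).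
  by move=> s0; exact: (hopf_lax_bmeas G horm fC s0).
rewrite !Lnorm_a_lexp//; last exact: bQ.
rewrite ler_expR.
(* The regularised flow starts at Hopf-Lax time s and runs for time t - s, so the exponent reached
   falls short of the target by rho s. *)
have delayed s : 0 < s -> s < t ->
    lexp mu (a + rho * (t - s)) (hopf_lax op t f) <= lexp mu a f.
  move=> s0 st; have ts : 0 <= t - s by rewrite subr_ge0 ltW.
  (* At the starting end the pointwise inequality Q_s f <= f takes the place of a limit s -> 0. *)
  apply: (@le_trans _ _ (lexp mu a (hopf_lax op s f))); last first.
    by apply: lexp_mono => //; [exact: bQ|move=> x; apply: (hopf_lax_le_id G fC); exact: ltW].
  have flow_cvg r : 0 <= r -> forall c,
      (fun m => lexp mu c (flow op inv lam f s m r)) @ \oo --> lexp mu c (hopf_lax op (s + r) f).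
    move=> r0 c; have sr : 0 < s + r by exact: ltr_wpDr.
    apply: (lexp_cvg mu1 (C := C)).
    - move=> m; apply: continuous_RN_measurable; apply: smooth_continuous.
      exact: (smooth_flow G horm lam_box' m fC s0 r0).
    - by move=> m x; exact: (flow_bound G horm lam_box' m fC s0 x r0).
    - move=> x; exact: (@mollify_cvg _ _ _ op inv sigma G lam lam_box' _ x (bQ _ sr)
        (hopf_lax_continuous G horm fC sr)).
    - exact: bQ.
  have h1 := flow_cvg _ ts (a + rho * (t - s)); rewrite (_ : s + (t - s) = t) in h1; last by rewrite addrC subrK.
  have h0 := flow_cvg 0 (lexx 0) a; rewrite addr0 in h0.
  apply: (ler_cvg_to h1 h0); apply: nearW => m.
  exact: (flow_hypercontractive G horm lam_box' m fC s0 mu1 rho_gt0 LSI a ts).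
apply/ler_addgt0Pr => /= e e0.
have QC x : `|hopf_lax op t f x| <= C by exact: (hopf_lax_bound G fC).
have [de de0 Hde] := lexp_continuous mu1 (a + rho * t) (bQ t t_gt0) QC e0.
(* The shortfall rho s of the exponent is at most [de], and Q_t f does not depend on s, so
   continuity in the exponent absorbs the delay. *)
pose s := Num.min (t / 2) (de / rho).
have s0 : 0 < s by rewrite lt_min !divr_gt0.
have st : s < t by rewrite gt_min ltr_pdivrMr// ltr_pMr// ltr1n.
have sde : s <= de / rho by rewrite ge_min lexx orbT.
have := Hde (a + rho * (t - s)).
have -> : a + rho * (t - s) - (a + rho * t) = - (rho * s) by ring.
rewrite normrN ger0_norm; last by rewrite mulr_ge0// ltW.
rewrite mulrC -ler_pdivlMr// => /(_ sde); rewrite ler_norml => /andP[h _].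
have := delayed s s0 st; move: h.
move: (lexp _ _ _) (lexp _ _ _) (lexp _ _ _) => c1 c2 c3; lra.
Qed.
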